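(* Let $X$ be an elliptic curve and $p\in X$. The bundle $E=\mathcal{O}\oplus\mathcal{O}$ on $X$ is strictly semistable with instability degree 0, all lines $\ell_p\in\mathbb{P}(E_p)$ are bad, and every Hecke modification $\alpha:F\to E$ at $p$ (for every line $\ell_p=\mathrm{im}(\alpha_p)$) has $F\cong\mathcal{O}\oplus\mathcal{O}(-p)$.
   Context: Let $E$ be a rank 2 holomorphic vector bundle over a curve $C$. A Hecke modification of $E$ at $p\in C$ is a rank 2 holomorphic bundle $F$ with a bundle map $\alpha:F\to E$ that is an isomorphism on fibers away from $p$ and that, in a local coordinate $z$ centered at $p$ and suitable local trivializations of $E$ and $F$ near $p$, is given by the matrix $\mathrm{diag}(1,z)$. Two Hecke modifications $\alpha:F\to E$, $\alpha':F'\to E$ at $p$ are equivalent if there is an isomorphism $\phi:F\to F'$ with $\alpha=\alpha'\circ\phi$. Equivalence classes correspond bijectively to lines $\ell_p\in\mathbb{P}(E_p)$ via $\ell_p=\mathrm{im}(\alpha_p:F_p\to E_p)$; the bundle $F$ for $\ell_p$ is the one whose sheaf of sections consists of the sections of $E$ whose value at $p$ lies in $\ell_p$. The instability degree of $E$ is $\deg M-\deg(E/M)$, where $M\subset E$ is a line subbundle of maximal degree. A line $\ell_p\in\mathbb{P}(E_p)$ is bad if there is a line subbundle $M\subset E$ of maximal degree with $M_p=\ell_p$, and good otherwise. *)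

(* Defs.v *)
From HB Require Import structures.
From mathcomp Require Import all_boot all_order all_algebra.
From mathcomp Require Import complex.
From mathcomp Require Import mathcomp_extra boolp classical_sets functions.
From mathcomp Require Import cardinality fsbigop reals topology normedtype derive.

Set Implicit Arguments.
Unset Strict Implicit.
Unset Printing Implicit Defensive.

Import Order.TTheory GRing.Theory Num.Theory.
Import numFieldNormedType.Exports.

Local Open Scope classical_set_scope.
Local Open Scope ring_scope.

(* The field of complex numbers is [R[i]] for a [realType] [R].  Its topology *)
(* and its normed space structure over itself are those of [R[i]^o], so that  *)
(* [derivable f z 1] for [f : R[i]^o -> R[i]^o] is complex differentiability. *)

Section Defs.
Variable R : realType.
Local Notation C := (R[i]).

(* [rs_coord c] is a homeomorphism from the open set [rs_dom c] onto an open  *)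
(* subset of the complex plane, with inverse [rs_par c]; the values of        *)
(* [rs_coord c] and [rs_par c] outside these two sets are irrelevant.         *)
Record riemannSurface := RiemannSurface {
  rs_space :> topologicalType ;
  rs_chart : Type ;
  rs_dom : rs_chart -> set rs_space ;
  rs_coord : rs_chart -> rs_space -> C ;
  rs_par : rs_chart -> C -> rs_space ;
  rs_hausdorff : hausdorff_space rs_space ;
  rs_nonempty : [set: rs_space] !=set0 ;
  rs_connected : connected [set: rs_space] ;
  rs_cover : forall x, exists c, rs_dom c x ;
  rs_dom_open : forall c, open (rs_dom c) ;
  rs_img_open : forall c, open (rs_coord c @` rs_dom c : set C^o) ;
  rs_coordK : forall c x, rs_dom c x -> rs_par c (rs_coord c x) = x ;
  rs_coord_cont : forall c x, rs_dom c x ->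
    {for x, continuous (rs_coord c : rs_space -> C^o)} ;
  rs_par_cont : forall c x, rs_dom c x ->
    {for (rs_coord c x : C^o), continuous (rs_par c : C^o -> rs_space)} ;
  rs_transition : forall c d x, rs_dom c x -> rs_dom d x ->
    derivable (rs_coord d \o rs_par c : C^o -> C^o) (rs_coord c x) 1
}.

Section OnSurface.
Variable X : riemannSurface.

(* For open [U]: [f] is holomorphic on [U]. *)
Definition holo_on (U : set X) (f : X -> C) :=
  forall c x, rs_dom c x -> U x ->
    derivable (f \o rs_par c : C^o -> C^o) (rs_coord c x) 1.

Definition holo_mx_on m n (U : set X) (g : X -> 'M[C]_(m, n)) :=
  forall k l, holo_on U (fun x => g x k l).

(* [h z = (z - a) ^ n * g z] near [a], off [a], with [g] holomorphic at [a]   *)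
(* and [g a != 0].                                                            *)
Definition has_order_C (h : C -> C) (a : C) (n : int) :=
  exists g : C -> C,
    [/\ \forall z \near (a : C^o), derivable (g : C^o -> C^o) z 1,
        g a != 0 &
        \forall z \near (a : C^o)^', h z = (z - a) ^ n * g z].

(* The value of [f] at [x] itself is irrelevant. *)
Definition has_order (f : X -> C) (x : X) (n : int) :=
  forall c, rs_dom c x -> has_order_C (f \o rs_par c) (rs_coord c x) n.

Definition meromorphic_at (f : X -> C) (x : X) :=
  forall c, rs_dom c x ->
    (\forall z \near (rs_coord c x : C^o)^', f (rs_par c z) = 0) \/
    (exists n, has_order_C (f \o rs_par c) (rs_coord c x) n).

(* A rank [r] bundle is a family of vector spaces with local trivializations  *)
(* [vb_triv i x : vb_fiber x -> C^r], for [x] in the open set [vb_dom i],     *)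
(* related by holomorphic transition matrices.  This determines the complex   *)
(* manifold structure of the total space.                                     *)
Record vbundle (r : nat) := VBundle {
  vb_fiber : X -> vectType C ;
  vb_idx : Type ;
  vb_dom : vb_idx -> set X ;
  vb_triv : vb_idx -> forall x, 'Hom(vb_fiber x, 'cV[C]_r) ;
  vb_dom_open : forall i, open (vb_dom i) ;
  vb_cover : forall x, exists i, vb_dom i x ;
  vb_triv_bij : forall i x, vb_dom i x -> bijective (vb_triv i x) ;
  vb_transition : forall i j, exists2 g : X -> 'M[C]_r,
    holo_mx_on (vb_dom i `&` vb_dom j) g &
    forall x v, (vb_dom i `&` vb_dom j) x ->
      vb_triv j x v = g x *m vb_triv i x v
}.

Arguments vb_dom {r} v i.
Arguments vb_triv {r} v i x.
Arguments vb_transition {r} v i j.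

Definition local_trivialization r (E : vbundle r) (U : set X)
    (tau : forall x, 'Hom(vb_fiber E x, 'cV[C]_r)) :=
  (forall x, U x -> bijective (tau x)) /\
  forall i, exists2 g : X -> 'M[C]_r,
    holo_mx_on (U `&` vb_dom E i) g &
    forall x v, (U `&` vb_dom E i) x -> tau x v = g x *m vb_triv E i x v.

Definition fiber_map r s (E : vbundle r) (F : vbundle s) :=
  forall x, 'Hom(vb_fiber E x, vb_fiber F x).

Definition bundle_map r s (E : vbundle r) (F : vbundle s)
    (alpha : fiber_map E F) :=
  forall i j, exists2 A : X -> 'M[C]_(s, r),
    holo_mx_on (vb_dom E i `&` vb_dom F j) A &
    forall x v, (vb_dom E i `&` vb_dom F j) x ->
      vb_triv F j x (alpha x v) = A x *m vb_triv E i x v.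

Definition bundle_iso r (E F : vbundle r) :=
  exists (phi : fiber_map E F) (psi : fiber_map F E),
    [/\ bundle_map phi, bundle_map psi &
        forall x, cancel (phi x) (psi x) /\ cancel (psi x) (phi x)].

Definition meromorphic_section r (E : vbundle r)
    (s : forall x, vb_fiber E x) :=
  forall i k x, vb_dom E i x ->
    meromorphic_at (fun y => vb_triv E i y (s y) k 0) x.

(* Component in the [i]-th trivialization of the section                      *)
(* [s 0 /\ ... /\ s (r - 1)] of [det E].                                      *)
Definition wedge r (E : vbundle r) (s : 'I_r -> forall x, vb_fiber E x)
    (i : vb_idx E) (x : X) : C :=
  \det (\matrix_(k, l) vb_triv E i x (s l x) k 0).

(* The degree of [E] is the degree of [det E], that is, the degree of the     *)
(* divisor [o] of a nonzero meromorphic section of [det E].  Meromorphic      *)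
(* sections of [det E] are all of the form [s 0 /\ ... /\ s (r - 1)] with     *)
(* meromorphic sections [s l] of [E].                                         *)
Definition has_degree r (E : vbundle r) (d : int) :=
  exists (s : 'I_r -> forall x, vb_fiber E x) (o : X -> int),
    [/\ forall l, meromorphic_section (s l),
        forall i x, vb_dom E i x -> has_order (wedge s i) x (o x),
        finite_set [set x | o x != 0] &
        d = \sum_(x \in [set: X]) o x].

(* On a compact Riemann surface, there is exactly one [d] with                *)
(* [has_degree E d].                                                          *)
Definition deg r (E : vbundle r) : int := xget 0 [set d | has_degree E d].

Definition slope r (E : vbundle r) : rat := (deg E)%:~R / r%:R.

(* A subbundle is given as a bundle [M] with an embedding [iota : M -> E];    *)
(* the corresponding subspace of the fiber at [x] is [limg (iota x)].         *)
Definition subbundle s r (M : vbundle s) (E : vbundle r)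
    (iota : fiber_map M E) :=
  bundle_map iota /\ forall x, injective (iota x).

Definition semistable r (E : vbundle r) :=
  forall s (M : vbundle s) (iota : fiber_map M E),
    (0 < s < r)%N -> subbundle iota -> slope M <= slope E.

Definition stable r (E : vbundle r) :=
  forall s (M : vbundle s) (iota : fiber_map M E),
    (0 < s < r)%N -> subbundle iota -> slope M < slope E.

Definition strictly_semistable r (E : vbundle r) :=
  semistable E /\ ~ stable E.

(* [q : E -> Q] exhibits [Q] as the quotient bundle [E / M]. *)
Definition quotient_bundle s r t (M : vbundle s) (E : vbundle r)
    (Q : vbundle t) (iota : fiber_map M E) (q : fiber_map E Q) :=
  bundle_map q /\
  forall x, limg (q x) = fullv /\ lker (q x) = limg (iota x).

Definition max_line_subbundle (E : vbundle 2) (M : vbundle 1)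
    (iota : fiber_map M E) :=
  subbundle iota /\
  forall (M' : vbundle 1) (iota' : fiber_map M' E),
    subbundle iota' -> deg M' <= deg M.

Definition instability_degree (E : vbundle 2) (n : int) :=
  exists (M Q : vbundle 1) (iota : fiber_map M E) (q : fiber_map E Q),
    [/\ max_line_subbundle iota, quotient_bundle iota q &
        n = deg M - deg Q].

(* Points of the projective line of the fiber at [p] are the subspaces of     *)
(* dimension 1.                                                               *)
Definition bad_line (E : vbundle 2) (p : X) (l : {vspace vb_fiber E p}) :=
  exists (M : vbundle 1) (iota : fiber_map M E),
    max_line_subbundle iota /\ limg (iota p) = l.

(* Near [p], [alpha] is given by [diag (1, z)] in suitable trivializations,   *)
(* where [z = rs_coord c - rs_coord c p].                                     *)
Definition hecke_modification (E F : vbundle 2) (p : X)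
    (alpha : fiber_map F E) :=
  [/\ bundle_map alpha,
      forall x, x <> p -> bijective (alpha x) &
      exists (c : rs_chart X) (U : set X)
             (tauE : forall x, 'Hom(vb_fiber E x, 'cV[C]_2))
             (tauF : forall x, 'Hom(vb_fiber F x, 'cV[C]_2)),
        [/\ open U, U p, U `<=` rs_dom c,
            local_trivialization U tauE /\ local_trivialization U tauF &
            forall x v, U x ->
              tauE x (alpha x v) =
              diag_mx (\row_(k < 2) (rs_coord c x - rs_coord c p) ^+ k)
                *m tauF x v]].

Lemma holo_on_cst (U : set X) (a : C) : holo_on U (fun=> a).
Proof. by move=> c x _ _; exact: derivable_cst. Qed.

Lemma holo_mx_on_cst m n (U : set X) (a : 'M[C]_(m, n)) :
  holo_mx_on U (fun=> a).
Proof. by move=> k l; exact: holo_on_cst. Qed.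

Definition scale_fun (a : C) (v : C^o) : 'cV[C]_1 := const_mx (a * v).

Lemma scale_fun_linear a : linear (scale_fun a).
Proof.
move=> k u v; apply/matrixP => i j; rewrite !mxE mulrDr.
by rewrite mulrCA.
Qed.

HB.instance Definition _ a := GRing.isLinear.Build C C^o 'cV[C]_1 _
  (scale_fun a) (scale_fun_linear a).

Definition scale_hom (a : C) : 'Hom(C^o, 'cV[C]_1) := linfun (scale_fun a).

Lemma scale_homE a v : scale_hom a v = const_mx (a * v).
Proof. by rewrite lfunE. Qed.

Lemma scale_hom_bij a : a != 0 -> bijective (scale_hom a).
Proof.
move=> a0; exists (fun w : 'cV[C]_1 => a^-1 * w 0 0 : C^o) => [v|w].
  by rewrite scale_homE mxE mulKf.
by apply/matrixP => i j; rewrite scale_homE mxE mulVKf // !ord1.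
Qed.

Lemma scale_hom_trans a b v : a != 0 ->
  scale_hom b v = (b / a)%:M *m scale_hom a v.
Proof.
move=> a0; rewrite !scale_homE mul_scalar_mx.
by apply/matrixP => i j; rewrite !mxE mulrA divfK.
Qed.

Definition line_triv (T : Type) (a : T -> X -> C) (i : T) (x : X) :
  'Hom(C^o, 'cV[C]_1) := scale_hom (a i x).

Lemma line_triv_bij (T : Type) (dom : T -> set X) (a : T -> X -> C) :
  (forall i x, dom i x -> a i x != 0) ->
  forall i x, dom i x -> bijective (line_triv a i x).
Proof. by move=> a0 i x ix; exact/scale_hom_bij/(a0 i). Qed.

Lemma line_transition (T : Type) (dom : T -> set X) (a : T -> X -> C) :
  (forall i x, dom i x -> a i x != 0) ->
  (forall i j, holo_on (dom i `&` dom j) (fun x => a j x / a i x)) ->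
  forall i j, exists2 g : X -> 'M[C]_1,
    holo_mx_on (dom i `&` dom j) g &
    forall x v, (dom i `&` dom j) x ->
      line_triv a j x v = g x *m line_triv a i x v.
Proof.
move=> a0 ha i j; exists (fun x => (a j x / a i x)%:M).
  move=> k l; have -> : (fun x => (a j x / a i x)%:M k l) =
      (fun x => a j x / a i x).
    by apply/funext => x; rewrite !ord1 mxE eqxx mulr1n.
  exact: ha.
by move=> x v [ix jx]; apply: scale_hom_trans; exact: (a0 i).
Qed.

Definition line_bundle (T : Type) (dom : T -> set X) (a : T -> X -> C)
    (dom_open : forall i, open (dom i))
    (dom_cover : forall x, exists i, dom i x)
    (a0 : forall i x, dom i x -> a i x != 0)
    (ha : forall i j, holo_on (dom i `&` dom j) (fun x => a j x / a i x)) :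
    vbundle 1 :=
  @VBundle 1 (fun=> C^o) T dom (line_triv a) dom_open dom_cover
    (line_triv_bij a0) (line_transition a0 ha).

Lemma O_trans (i j : unit) :
  holo_on ([set: X] `&` [set: X]) (fun=> (1 : C) / 1).
Proof. exact: holo_on_cst. Qed.

Definition O_bundle : vbundle 1 :=
  @line_bundle unit (fun=> [set: X]) (fun _ _ => 1)
    (fun=> openT) (fun=> ex_intro _ tt I) (fun _ _ _ => oner_neq0 C) O_trans.

Section Ominus.
Variable p : X.

Definition chart_at : rs_chart X := projT1 (cid (rs_cover p)).

Lemma chart_atP : rs_dom chart_at p.
Proof. exact: projT2 (cid (rs_cover p)). Qed.

Definition coord_at (x : X) : C := rs_coord chart_at x - rs_coord chart_at p.

Lemma coord_at_neq0 x : rs_dom chart_at x -> x != p -> coord_at x != 0.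
Proof.
move=> xc; apply: contra; rewrite subr_eq0 => /eqP xp.
by rewrite -(rs_coordK xc) xp (rs_coordK chart_atP).
Qed.

Lemma holo_coord_at : holo_on (rs_dom chart_at) coord_at.
Proof.
move=> c x cx x0.
apply: derivableB; last exact: derivable_cst.
exact: rs_transition.
Qed.

(* O(-p) is the line bundle whose sections are the functions vanishing at     *)
(* [p]: a local frame is 1 away from [p] (index [false]) and the coordinate   *)
(* [coord_at] near [p] (index [true]).  An element [v] of the fiber [C] at    *)
(* [x != p] is the value at [x] of a function; at [p], it is the value of     *)
(* the quotient of a function by [coord_at].                                  *)
Definition Om_dom (b : bool) : set X :=
  if b then rs_dom chart_at else ~` [set p].

Definition Om_coef (b : bool) (x : X) : C :=
  if b && (x != p) then (coord_at x)^-1 else 1.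

Lemma Om_dom_open b : open (Om_dom b).
Proof.
case: b; first exact: rs_dom_open.
apply: closed_openC; apply: accessible_closed_set1.
exact/hausdorff_accessible/rs_hausdorff.
Qed.

Lemma Om_cover x : exists b, Om_dom b x.
Proof.
have [->|/eqP xp] := eqVneq x p; first by exists true; exact: chart_atP.
by exists false.
Qed.

Lemma Om_coef_neq0 b x : Om_dom b x -> Om_coef b x != 0.
Proof.
case: b => /= xb; rewrite /Om_coef /= ?oner_eq0 //.
by case: ifPn => xp; rewrite ?oner_eq0 // invr_eq0 coord_at_neq0.
Qed.

Lemma holo_on_eq (U : set X) (f g : X -> C) : open U ->
  (forall x, U x -> f x = g x) -> holo_on U f -> holo_on U g.
Proof.
move=> oU fg hf c x cx Ux; apply: near_eq_derivable (hf c x cx Ux).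
have : nbhs (rs_par c (rs_coord c x)) U.
  by rewrite rs_coordK //; exact: open_nbhs_nbhs.
move=> /(rs_par_cont cx) nU.
have : \forall z \near (rs_coord c x : C^o), U (rs_par c z) := nU.
by apply: filterS => z /fg.
Qed.

Lemma Om_trans b b' :
  holo_on (Om_dom b `&` Om_dom b') (fun x => Om_coef b' x / Om_coef b x).
Proof.
have oD : open (Om_dom b `&` Om_dom b') by apply: openI; exact: Om_dom_open.
case: b b' oD => -[] oD.
- apply: (holo_on_eq (f := fun=> 1)) => //; last exact: holo_on_cst.
  by move=> x [xb _]; rewrite divff// Om_coef_neq0.
- apply: (holo_on_eq (f := coord_at)) => //.
    by move=> x [xb /eqP xp]; rewrite /Om_coef /= xp div1r invrK.
  by move=> c x cx [xb _]; exact: holo_coord_at.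
- apply: (holo_on_eq (f := fun x => (coord_at x)^-1)) => //.
    by move=> x [/eqP xp xb]; rewrite /Om_coef /= xp divr1.
  move=> c x cx [/eqP xp xb]; apply: derivableV.
    by rewrite /= rs_coordK//; exact: coord_at_neq0.
  exact: holo_coord_at.
- apply: (holo_on_eq (f := fun=> 1)) => //; last exact: holo_on_cst.
  by move=> x [xb _]; rewrite divff// Om_coef_neq0.
Qed.

Definition Ominus_bundle : vbundle 1 :=
  line_bundle Om_dom_open Om_cover Om_coef_neq0 Om_trans.

End Ominus.

Section DirectSum.
Variables (r s : nat) (E : vbundle r) (F : vbundle s).

Definition dsum_fiber (x : X) : vectType C :=
  (vb_fiber E x * vb_fiber F x)%type.

Definition dsum_dom (ij : vb_idx E * vb_idx F) : set X :=
  vb_dom E ij.1 `&` vb_dom F ij.2.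

Definition dsum_fun (ij : vb_idx E * vb_idx F) (x : X) (v : dsum_fiber x) :
  'cV[C]_(r + s) :=
  col_mx (vb_triv E ij.1 x v.1) (vb_triv F ij.2 x v.2).

Lemma dsum_fun_linear ij x : linear (@dsum_fun ij x).
Proof.
by move=> k u v; rewrite /dsum_fun /= !linearP /= scale_col_mx add_col_mx.
Qed.

HB.instance Definition _ ij x := GRing.isLinear.Build C (dsum_fiber x)
  'cV[C]_(r + s) _ (@dsum_fun ij x) (@dsum_fun_linear ij x).

Definition dsum_triv ij x : 'Hom(dsum_fiber x, 'cV[C]_(r + s)) :=
  linfun (@dsum_fun ij x).

Lemma dsum_dom_open ij : open (dsum_dom ij).
Proof. by apply: openI; exact: vb_dom_open. Qed.

Lemma dsum_cover x : exists ij, dsum_dom ij x.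
Proof.
by have [i ix] := vb_cover E x; have [j jx] := vb_cover F x; exists (i, j).
Qed.

Lemma dsum_triv_bij ij x : dsum_dom ij x -> bijective (dsum_triv ij x).
Proof.
case=> /vb_triv_bij[f ef fe] /vb_triv_bij[g eg ge].
exists (fun w : 'cV[C]_(r + s) => (f (usubmx w), g (dsubmx w)) : dsum_fiber x).
  by move=> [u v]; rewrite lfunE /= /dsum_fun col_mxKu col_mxKd /= ef eg.
by move=> w; rewrite lfunE /= /dsum_fun /= fe ge vsubmxK.
Qed.

Lemma dsum_transition ij kl : exists2 g : X -> 'M[C]_(r + s),
  holo_mx_on (dsum_dom ij `&` dsum_dom kl) g &
  forall x v, (dsum_dom ij `&` dsum_dom kl) x ->
    dsum_triv kl x v = g x *m dsum_triv ij x v.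
Proof.
have [g hg gE] := vb_transition E ij.1 kl.1.
have [h hh hE] := vb_transition F ij.2 kl.2.
exists (fun x => block_mx (g x) 0 0 (h x)).
  move=> k l c x cx [[x1 x2] [x3 x4]].
  case: (split_ordP k) => k' ->; case: (split_ordP l) => l' ->.
  - have -> : (fun y => block_mx (g y) 0 0 (h y) (lshift s k') (lshift s l'))
      = (fun y => g y k' l') by apply/funext => y; rewrite block_mxEul.
    exact: hg.
  - have -> : (fun y => block_mx (g y) 0 0 (h y) (lshift s k') (rshift r l'))
      = (fun=> 0) by apply/funext => y; rewrite block_mxEur mxE.
    exact: (@holo_on_cst setT).
  - have -> : (fun y => block_mx (g y) 0 0 (h y) (rshift r k') (lshift s l'))
      = (fun=> 0) by apply/funext => y; rewrite block_mxEdl mxE.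
    exact: (@holo_on_cst setT).
  - have -> : (fun y => block_mx (g y) 0 0 (h y) (rshift r k') (rshift r l'))
      = (fun y => h y k' l') by apply/funext => y; rewrite block_mxEdr.
    exact: hh.
move=> x v [[x1 x2] [x3 x4]]; rewrite !lfunE /= /dsum_fun mul_block_col.
by rewrite !mul0mx addr0 add0r gE // hE.
Qed.

Definition dsum_bundle : vbundle (r + s) :=
  @VBundle (r + s) dsum_fiber _ dsum_dom dsum_triv dsum_dom_open dsum_cover
    dsum_triv_bij dsum_transition.

End DirectSum.

End OnSurface.

(* [X] is biholomorphic to the quotient of the complex plane by the lattice   *)
(* spanned by [w1] and [w2]: [proj] is a local biholomorphism from the plane  *)
(* onto [X], whose fibers are the cosets of the lattice.                      *)
Definition elliptic_curve (X : riemannSurface) :=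
  exists (w1 w2 : C) (proj : C -> X),
    [/\ forall a b : R,
          (a%:C * w1 + b%:C * w2)%C = 0 -> a = 0 /\ b = 0,
        forall x, exists z, proj z = x,
        forall z z', proj z = proj z' <->
          exists m n : int, z - z' = m%:~R * w1 + n%:~R * w2,
        continuous (proj : C^o -> X) &
        forall c z, rs_dom c (proj z) ->
          derivable (rs_coord c \o proj : C^o -> C^o) z 1 /\
          'D_1 (rs_coord c \o proj : C^o -> C^o) z != 0].

End Defs.

Arguments vb_dom {R X r} v i.
Arguments vb_triv {R X r} v i x.
Arguments vb_transition {R X r} v i j.
Arguments O_bundle {R} X.

(* Main.v *)
Require Import Defs.
From HB Require Import structures.
From mathcomp Require Import all_boot all_order all_algebra.
From mathcomp Require Import complex ring lra.
From mathcomp Require Import mathcomp_extra boolp classical_sets functions.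
From mathcomp Require Import cardinality fsbigop reals topology normedtype derive.
From mathcomp Require Import set_interval sequences realfun exp trigo measure.
From mathcomp Require Import lebesgue_measure lebesgue_integral ftc.
From mathcomp Require Import constructive_ereal ereal.

(** The assertions on stability are about degrees, and come down to one fact
    on an elliptic curve [X], the plane modulo the lattice spanned by [1] and
    [tau]: a nonzero meromorphic function [h] on [X], whose order at each [x] is
    at least [o x], satisfies [sum o <= 0] (lemma [elliptic_degree_le0]).
    Applied to [h] and to [1 / h] it says that a meromorphic function has as
    many zeros as poles, so that the trivial bundles [O] and [O + O] have degree
    [0]. If [M] is a line subbundle of [O + O], a meromorphic section of [M] has
    two coordinates in [O + O], which are meromorphic functions on [X]. They are
    obtained from the section in a local frame of [M] by multiplication by
    holomorphic functions, so that their orders are at least those of the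
    section, and [deg M <= 0]. Hence [O + O] is semistable, and every inclusion
    [v |-> v e] of [O], with [e] a nonzero constant vector, is a line subbundle
    of maximal degree. These inclusions have slope [0], so [O + O] is not
    stable; they pass through every line of the fiber at [p], so every line is
    bad; and the quotient of [O + O] by one of them is [O], so the instability
    degree is [0].

    The inequality [sum o <= 0] is proved by contradiction ([order_sum_le0]).
    Lift [h] to the plane and divide it by the product of the translates
    [theta (z - a x) ^ o x] of a theta function, which has a simple zero at each
    point of the lattice and no other zero. The quotient extends to an entire
    function [F] that is periodic under [1] and satisfies
    [|F (z + tau)| = |F z| exp (2 pi (b - d Im z))] with [d = sum o]. If [d > 0],
    there are [al > 0] and [be] such that [|F z| exp (al (Im z)^2 + be Im z)] is
    doubly periodic, hence has a maximum, at some [z0]. Now [al (Im z)^2] is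
    strictly subharmonic: multiplying [F] by the exponential of a quadratic
    polynomial [w] gives an entire function with
    [|F e^w| <= |F z0| exp (- al |z - z0|^2 / 2)] and equality at [z0]. By the
    maximum principle [F z0 = 0], so [F] and [h] vanish identically.

    The theta function is [T (u) T (q / u)] at [u = exp (2 pi i z)], with [T (u)]
    the product of all [1 - q^k u], for [k >= 0] and [q = exp (2 pi i tau)]. The
    function theory that is needed is built on integrals along the boundary of
    rectangles: Goursat's theorem by bisection, Cauchy's formula on a square,
    and from it the division of a holomorphic function by [z - a] at a zero [a],
    the holomorphy of locally uniform limits, and the maximum principle.

    For a Hecke modification [alpha : F -> O + O] at [p], choose a constant
    basis of the plane adapted to the line [im (alpha p)]: the second component
    of [alpha] in this basis vanishes at [p], so that it can be divided by the
    local coordinate at [p]. In other words it takes its values in [O(-p)].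
    The resulting map from [F] to [O + O(-p)] is holomorphic, and it is
    bijective at [p] because [alpha] looks like [diag (1, z)] there
    ([hecke_iso]). *)

Set Implicit Arguments.
Unset Strict Implicit.
Unset Printing Implicit Defensive.

Import Order.TTheory GRing.Theory Num.Theory.
Import numFieldNormedType.Exports.

Local Open Scope classical_set_scope.
Local Open Scope ring_scope.
Local Open Scope complex_scope.

Local Notation Re := complex.Re.
Local Notation Im := complex.Im.

(** * The modulus of a complex number and epsilon-delta calculus *)

Section ComplexNorm.
Variable R : realType.
Local Notation C := (R[i]).
Implicit Types z w : C.

(** The norm of [R[i]] has values in [R[i]]. Estimates are carried out with its
    real version, for which the order is total. *)
Definition nm z : R := Re `|z|.

Lemma nmE z : `|z| = (nm z)%:C.
Proof. by rewrite /nm RRe_real// normr_real. Qed.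

Lemma nm_ge0 z : 0 <= nm z. Proof. by rewrite -ler0c -nmE. Qed.
Lemma nm0 : nm 0 = 0. Proof. by apply: complexI; rewrite -nmE normr0. Qed.
Lemma nm1 : nm 1 = 1. Proof. by apply: complexI; rewrite -nmE normr1. Qed.
Lemma nmN z : nm (- z) = nm z. Proof. by rewrite /nm normrN. Qed.
Lemma nmB z w : nm (z - w) = nm (w - z). Proof. by rewrite /nm distrC. Qed.
Lemma nmM z w : nm (z * w) = nm z * nm w.
Proof. by apply: complexI; rewrite rmorphM/= -!nmE normrM. Qed.
Lemma nmX z n : nm (z ^+ n) = nm z ^+ n.
Proof. by apply: complexI; rewrite rmorphXn/= -!nmE normrX. Qed.
Lemma nmV z : nm (z^-1) = (nm z)^-1.
Proof. by apply: complexI; rewrite fmorphV/= -!nmE normfV. Qed.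
Lemma nmD z w : nm (z + w) <= nm z + nm w.
Proof. by rewrite -lecR rmorphD/= -!nmE ler_normD. Qed.
Lemma nm_tri z w u : nm (z - w) <= nm (z - u) + nm (u - w).
Proof. by apply: le_trans (nmD _ _); rewrite addrA subrK. Qed.
Lemma nm_eq0 z : (nm z == 0) = (z == 0).
Proof. by rewrite -(inj_eq (@complexI R)) -nmE normr_eq0. Qed.
Lemma nm_gt0 z : (0 < nm z) = (z != 0).
Proof. by rewrite lt0r nm_eq0 nm_ge0 andbT. Qed.
Lemma nm_real (x : R) : nm x%:C = `|x|.
Proof. by rewrite /nm normc_def /= expr0n addr0 sqrtr_sqr. Qed.
Lemma nm_sqr z : nm z ^+ 2 = Re z ^+ 2 + Im z ^+ 2.
Proof. by apply: complexI; rewrite rmorphXn/= -nmE -add_Re2_Im2. Qed.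
Lemma Re_le_nm z : `|Re z| <= nm z.
Proof. by rewrite -lecR -nmE normc_ge_Re. Qed.
Lemma nm_i : nm 'i%C = 1.
Proof. by rewrite /nm normc_def /= expr0n add0r expr1n sqrtr1. Qed.
Lemma Im_le_nm z : `|Im z| <= nm z.
Proof. by have := Re_le_nm (z * 'i%C); rewrite ReiNIm normrN nmM nm_i mulr1. Qed.
Lemma nm_le z : nm z <= `|Re z| + `|Im z|.
Proof.
rewrite {1}[z]complexE; apply: le_trans (nmD _ _) _.
by rewrite nmM nm_i mul1r !nm_real.
Qed.

Lemma nbhsC (a : C) (P : set C) :
  nbhs (a : C^o) P <-> exists2 e : R, 0 < e & forall z, nm (z - a) < e -> P z.
Proof.
split=> [/nbhs_ballP[e /= e0 aP]|[e e0 aP]].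
  have eR : e \is Num.real by rewrite gtr0_real.
  exists (Re e); first by rewrite -ltcR RRe_real.
  move=> z; rewrite -ltcR -nmE (RRe_real eR) => za.
  by apply: aP; rewrite -ball_normE /= distrC.
apply/nbhs_ballP; exists e%:C; first by rewrite /= ltcR.
by move=> z; rewrite -ball_normE /= distrC nmE ltcR => /aP.
Qed.

Lemma dnbhsC (a : C) (P : set C) : nbhs ((a : C^o)^') P <->
  exists2 e : R, 0 < e & forall z, nm (z - a) < e -> z != a -> P z.
Proof. exact: nbhsC. Qed.

Lemma contCP (f : C -> C) (a : C) :
  {for (a : C^o), continuous (f : C^o -> C^o)} <->
  forall e : R, 0 < e -> exists2 d : R, 0 < d &
    forall z, nm (z - a) < d -> nm (f z - f a) < e.
Proof.
split=> [/cvgrPdist_lt fa e e0|fa].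
  have /fa : 0 < e%:C :> C by rewrite ltcR.
  move=> /nbhsC[d d0 ad]; exists d => // z /ad.
  by rewrite -ltcR -nmE distrC.
apply: (@cvgrPdist_lt _ C^o _ (nbhs (a : C^o)) _ f (f a)).2 => e e0.
have eR : e \is Num.real by rewrite gtr0_real.
have /fa[d d0 ad] : 0 < Re e by rewrite -ltcR RRe_real.
apply/nbhsC; exists d => // z /ad.
by rewrite -ltcR -nmE distrC RRe_real.
Qed.

(** Multiplying the difference quotient by [z - a] removes the case [z = a] and
    gives the form in which derivatives enter all the estimates below. *)
Lemma is_deriveCP (f : C -> C) (a d : C) :
  is_derive (a : C^o) 1 (f : C^o -> C^o) d <->
  forall e : R, 0 < e -> exists2 r : R, 0 < r &
    forall z, nm (z - a) < r -> nm (f z - f a - d * (z - a)) <= e * nm (z - a).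
Proof.
split=> [[df fd] e e0|fa].
  move: df => /cvg_ex[l] df.
  have ld : l = d by rewrite -fd; apply/esym/cvg_lim.
  move: df => /cvgrPdist_le/(_ e%:C).
  rewrite ltcR => /(_ e0)/dnbhsC[r r0 H]; exists r => // z zr.
  have [->|za] := eqVneq z a; first by rewrite !subrr mulr0 subr0 nm0 mulr0.
  have := H (z - a); rewrite subr0 => /(_ zr).
  rewrite subr_eq0 => /(_ za).
  rewrite -lecR -!nmE ld /=.
  rewrite -[_%:A]/(_ * 1) mulr1 subrK => {}H.
  have za0 : z - a != 0 by rewrite subr_eq0.
  have -> : f z - f a - d * (z - a) = - ((d - (z - a)^-1 * (f z - f a)) * (z - a)).
    by field.
  by rewrite normrN normrM rmorphM/= -nmE ler_wpM2r.
have H : ((fun h : C^o => h^-1 *: ((f \o shift a) (h *: (1 : C^o)) - f a) : C^o)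
    @ (0 : C^o)^') --> (d : C^o).
  apply/cvgrPdist_le => e e0.
  have eR : e \is Num.real by rewrite gtr0_real.
  have /fa[r r0 H] : 0 < Re e by rewrite -ltcR RRe_real.
  apply/dnbhsC; exists r => // h; rewrite subr0 => hr h0.
  have := H (h + a); rewrite addrK => /(_ hr).
  rewrite -lecR rmorphM/= -!nmE RRe_real// => {}H.
  rewrite -[_%:A]/(_ * 1) mulr1 /=.
  have hn : 0 < `|h| by rewrite normr_gt0.
  rewrite -(ler_pM2r hn) -normrM -normrN.
  have -> : - ((d - h^-1 *: (f (h + a) - f a)) * h) = f (h + a) - f a - d * h.
    rewrite -[_ *: _]/(_ * _); field; exact: h0.
  exact: H.
have df : derivable (f : C^o -> C^o) a 1 by apply/cvg_ex; exists d.
apply: DeriveDef; first exact: df.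
by apply: cvg_lim H; exact: norm_hausdorff.
Qed.

End ComplexNorm.

(** * Integrals of complex functions on segments *)

Section ReIm.
Variable R : realType.
Implicit Types z w : R[i].
Lemma ReD z w : Re (z + w) = Re z + Re w. Proof. by case: z; case: w. Qed.
Lemma ImD z w : Im (z + w) = Im z + Im w. Proof. by case: z; case: w. Qed.
Lemma ReN z : Re (- z) = - Re z. Proof. by case: z. Qed.
Lemma ImN z : Im (- z) = - Im z. Proof. by case: z. Qed.
Lemma ReM z w : Re (z * w) = Re z * Re w - Im z * Im w.
Proof. by case: z; case: w. Qed.
Lemma ImM z w : Im (z * w) = Re z * Im w + Im z * Re w.
Proof. by case: z; case: w. Qed.
End ReIm.

Section SegmentIntegral.
Variable R : realType.
Local Notation C := (R[i]).
Implicit Types (phi psi : R -> C) (a b c x : R).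

Definition rcont phi x := forall e : R, 0 < e -> exists2 d : R, 0 < d &
  forall y, `|y - x| < d -> nm (phi y - phi x) < e.

Definition contOn a b phi := forall x, a <= x <= b -> rcont phi x.

Definition rint (f : R -> R) a b : R :=
  \int[@lebesgue_measure R]_(x in `[a, b]) f x.

Definition cint phi a b : C :=
  (rint (fun x => Re (phi x)) a b) +i* (rint (fun x => Im (phi x)) a b).

Lemma rcont_Re phi x : rcont phi x -> {for x, continuous (fun y => Re (phi y))}.
Proof.
move=> h; apply: (@cvgrPdist_lt _ R^o _ (nbhs x) _ _ _).2 => e e0.
have [d d0 H] := h _ e0; apply/nbhs_ballP; exists d => // y.
rewrite -ball_normE /= distrC => /H; apply: le_lt_trans.
by rewrite distrC -ReN -ReD; exact: Re_le_nm.
Qed.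

Lemma rcont_Im phi x : rcont phi x -> {for x, continuous (fun y => Im (phi y))}.
Proof.
move=> h; apply: (@cvgrPdist_lt _ R^o _ (nbhs x) _ _ _).2 => e e0.
have [d d0 H] := h _ e0; apply/nbhs_ballP; exists d => // y.
rewrite -ball_normE /= distrC => /H; apply: le_lt_trans.
by rewrite distrC -ImN -ImD; exact: Im_le_nm.
Qed.

Lemma cont_integrable (f : R -> R) a b :
  (forall x, a <= x <= b -> {for x, continuous f}) ->
  (@lebesgue_measure R).-integrable `[a, b] (EFin \o f).
Proof.
move=> cf; apply: continuous_compact_integrable; first exact: segment_compact.
apply: continuous_in_subspaceT => x; rewrite inE /= in_itv /=; exact: cf.
Qed.

Lemma contOn_integrable phi a b : contOn a b phi ->
  (@lebesgue_measure R).-integrable `[a, b] (EFin \o (fun x => Re (phi x))) /\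
  (@lebesgue_measure R).-integrable `[a, b] (EFin \o (fun x => Im (phi x))).
Proof.
by move=> h; split; apply: cont_integrable => x /h;
  [exact: rcont_Re | exact: rcont_Im].
Qed.

Lemma eq_cint phi psi a b : (forall x, a <= x <= b -> phi x = psi x) ->
  cint phi a b = cint psi a b.
Proof.
by move=> h; congr (_ +i* _); apply: eq_Rintegral => x; rewrite inE /= in_itv /=
  => /h ->.
Qed.

Lemma cintD phi psi a b : contOn a b phi -> contOn a b psi ->
  cint (fun x => phi x + psi x) a b = cint phi a b + cint psi a b.
Proof.
move=> /contOn_integrable[p1 p2] /contOn_integrable[q1 q2].
rewrite /cint /rint; simpc.
congr (_ +i* _).
  under eq_Rintegral do rewrite ReD.
  by rewrite RintegralD.
under eq_Rintegral do rewrite ImD.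
by rewrite RintegralD.
Qed.

Lemma cintZ phi (k : C) a b : contOn a b phi ->
  cint (fun x => k * phi x) a b = k * cint phi a b.
Proof.
move=> /contOn_integrable[p1 p2]; rewrite /cint /rint.
case: k => k l; simpc.
have i1 (r : R) (f : R -> R) : (@lebesgue_measure R).-integrable `[a, b] (EFin \o f) ->
    (@lebesgue_measure R).-integrable `[a, b] (EFin \o (fun x => r * f x)).
  move=> fi; have -> : EFin \o (fun x => r * f x) = (fun x => r%:E * (EFin \o f) x)%E.
    by apply/funext => x /=; rewrite EFinM.
  exact: integrableZl.
congr (_ +i* _).
  under eq_Rintegral do rewrite ReM /=.
  by rewrite RintegralB ?RintegralZl//; exact: i1.
under eq_Rintegral do rewrite ImM /=.
by rewrite RintegralD ?RintegralZl//; exact: i1.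
Qed.

Lemma cint_cst (k : C) a b : a <= b -> cint (fun=> k) a b = k * (b - a)%:C.
Proof.
move=> ab; rewrite /cint /rint !Rintegral_cst//= lebesgue_measure_itv /= lte_fin.
have -> : fine (if (a < b)%R then b%:E - a%:E else 0)%E = b - a.
  case: ifPn => //=; rewrite -leNgt => ba.
  by have -> : a = b by [apply/eqP; rewrite eq_le ab]; rewrite subrr.
by case: k => k l; simpc.
Qed.

Lemma cint_split phi a c b : a <= c -> c <= b -> contOn a b phi ->
  cint phi a b = cint phi a c + cint phi c b.
Proof.
move=> ac cb /contOn_integrable[p1 p2]; rewrite /cint /rint; simpc.
have key (f : R -> R) : (@lebesgue_measure R).-integrable `[a, b] (EFin \o f) ->
  \int[@lebesgue_measure R]_(x in `[a, b]) f x =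
  \int[@lebesgue_measure R]_(x in `[a, c]) f x +
  \int[@lebesgue_measure R]_(x in `[c, b]) f x.
  move=> fi.
  have := @Rintegral_itvB R f (BLeft a) (BRight b) c fi.
  rewrite !bnd_simp => /(_ ac cb) /(canRL (subrK _)) ->.
  rewrite addrC; congr (_ + _); apply: Rintegral_itv_obnd_cbnd.
  apply: integrableS fi => //.
  by apply: subset_itvr; rewrite bnd_simp.
by congr (_ +i* _); apply: key.
Qed.

(** The real and the imaginary part are estimated separately, whence the factor
    [2]; the maximum principle [max_square] is insensitive to such constants. *)
Lemma cint_bound phi a b (M : R) : a <= b -> contOn a b phi ->
  (forall x, a <= x <= b -> nm (phi x) <= M) ->
  nm (cint phi a b) <= 2 * M * (b - a).
Proof.
move=> ab /contOn_integrable[p1 p2] hM.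
have key (f : R -> R) : (@lebesgue_measure R).-integrable `[a, b] (EFin \o f) ->
    (forall x, a <= x <= b -> `|f x| <= M) ->
    `|rint f a b| <= M * (b - a).
  move=> fi fM; apply: le_trans (le_normr_Rintegral _ fi) _ => //.
  have -> : M * (b - a) = rint (fun=> M) a b.
    by have [] := @cint_cst (M%:C) _ _ ab; rewrite mul0r subr0 => <-.
  apply: le_Rintegral => //.
  - have -> : EFin \o (fun x => `|f x|) = abse \o (EFin \o f) by apply/funext.
    exact: integrable_abse.
  - by apply: cont_integrable => x _; exact: cvg_cst.
have H := nm_le (cint phi a b).
apply: (le_trans H) => /=.
have -> : 2 * M * (b - a) = M * (b - a) + M * (b - a) by ring.
by apply: lerD; apply: key => // x /hM; apply: le_trans;
  [exact: Re_le_nm | exact: Im_le_nm].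
Qed.

Lemma Im_cint_ge phi a b (M : R) : a <= b -> contOn a b phi ->
  (forall x, a <= x <= b -> M <= Im (phi x)) -> M * (b - a) <= Im (cint phi a b).
Proof.
move=> ab /contOn_integrable[_ p2] hM /=.
have -> : M * (b - a) = rint (fun=> M) a b.
  by have [] := @cint_cst (M%:C) _ _ ab; rewrite mul0r subr0 => <-.
by apply: le_Rintegral => //; apply: cont_integrable => x _; exact: cvg_cst.
Qed.

Lemma contOn_bounded phi a b : a <= b -> contOn a b phi ->
  exists M : R, forall x, a <= x <= b -> nm (phi x) <= M.
Proof.
move=> ab hc.
have [c _ H] : exists2 c, c \in `[a, b]%R & forall t, t \in `[a, b]%R ->
    nm (phi t) <= nm (phi c).
  apply: (EVT_max ab); apply: continuous_in_subspaceT => x.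
  rewrite inE /= in_itv /= => /hc cx.
  apply: (@cvgrPdist_lt _ R^o _ (nbhs x) _ _ _).2 => e e0.
  have [d d0 H] := cx _ e0; apply/nbhs_ballP; exists d => // y.
  rewrite -ball_normE /= distrC => /H; apply: le_lt_trans.
  have h1 := nm_tri (phi x) 0 (phi y); have h2 := nm_tri (phi y) 0 (phi x).
  by move: h1 h2; rewrite !subr0 (nmB (phi x)) ler_norml => *; lra.
by exists (nm (phi c)) => x xab; apply: H; rewrite in_itv.
Qed.

End SegmentIntegral.

Opaque cint rint.

(** * Holomorphic functions and integrals along rectangles *)

Local Notation hol f z := (derivable (f : (_^o -> _^o)) z 1).

Section Hol.
Variable R : realType.
Local Notation C := (R[i]).
Implicit Types (f g : C -> C) (z : C).

Lemma hol_cst (k : C) z : hol (fun _ : C => k) z.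
Proof. exact: derivable_cst. Qed.
Lemma hol_id z : hol (fun w : C => w) z.
Proof. exact: derivable_id. Qed.
Lemma holD f g z : hol f z -> hol g z -> hol (fun w => f w + g w) z.
Proof. exact: derivableD. Qed.
Lemma holN f z : hol f z -> hol (fun w => - f w) z.
Proof. exact: derivableN. Qed.
Lemma holB f g z : hol f z -> hol g z -> hol (fun w => f w - g w) z.
Proof. exact: derivableB. Qed.
Lemma holM f g z : hol f z -> hol g z -> hol (fun w => f w * g w) z.
Proof. exact: derivableM. Qed.
Lemma holV f z : f z != 0 -> hol f z -> hol (fun w => (f w)^-1) z.
Proof. exact: derivableV. Qed.
Lemma holX f n z : hol f z -> hol (fun w => f w ^+ n) z.
Proof.
move=> fz; elim: n => [|n IH]; first exact: hol_cst.
have -> : (fun w => f w ^+ n.+1) = (fun w => f w * f w ^+ n).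
  by apply/funext => w; rewrite exprS.
exact: holM.
Qed.
Lemma hol_comp f g z : hol g z -> hol f (g z) -> hol (fun w => f (g w)) z.
Proof.
move=> /derivable1_diffP gz /derivable1_diffP fz; apply/derivable1_diffP.
have := @differentiable_comp C C^o C^o C^o (g : C^o -> C^o) (f : C^o -> C^o) z gz fz.
by [].
Qed.
Lemma hol_exprz f (n : int) z : f z != 0 -> hol f z -> hol (fun w => f w ^ n) z.
Proof.
move=> fz0 fz; case: n => n; first exact: holX.
by apply: holV; [rewrite expf_neq0|exact: holX].
Qed.
Lemma eq_hol f g z : (\forall w \near (z : C^o), f w = g w) -> hol f z -> hol g z.
Proof. by move=> fg; apply: near_eq_derivable. Qed.

End Hol.

Section RectangleIntegral.
Variable R : realType.
Local Notation C := (R[i]).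
Implicit Types (f g : C -> C) (x y : R).

Definition ccont f z := forall e : R, 0 < e -> exists2 d : R, 0 < d &
  forall w, nm (w - z) < d -> nm (f w - f z) < e.

Definition inrect x0 x1 y0 y1 (z : C) :=
  (x0 <= Re z <= x1) && (y0 <= Im z <= y1).

Definition onedge x0 x1 y0 y1 (z : C) := inrect x0 x1 y0 y1 z /\
  [\/ Re z = x0, Re z = x1, Im z = y0 | Im z = y1].

(** The integral of [f z dz] along the boundary of a rectangle, counterclockwise;
    on the vertical sides [dz] is ['i dy]. *)
Definition rect_int f x0 x1 y0 y1 : C :=
  cint (fun x => f (x +i* y0)) x0 x1 - cint (fun x => f (x +i* y1)) x0 x1 +
  'i * (cint (fun y => f (x1 +i* y)) y0 y1 - cint (fun y => f (x0 +i* y)) y0 y1).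

Lemma rectE f x0 x1 y0 y1 : rect_int f x0 x1 y0 y1 =
  cint (fun x => f (x +i* y0)) x0 x1 - cint (fun x => f (x +i* y1)) x0 x1 +
  'i * (cint (fun y => f (x1 +i* y)) y0 y1 - cint (fun y => f (x0 +i* y)) y0 y1).
Proof. exact: erefl. Qed.

Lemma ccontP f z : {for (z : C^o), continuous (f : C^o -> C^o)} <-> ccont f z.
Proof. exact: contCP. Qed.

Lemma hor_contOn f a b y : (forall x, a <= x <= b -> ccont f (x +i* y)) ->
  contOn a b (fun x => f (x +i* y)).
Proof.
move=> h x /h fx e /fx[d d0 H]; exists d => // x' xx'; apply: H.
have -> : (x' +i* y) - (x +i* y) = (x' - x)%:C by simpc.
by rewrite nm_real.
Qed.

Lemma ver_contOn f a b x : (forall y, a <= y <= b -> ccont f (x +i* y)) ->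
  contOn a b (fun y => f (x +i* y)).
Proof.
move=> h y /h fx e /fx[d d0 H]; exists d => // y' yy'; apply: H.
have -> : (x +i* y') - (x +i* y) = 'i * (y' - y)%:C by simpc.
by rewrite nmM nm_i mul1r nm_real.
Qed.

Lemma edgeP f (P : C -> Prop) x0 x1 y0 y1 : x0 <= x1 -> y0 <= y1 ->
  (forall z, onedge x0 x1 y0 y1 z -> P z) ->
  [/\ forall x, x0 <= x <= x1 -> P (x +i* y0),
      forall x, x0 <= x <= x1 -> P (x +i* y1),
      forall y, y0 <= y <= y1 -> P (x0 +i* y) &
      forall y, y0 <= y <= y1 -> P (x1 +i* y)].
Proof.
move=> xx yy h; split=> t tt; apply: h; split; rewrite /inrect /= ?tt ?lexx ?xx ?yy //.
- by apply: Or43.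
- by apply: Or44.
- by apply: Or41.
- by apply: Or42.
Qed.

Lemma rect_contOn f x0 x1 y0 y1 : x0 <= x1 -> y0 <= y1 ->
  (forall z, onedge x0 x1 y0 y1 z -> ccont f z) ->
  [/\ contOn x0 x1 (fun x => f (x +i* y0)), contOn x0 x1 (fun x => f (x +i* y1)),
    contOn y0 y1 (fun y => f (x0 +i* y)) & contOn y0 y1 (fun y => f (x1 +i* y))].
Proof.
move=> xx yy /(edgeP f xx yy)[h1 h2 h3 h4].
by split; [exact: hor_contOn|exact: hor_contOn|exact: ver_contOn|exact: ver_contOn].
Qed.

Lemma eq_rect_int f g x0 x1 y0 y1 : x0 <= x1 -> y0 <= y1 ->
  (forall z, onedge x0 x1 y0 y1 z -> f z = g z) ->
  rect_int f x0 x1 y0 y1 = rect_int g x0 x1 y0 y1.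
Proof.
move=> xx yy /(edgeP f xx yy)[h1 h2 h3 h4].
by rewrite /rect_int (eq_cint h1) (eq_cint h2) (eq_cint h3) (eq_cint h4).
Qed.

Lemma rectD f g x0 x1 y0 y1 : x0 <= x1 -> y0 <= y1 ->
  (forall z, onedge x0 x1 y0 y1 z -> ccont f z) ->
  (forall z, onedge x0 x1 y0 y1 z -> ccont g z) ->
  rect_int (fun z => f z + g z) x0 x1 y0 y1 = rect_int f x0 x1 y0 y1 + rect_int g x0 x1 y0 y1.
Proof.
move=> xx yy /(rect_contOn xx yy)[h1 h2 h3 h4] /(rect_contOn xx yy)[k1 k2 k3 k4].
rewrite /rect_int !cintD//; ring.
Qed.

Lemma rectZ f k x0 x1 y0 y1 : x0 <= x1 -> y0 <= y1 ->
  (forall z, onedge x0 x1 y0 y1 z -> ccont f z) ->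
  rect_int (fun z => k * f z) x0 x1 y0 y1 = k * rect_int f x0 x1 y0 y1.
Proof.
move=> xx yy /(rect_contOn xx yy)[h1 h2 h3 h4].
rewrite /rect_int !cintZ//; ring.
Qed.

Lemma rect_bound f x0 x1 y0 y1 (M : R) : x0 <= x1 -> y0 <= y1 ->
  (forall z, onedge x0 x1 y0 y1 z -> ccont f z) ->
  (forall z, onedge x0 x1 y0 y1 z -> nm (f z) <= M) ->
  nm (rect_int f x0 x1 y0 y1) <= 4 * M * ((x1 - x0) + (y1 - y0)).
Proof.
move=> xx yy /(rect_contOn xx yy)[h1 h2 h3 h4] /(edgeP f xx yy)[k1 k2 k3 k4].
have {}h1 := cint_bound xx h1 k1; have {}h2 := cint_bound xx h2 k2.
have {}h3 := cint_bound yy h3 k3; have {}h4 := cint_bound yy h4 k4.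
apply: le_trans (nmD _ _) _; rewrite nmM nm_i mul1r.
have H1 := nmD (cint (fun x => f (x +i* y0)) x0 x1) (- cint (fun x => f (x +i* y1)) x0 x1).
have H2 := nmD (cint (fun y => f (x1 +i* y)) y0 y1) (- cint (fun y => f (x0 +i* y)) y0 y1).
rewrite !nmN in H1 H2; lra.
Qed.

Lemma rect_splitx f x0 c x1 y0 y1 : x0 <= c -> c <= x1 ->
  (forall x, x0 <= x <= x1 -> ccont f (x +i* y0)) ->
  (forall x, x0 <= x <= x1 -> ccont f (x +i* y1)) ->
  rect_int f x0 x1 y0 y1 = rect_int f x0 c y0 y1 + rect_int f c x1 y0 y1.
Proof.
move=> x0c cx1 /hor_contOn h1 /hor_contOn h2.
rewrite /rect_int (cint_split x0c cx1 h1) (cint_split x0c cx1 h2); ring.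
Qed.

Lemma rect_splity f x0 x1 y0 c y1 : y0 <= c -> c <= y1 ->
  (forall y, y0 <= y <= y1 -> ccont f (x0 +i* y)) ->
  (forall y, y0 <= y <= y1 -> ccont f (x1 +i* y)) ->
  rect_int f x0 x1 y0 y1 = rect_int f x0 x1 y0 c + rect_int f x0 x1 c y1.
Proof.
move=> x0c cx1 /ver_contOn h1 /ver_contOn h2.
rewrite /rect_int (cint_split x0c cx1 h1) (cint_split x0c cx1 h2); ring.
Qed.

Lemma ccont_cst k z : ccont (fun=> k) z.
Proof. by move=> e e0; exists 1 => // w _; rewrite subrr nm0. Qed.

Lemma hol_ccont f z : hol f z -> ccont f z.
Proof.
by move=> /derivable1_diffP/differentiable_continuous fz; apply/ccontP.
Qed.

Lemma hol_affine (p q c : C) z : hol (fun w => p + q * (w - c)) z.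
Proof.
apply: holD; first exact: hol_cst.
apply: holM; first exact: hol_cst.
by apply: holB; [exact: hol_id|exact: hol_cst].
Qed.

(** The integrals along the two horizontal sides differ by ['i q] times the area,
    those along the two vertical sides by [q] times the area, and the latter
    enter with the factor ['i]. *)
Lemma rect_affine (p q c : C) x0 x1 y0 y1 : x0 <= x1 -> y0 <= y1 ->
  rect_int (fun w => p + q * (w - c)) x0 x1 y0 y1 = 0.
Proof.
move=> xx yy.
pose f w : C := p + q * (w - c).
have cf z : ccont f z by apply: hol_ccont; exact: hol_affine.
have hh y : contOn x0 x1 (fun x => f (x +i* y)) by apply: hor_contOn => ? _.
have vv x : contOn y0 y1 (fun y => f (x +i* y)) by apply: ver_contOn => ? _.
have cst a b (k : C) : contOn a b (fun _ : R => k).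
  by move=> t _ e e0; exists 1 => // w _; rewrite subrr nm0.
have pE (x y : R) : x +i* y = x%:C + 'i * y%:C by simpc.
rewrite -/f /rect_int.
have -> : cint (fun x => f (x +i* y1)) x0 x1 =
  cint (fun x => f (x +i* y0)) x0 x1 + 'i * q * (y1 - y0)%:C * (x1 - x0)%:C.
  rewrite -(cint_cst _ xx) -cintD//; apply: eq_cint => x _.
  by rewrite /f !pE rmorphB /=; ring.
have -> : cint (fun y => f (x1 +i* y)) y0 y1 =
  cint (fun y => f (x0 +i* y)) y0 y1 + q * (x1 - x0)%:C * (y1 - y0)%:C.
  rewrite -(cint_cst _ yy) -cintD//; apply: eq_cint => y _.
  by rewrite /f !pE rmorphB /=; ring.
ring.
Qed.

Definition holrect f x0 x1 y0 y1 :=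
  forall z, inrect x0 x1 y0 y1 z -> hol f z.

(** The rectangle integral is small, to second order in the size, around a
    point of differentiability, because affine functions integrate to 0. *)
Lemma rect_near_derivable f x0 x1 y0 y1 (a : C) (e : R) :
  holrect f x0 x1 y0 y1 -> 0 < e -> inrect x0 x1 y0 y1 a ->
  exists2 r : R, 0 < r & forall u0 u1 v0 v1, u0 <= u1 -> v0 <= v1 ->
    x0 <= u0 -> u1 <= x1 -> y0 <= v0 -> v1 <= y1 ->
    inrect u0 u1 v0 v1 a -> (u1 - u0) + (v1 - v0) < r ->
    nm (rect_int f u0 u1 v0 v1) <= e * ((u1 - u0) + (v1 - v0)) ^+ 2.
Proof.
move=> hf e0 ain; have /derivableP := hf _ ain.
move: (derive _ _ _) => d /is_deriveCP/(_ (e / 4)).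
case; first by rewrite divr_gt0.
move=> r r0 H; exists r => // u0 u1 v0 v1 uu vv xu ux yv vy ua ur.
pose l z := f a + d * (z - a).
have hl z : hol l z by exact: hol_affine.
have hfe z : onedge u0 u1 v0 v1 z -> hol f z.
  move=> [/andP[/andP[z1 z2] /andP[z3 z4]] _]; apply/hf.
  by apply/andP; split; apply/andP; split; lra.
have hkl z : hol (fun z => -1 * l z) z by apply: holM => //; exact: hol_cst.
have -> : rect_int f u0 u1 v0 v1 = rect_int (fun z => f z + -1 * l z) u0 u1 v0 v1.
  rewrite rectD// ?rectZ// ?rect_affine// ?mulr0 ?addr0// => z zin;
    apply: hol_ccont; [exact: hl|exact: hfe|exact: hkl].
set s := (u1 - u0) + (v1 - v0) in ur *.
have -> : e * s ^+ 2 = 4 * (e / 4 * s) * s by field.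
apply: rect_bound => // z zin.
  by apply: hol_ccont; apply: holD; [exact: hfe|exact: hkl].
case: zin => zin _.
have zs : nm (z - a) <= s.
  apply: le_trans (nm_le _) _; rewrite ReD ImD ReN ImN.
  move: zin ua => /andP[/andP[z1 z2] /andP[z3 z4]] /andP[/andP[a1 a2] /andP[a3 a4]].
  by rewrite lerD// ler_norml; lra.
have -> : f z + -1 * l z = f z - f a - d * (z - a) by rewrite /l; ring.
apply: le_trans (H _ (le_lt_trans zs ur)) _.
by rewrite ler_wpM2l// divr_ge0 // ltW.
Qed.

End RectangleIntegral.

Opaque rect_int nm.

(** * Goursat's theorem *)

Lemma nested_intervals (R : realType) (Z V : nat -> R) : (forall n, 0 <= V n) ->
  (forall n, Z n <= Z n.+1 /\ Z n.+1 + V n.+1 <= Z n + V n) ->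
  exists z, forall n, Z n <= z <= Z n + V n.
Proof.
move=> V0 ZV.
have ZD n k : Z n <= Z (n + k)%N /\ Z (n + k)%N + V (n + k)%N <= Z n + V n.
  elim: k => [|k [IH1 IH2]]; first by rewrite addn0.
  by rewrite addnS; have [h1 h2] := ZV (n + k)%N; split; lra.
have Zub n m : Z m <= Z n + V n.
  have [nm|/ltnW mn] := leqP n m.
    by have := ZD n (m - n)%N; rewrite subnKC// => -[? ?]; have := V0 m; lra.
  by have := ZD m (n - m)%N; rewrite subnKC// => -[? ?]; have := V0 n; lra.
exists (sup (range Z)) => n; apply/andP; split.
  apply: ub_le_sup; last by exists n.
  by exists (Z 0%N + V 0%N) => _ [m _ <-].
apply: ge_sup; first by exists (Z 0%N), 0%N.
by move=> _ [m _ <-].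
Qed.

Section Goursat.
Variable R : realType.
Local Notation C := (R[i]).
Implicit Types (f g : C -> C) (x y : R).

Lemma rect_quarters f x c x' y d y' :
  x <= c -> c <= x' -> y <= d -> d <= y' -> holrect f x x' y y' ->
  rect_int f x x' y y' =
  rect_int f x c y d + rect_int f x c d y' + rect_int f c x' y d + rect_int f c x' d y'.
Proof.
move=> xc cx yd dy hf.
have cf z : inrect x x' y y' z -> ccont f z by move=> /hf/hol_ccont.
rewrite (@rect_splitx _ f x c x'); first last; rewrite //.
- by move=> t tt; apply: cf; rewrite /inrect /= tt /=; lra.
- by move=> t tt; apply: cf; rewrite /inrect /= tt /=; lra.
rewrite (@rect_splity _ f x c y d y'); first last; rewrite //.
- by move=> t tt; apply: cf; rewrite /inrect /= tt andbT; lra.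
- by move=> t tt; apply: cf; rewrite /inrect /= tt andbT; lra.
rewrite (@rect_splity _ f c x' y d y'); first last; rewrite //.
- by move=> t tt; apply: cf; rewrite /inrect /= tt andbT; lra.
- by move=> t tt; apply: cf; rewrite /inrect /= tt andbT; lra.
by rewrite !addrA.
Qed.

Lemma rect_quarters_bound f x y w h e : 0 <= w -> 0 <= h ->
  holrect f x (x + w + w) y (y + h + h) ->
  nm (rect_int f x (x + w) y (y + h)) <= e * (w + h) ^+ 2 ->
  nm (rect_int f x (x + w) (y + h) (y + h + h)) <= e * (w + h) ^+ 2 ->
  nm (rect_int f (x + w) (x + w + w) y (y + h)) <= e * (w + h) ^+ 2 ->
  nm (rect_int f (x + w) (x + w + w) (y + h) (y + h + h)) <= e * (w + h) ^+ 2 ->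
  nm (rect_int f x (x + w + w) y (y + h + h)) <= e * (w + w + (h + h)) ^+ 2.
Proof.
move=> w0 h0 hf q1 q2 q3 q4.
rewrite (@rect_quarters f x (x + w) _ y (y + h)) ?lerDl//.
have -> : e * (w + w + (h + h)) ^+ 2 = e * (w + h) ^+ 2 + e * (w + h) ^+ 2
  + e * (w + h) ^+ 2 + e * (w + h) ^+ 2 by ring.
apply: (le_trans (nmD _ _)); apply: lerD => //.
apply: (le_trans (nmD _ _)); apply: lerD => //.
by apply: (le_trans (nmD _ _)); apply: lerD.
Qed.

Variables (f : C -> C) (x0 y0 w h e : R).
Hypotheses (w0 : 0 <= w) (h0 : 0 <= h) (e0 : 0 < e).
Hypothesis hf : holrect f x0 (x0 + w) y0 (y0 + h).

Let W n : R := w / 2 ^+ n.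
Let H n : R := h / 2 ^+ n.

Let WS n : W n = W n.+1 + W n.+1.
Proof. by rewrite /W exprS; field; rewrite expf_neq0. Qed.
Let HS n : H n = H n.+1 + H n.+1.
Proof. by rewrite /H exprS; field; rewrite expf_neq0. Qed.
Let W0 n : 0 <= W n. Proof. by rewrite divr_ge0 // exprn_ge0. Qed.
Let H0 n : 0 <= H n. Proof. by rewrite divr_ge0 // exprn_ge0. Qed.

Let inside n x y := [/\ x0 <= x, x + W n <= x0 + w, y0 <= y & y + H n <= y0 + h].

Let bad n x y := inside n x y /\
  e * (W n + H n) ^+ 2 < nm (rect_int f x (x + W n) y (y + H n)).

(** A rectangle in which the bound fails contains a quarter in which it fails,
    since the bound is additive over the quarters. *)
Let bad_step n x y : bad n x y -> exists x' y',
  [/\ bad n.+1 x' y', x <= x', x' + W n.+1 <= x + W n, y <= y' &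
      y' + H n.+1 <= y + H n].
Proof.
move=> [[xx xw yy yh] B].
have := W0 n.+1; have := H0 n.+1; have := WS n; have := HS n.
set wn := W n.+1; set hn := H n.+1 => hE wE hn0 wn0.
have [//|N] := pselect (exists x' y',
  [/\ bad n.+1 x' y', x <= x', x' + W n.+1 <= x + W n, y <= y' &
      y' + H n.+1 <= y + H n]).
have G x' y' : x <= x' -> x' + wn <= x + W n -> y <= y' -> y' + hn <= y + H n ->
    nm (rect_int f x' (x' + wn) y' (y' + hn)) <= e * (wn + hn) ^+ 2.
  move=> h1 h2 h3 h4; rewrite leNgt; apply/negP => lt; apply: N.
  exists x', y'; split => //; split=> //; split; rewrite -/wn -/hn; lra.
suff : nm (rect_int f x (x + W n) y (y + H n)) <= e * (W n + H n) ^+ 2.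
  by rewrite leNgt B.
move: G; rewrite wE hE !addrA => G.
rewrite wE addrA in xw; rewrite hE addrA in yh.
have -> : e * (wn + wn + hn + hn) ^+ 2 = e * (wn + wn + (hn + hn)) ^+ 2.
  by rewrite addrA.
apply: rect_quarters_bound => //; try by apply: G; rewrite ?lerDl // ?lexx // -addrA lerD2l lerDl.
move=> z /andP[/andP[z1 z2] /andP[z3 z4]]; apply: hf.
by rewrite /inrect (le_trans xx z1) (le_trans z2 xw) (le_trans yy z3) (le_trans z4 yh).
Qed.

(** Otherwise bisection gives a nested sequence of rectangles in which the bound
    fails, and it contradicts [rect_near_derivable] at their common point. *)
Lemma goursat_bound : nm (rect_int f x0 (x0 + w) y0 (y0 + h)) <= e * (w + h) ^+ 2.
Proof.
rewrite leNgt; apply/negP => B0.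
have W0E : W 0 = w by rewrite /W expr0 divr1.
have H0E : H 0 = h by rewrite /H expr0 divr1.
have bad0 : bad 0 x0 y0 by split; [split|]; rewrite ?W0E ?H0E.
pose T := {s : nat * (R * R) | `[< bad s.1 s.2.1 s.2.2 >]}.
pose Rl (s t : T) := [/\ (sval t).1 = (sval s).1.+1,
  (sval s).2.1 <= (sval t).2.1,
  (sval t).2.1 + W (sval t).1 <= (sval s).2.1 + W (sval s).1,
  (sval s).2.2 <= (sval t).2.2 &
  (sval t).2.2 + H (sval t).1 <= (sval s).2.2 + H (sval s).1].
have HR : forall s, {t | Rl s t}.
  move=> [[n [x y]] hb]; apply: cid.
  have [x' [y' [b' h1 h2 h3 h4]]] := bad_step (asboolW hb).
  by exists (exist _ (n.+1, (x', y')) (asboolT b')).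
have [F [F0 FS]] := dependent_choice HR (exist _ (0%N, (x0, y0)) (asboolT bad0)).
pose X n := (sval (F n)).2.1; pose Y n := (sval (F n)).2.2.
have Fn n : (sval (F n)).1 = n.
  by elim: n => [|n IH]; [rewrite F0|have [-> _ _ _ _] := FS n; rewrite IH].
have Fbad n : bad n (X n) (Y n).
  by have := asboolW (svalP (F n)); rewrite Fn.
have Xm n : X n <= X n.+1 /\ X n.+1 + W n.+1 <= X n + W n.
  by have [_ h1 h2 _ _] := FS n; rewrite !Fn in h2.
have Ym n : Y n <= Y n.+1 /\ Y n.+1 + H n.+1 <= Y n + H n.
  by have [_ _ _ h1 h2] := FS n; rewrite !Fn in h2.
have [x xP] := nested_intervals W0 Xm.
have [y yP] := nested_intervals H0 Ym.
have a_in n : inrect (X n) (X n + W n) (Y n) (Y n + H n) (x +i* y).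
  by rewrite /inrect /= xP yP.
have ain : inrect x0 (x0 + w) y0 (y0 + h) (x +i* y).
  have [[h1 h2 h3 h4] _] := Fbad 0%N; have := a_in 0%N.
  move=> /andP[/andP[z1 z2] /andP[z3 z4]].
  by apply/andP; split; apply/andP; split; lra.
have [r r0 small] := rect_near_derivable hf e0 ain.
have [n rn] : exists n, W n + H n < r.
  have [n Hn] : exists n, (w + h) / r < 2 ^+ n.
    exists (Num.bound ((w + h) / r)).
    apply: (lt_le_trans (archi_boundP _)).
      by rewrite divr_ge0 ?addr_ge0 // ltW.
    by rewrite -natrX ler_nat ltnW// ltn_expl.
  exists n; rewrite /W /H -mulrDl ltr_pdivrMr ?exprn_gt0// mulrC -ltr_pdivrMr//.
have [[h1 h2 h3 h4]] := Fbad n; rewrite ltNge => /negP; apply.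
have wE : X n + W n - X n = W n by rewrite addrC addKr.
have hE : Y n + H n - Y n = H n by rewrite addrC addKr.
have := small (X n) (X n + W n) (Y n) (Y n + H n).
rewrite wE hE; apply => //; rewrite ?lerDl //; exact: a_in.
Qed.

End Goursat.

Theorem goursat (R : realType) (f : R[i] -> R[i]) (x0 x1 y0 y1 : R) :
  x0 <= x1 -> y0 <= y1 -> holrect f x0 x1 y0 y1 -> rect_int f x0 x1 y0 y1 = 0.
Proof.
move=> xx yy hf.
have w0 : 0 <= x1 - x0 by rewrite subr_ge0.
have h0 : 0 <= y1 - y0 by rewrite subr_ge0.
have xE : x0 + (x1 - x0) = x1 by rewrite addrC subrK.
have yE : y0 + (y1 - y0) = y1 by rewrite addrC subrK.
apply/eqP; rewrite -nm_eq0 eq_le nm_ge0 andbT.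
apply/ler_addgt0Pr => d d0; rewrite add0r.
pose s := (x1 - x0 + (y1 - y0)) ^+ 2 + 1.
have s0 : 0 < s by rewrite ltr_wpDl// sqr_ge0.
have := @goursat_bound R f x0 y0 (x1 - x0) (y1 - y0) (d / s) w0 h0.
rewrite xE yE => /(_ (divr_gt0 d0 s0) hf) /le_trans; apply.
rewrite -mulrA ger_pMr// mulrC ler_pdivrMr// mul1r /s; lra.
Qed.

(** * Cauchy's formula on squares *)

Section Square.
Variable R : realType.
Local Notation C := (R[i]).
Implicit Types (f g : C -> C) (a w z : C) (s : R).

Definition sq_int f a s := rect_int f (Re a - s) (Re a + s) (Im a - s) (Im a + s).
Definition insq a s := inrect (Re a - s) (Re a + s) (Im a - s) (Im a + s).
Definition onsq a s := onedge (Re a - s) (Re a + s) (Im a - s) (Im a + s).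

Lemma sqE f a s :
  sq_int f a s = rect_int f (Re a - s) (Re a + s) (Im a - s) (Im a + s).
Proof. exact: erefl. Qed.

Lemma sq_le (u s : R) : 0 < s -> u - s <= u + s. Proof. by move=> s0; lra. Qed.

Lemma onsq_nm a s z : 0 < s -> onsq a s z -> s <= nm (z - a).
Proof.
move=> s0 [_ H].
have hRe : s <= `|Re (z - a)| -> s <= nm (z - a) by move/le_trans; apply; exact: Re_le_nm.
have hIm : s <= `|Im (z - a)| -> s <= nm (z - a) by move/le_trans; apply; exact: Im_le_nm.
rewrite ReD ReN in hRe; rewrite ImD ImN in hIm.
by case: H => E; [apply: hRe|apply: hRe|apply: hIm|apply: hIm];
  rewrite E addrAC subrr ?sub0r ?add0r ?normrN gtr0_norm.
Qed.

Lemma onsq_in a s z : onsq a s z -> insq a s z. Proof. by case. Qed.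

Lemma insq_nm a s z : insq a s z -> nm (z - a) <= 2 * s.
Proof.
move=> /andP[/andP[z1 z2] /andP[z3 z4]].
apply: le_trans (nm_le _) _; rewrite ReD ImD ReN ImN.
have h1 : `|Re z - Re a| <= s by rewrite ler_norml; apply/andP; split; lra.
have h2 : `|Im z - Im a| <= s by rewrite ler_norml; apply/andP; split; lra.
lra.
Qed.

Lemma nm_insq a s z : nm (z - a) <= s -> insq a s z.
Proof.
move=> zs; have := le_trans (Re_le_nm _) zs; have := le_trans (Im_le_nm _) zs.
rewrite ReD ReN ImD ImN !ler_norml => /andP[h1 h2] /andP[h3 h4].
by apply/andP; split; apply/andP; split; lra.
Qed.

Lemma onsq_far a s w z : 0 < s -> nm (w - a) < s / 2 -> onsq a s z -> s / 2 <= nm (z - w).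
Proof.
move=> s0 wa /(onsq_nm s0); have := nm_tri z a w; lra.
Qed.

Lemma onsq_neq a s w z : 0 < s -> nm (w - a) < s -> onsq a s z -> z - w != 0.
Proof.
move=> s0 wa /(onsq_nm s0) H; apply: contraTN wa => /eqP zw.
have -> : w = z by apply/eqP; rewrite eq_sym -subr_eq0 zw.
by rewrite -leNgt.
Qed.

Lemma eq_sq f g a s : 0 < s -> (forall z, onsq a s z -> f z = g z) -> sq_int f a s = sq_int g a s.
Proof. by move=> s0; apply: eq_rect_int; exact: sq_le. Qed.

Lemma sqD f g a s : 0 < s -> (forall z, onsq a s z -> ccont f z) ->
  (forall z, onsq a s z -> ccont g z) ->
  sq_int (fun z => f z + g z) a s = sq_int f a s + sq_int g a s.
Proof. by move=> s0; apply: rectD; exact: sq_le. Qed.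

Lemma sqZ f k a s : 0 < s -> (forall z, onsq a s z -> ccont f z) ->
  sq_int (fun z => k * f z) a s = k * sq_int f a s.
Proof. by move=> s0; apply: rectZ; exact: sq_le. Qed.

Lemma sq_bound f a s (M : R) : 0 < s -> (forall z, onsq a s z -> ccont f z) ->
  (forall z, onsq a s z -> nm (f z) <= M) -> nm (sq_int f a s) <= 16 * M * s.
Proof.
move=> s0 h1 h2; have := rect_bound (sq_le (Re a) s0) (sq_le (Im a) s0) h1 h2.
by move/le_trans; apply; lra.
Qed.

Lemma ccontM f g z : ccont f z -> ccont g z -> ccont (fun w => f w * g w) z.
Proof.
move=> /ccontP fz /ccontP gz; apply/ccontP.
exact: (@continuousM C C^o f g z fz gz).
Qed.

Lemma ccontD f g z : ccont f z -> ccont g z -> ccont (fun w => f w + g w) z.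
Proof.
move=> /ccontP fz /ccontP gz; apply/ccontP.
exact: (@continuousD C C^o C^o f g z fz gz).
Qed.

Lemma sq_bounded f a s : 0 < s -> (forall z, onsq a s z -> ccont f z) ->
  exists2 M : R, 0 <= M & forall z, onsq a s z -> nm (f z) <= M.
Proof.
move=> s0 cf; have x01 := sq_le (Re a) s0; have y01 := sq_le (Im a) s0.
have [c1 c2 c3 c4] := rect_contOn x01 y01 cf.
have [M1 h1] := contOn_bounded x01 c1; have [M2 h2] := contOn_bounded x01 c2.
have [M3 h3] := contOn_bounded y01 c3; have [M4 h4] := contOn_bounded y01 c4.
exists (`|M1| + `|M2| + `|M3| + `|M4|); first by rewrite !addr_ge0.
have := ler_norm M1; have := ler_norm M2; have := ler_norm M3; have := ler_norm M4.
have := normr_ge0 M1; have := normr_ge0 M2; have := normr_ge0 M3; have := normr_ge0 M4.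
move=> p1 p2 p3 p4 p5 p6 p7 p8 [x y] [/andP[/= zx zy] /= [] E]; rewrite E.
- by have := h3 _ zy; lra.
- by have := h4 _ zy; lra.
- by have := h1 _ zx; lra.
- by have := h2 _ zx; lra.
Qed.

Lemma hol_kernel a s w z : 0 < s -> nm (w - a) < s -> onsq a s z ->
  hol (fun z => (z - w)^-1) z.
Proof.
move=> s0 wa zon; apply: holV; first exact: onsq_neq zon.
by apply: holB; [exact: hol_id|exact: hol_cst].
Qed.

(** The frame between the two squares is cut into four rectangles on which the
    integral vanishes by Goursat. *)
Lemma sq_shrink f a s w d : 0 < d -> nm (w - a) + d <= s ->
  (forall z, insq a s z -> z != w -> hol f z) -> sq_int f a s = sq_int f w d.
Proof.
move=> d0 wds hf; have := Re_le_nm (w - a); have := Im_le_nm (w - a).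
rewrite ReD ReN ImD ImN !ler_norml => /andP[i1 i2] /andP[r1 r2].
rewrite /sq_int.
have L1 : Re a - s <= Re w - d by lra.
have L2 : Re w - d <= Re w + d by lra.
have L3 : Re w + d <= Re a + s by lra.
have M1 : Im a - s <= Im w - d by lra.
have M2 : Im w - d <= Im w + d by lra.
have M3 : Im w + d <= Im a + s by lra.
have hz z : (Re z != Re w) || (Im z != Im w) -> insq a s z -> hol f z.
  move=> zw zin; apply: hf => //; apply: contraL zw => /eqP ->.
  by rewrite !eqxx.
have gz (x x' y y' : R) : x <= x' -> y <= y' -> Re a - s <= x -> x' <= Re a + s ->
    Im a - s <= y -> y' <= Im a + s ->
    [|| x' < Re w, Re w < x, y' < Im w | Im w < y] -> rect_int f x x' y y' = 0.
  move=> xx yy h1 h2 h3 h4 o; apply: goursat => // z /andP[/andP[z1 z2] /andP[z3 z4]].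
  apply: hz; last by apply/andP; split; apply/andP; split; lra.
  by case/or4P: o => o; apply/orP; [left|left|right|right]; apply/eqP; lra.
have ch (y : R) : Im a - s <= y <= Im a + s -> y != Im w ->
    forall x : R, Re a - s <= x <= Re a + s -> ccont f (x +i* y).
  move=> yy yw x xx; apply/hol_ccont/hz; first by rewrite /= yw orbT.
  by rewrite /insq /inrect /= xx.
have cv (x : R) : Re a - s <= x <= Re a + s -> x != Re w ->
    forall y : R, Im a - s <= y <= Im a + s -> ccont f (x +i* y).
  move=> xx xw y yy; apply/hol_ccont/hz; first by rewrite /= xw.
  by rewrite /insq /inrect /= xx.
have b1 : Im a - s <= Im a - s <= Im a + s by lra.
have b2 : Im a - s <= Im a + s <= Im a + s by lra.
have n1 : Im a - s != Im w by apply/eqP; lra.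
have n2 : Im a + s != Im w by apply/eqP; lra.
rewrite (@rect_splitx _ f _ (Re w - d)); [|lra|lra|exact: ch|exact: ch].
rewrite (@rect_splitx _ f (Re w - d) (Re w + d)); [|lra|lra| |]; last 2 first.
- by move=> x xx; apply: ch => //; lra.
- by move=> x xx; apply: ch => //; lra.
have -> : rect_int f (Re a - s) (Re w - d) (Im a - s) (Im a + s) = 0.
  by apply: gz; [lra..|apply/or4P; apply: Or41; lra].
have -> : rect_int f (Re w + d) (Re a + s) (Im a - s) (Im a + s) = 0.
  by apply: gz; [lra..|apply/or4P; apply: Or42; lra].
rewrite add0r addr0.
have c1 : Re a - s <= Re w - d <= Re a + s by lra.
have c2 : Re a - s <= Re w + d <= Re a + s by lra.
have m1 : Re w - d != Re w by apply/eqP; lra.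
have m2 : Re w + d != Re w by apply/eqP; lra.
rewrite (@rect_splity _ f _ _ _ (Im w - d)); [|lra|lra|exact: cv|exact: cv].
rewrite (@rect_splity _ f _ _ (Im w - d) (Im w + d)); [|lra|lra| |]; last 2 first.
- by move=> x xx; apply: cv => //; lra.
- by move=> x xx; apply: cv => //; lra.
have -> : rect_int f (Re w - d) (Re w + d) (Im a - s) (Im w - d) = 0.
  by apply: gz; [lra..|apply/or4P; apply: Or43; lra].
have -> : rect_int f (Re w - d) (Re w + d) (Im w + d) (Im a + s) = 0.
  by apply: gz; [lra..|apply/or4P; apply: Or44; lra].
by rewrite add0r addr0.
Qed.

(** Up to the factor [2 pi i], the Cauchy integral of [g]. It is a function of [w]
    that is holomorphic inside the square even if [g] is only continuous. *)
Definition cauchy g a s w : C := sq_int (fun z => g z * (z - w)^-1) a s.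

(** Instead of the value [2 pi i], the formula has the integral for the constant
    function [1] as a factor: all that matters about it is that it is not zero.
    The proof shrinks the square towards [w], where the difference quotient of
    [f] is bounded. *)
Theorem cauchy_formula f a s w : 0 < s -> nm (w - a) < s ->
  (forall z, insq a s z -> hol f z) ->
  cauchy f a s w = f w * cauchy (fun=> 1) a s w.
Proof.
move=> s0 wa hf.
pose k z := (f z - f w) * (z - w)^-1.
have hw : hol f w by apply: hf; apply: nm_insq; exact: ltW.
have hk z : insq a s z -> z != w -> hol k z.
  move=> zin zw; apply: holM; first by apply: holB; [exact: hf|exact: hol_cst].
  apply: holV; first by rewrite subr_eq0.
  by apply: holB; [exact: hol_id|exact: hol_cst].
suff k0 : sq_int k a s = 0.
  pose g z : C := 1 * (z - w)^-1.
  have hg z : onsq a s z -> hol g z.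
    by move=> zon; apply: holM; [exact: hol_cst|exact: hol_kernel zon].
  have kE : sq_int k a s = cauchy f a s w + (- f w) * sq_int g a s.
    rewrite -sqZ//; last by move=> z /hg/hol_ccont.
    rewrite -sqD//.
    - by apply: eq_sq => // z _; rewrite /k /g; ring.
    - move=> z zon; apply: hol_ccont; apply: holM; last exact: hol_kernel zon.
      by apply: hf; exact: onsq_in.
    - move=> z zon; apply: hol_ccont; apply: holM; [exact: hol_cst|exact: hg].
  by apply/eqP; rewrite -subr_eq0 -mulNr -kE k0.
have [d Hd] : exists d, is_derive (w : C^o) 1 (f : C^o -> C^o) d.
  by exists (derive (f : C^o -> C^o) w 1); exact/derivableP.
have [|r r0 Hr] := (is_deriveCP f w d).1 Hd 1; first exact: ltr01.
pose M := nm d + 1.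
have M0 : 0 < M by rewrite ltr_wpDl ?nm_ge0.
have kM z : nm (z - w) < r -> z != w -> nm (k z) <= M.
  move=> /Hr H zw; rewrite /k nmM nmV ler_pdivrMr ?nm_gt0 ?subr_eq0//.
  have -> : f z - f w = (f z - f w - d * (z - w)) + d * (z - w) by ring.
  apply: le_trans (nmD _ _) _; rewrite nmM /M mulrDl addrC lerD2l.
  by rewrite mul1r in H *.
apply/eqP; rewrite -nm_eq0 eq_le nm_ge0 andbT; apply/ler_addgt0Pr => e e0.
rewrite add0r.
have [t [t0 t1 t2 t3]] : exists t, [/\ 0 < t, t <= (s - nm (w - a)) / 2,
    t <= r / 3 & t <= e / (16 * M)].
  exists (Num.min ((s - nm (w - a)) / 2) (Num.min (r / 3) (e / (16 * M)))).
  split; rewrite ?ge_min ?lexx ?orbT//.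
  by rewrite !lt_min !divr_gt0 ?subr_gt0// mulr_gt0.
rewrite (@sq_shrink k a s w t) //; last by lra.
have kon z : onsq w t z -> nm (z - w) < r /\ z != w.
  move=> zon; split; first by have H := insq_nm (onsq_in zon); lra.
  by rewrite -subr_eq0 -nm_gt0 (lt_le_trans t0)// (onsq_nm t0 zon).
apply: (@le_trans _ _ (16 * M * t)).
  apply: sq_bound => // z zon; have [z1 z2] := kon z zon; last exact: kM.
  apply: hol_ccont; apply: hk => //.
  apply: nm_insq; have := nm_tri z a w; have := insq_nm (onsq_in zon); lra.
have M16 : 0 < 16 * M by rewrite mulr_gt0.
by move: t3; rewrite ler_pdivlMr// mulrC.
Qed.

End Square.
Opaque sq_int.

(** * Division, maximum principle, uniform limits *)

Section CauchyConsequences.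
Variable R : realType.
Local Notation C := (R[i]).
Implicit Types (f g : C -> C) (a w z : C) (s : R).

(** Differentiation under the integral sign: the remainder is the integral of
    [r], which has the factor [(v - w) ^+ 2]. *)
Lemma cauchy_hol g a s w : 0 < s -> nm (w - a) < s / 2 ->
  (forall z, onsq a s z -> ccont g z) -> hol (cauchy g a s) w.
Proof.
move=> s0 wa cg; have [M M0 gM] := sq_bounded s0 cg.
have wa' (v : C) : nm (v - a) < s / 2 -> nm (v - a) < s by lra.
have ck v z : nm (v - a) < s / 2 -> onsq a s z -> ccont (fun z => (z - v)^-1) z.
  by move=> /wa' va zon; apply: hol_ccont; apply: hol_kernel zon.
pose D := sq_int (fun z => g z * ((z - w)^-1 * (z - w)^-1)) a s.
suff H : is_derive (w : C^o) 1 (cauchy g a s : C^o -> C^o) D.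
  by case: H.
apply/is_deriveCP => e e0.
pose K := 16 * (M * (2 / s) ^+ 3) * s.
have K0 : 0 <= K.
  apply: mulr_ge0; last exact: ltW.
  by apply: mulr_ge0 => //; apply: mulr_ge0 => //; rewrite exprn_ge0// divr_ge0// ltW.
have K1 : 0 < K + 1 by rewrite ltr_wpDl.
exists (Num.min (s / 2 - nm (w - a)) (e / (K + 1))).
  by rewrite lt_min subr_gt0 wa divr_gt0.
move=> v; rewrite lt_min => /andP[v1 v2].
have va : nm (v - a) < s / 2 by have := nm_tri v a w; lra.
pose r z := (v - w) ^+ 2 * (g z * ((z - w)^-1 * (z - w)^-1 * (z - v)^-1)).
have cr z : onsq a s z -> ccont (fun z => g z * ((z - w)^-1 * (z - w)^-1 * (z - v)^-1)) z.
  move=> zon; apply: ccontM; first exact: cg.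
  by apply: ccontM; [apply: ccontM|]; exact: ck.
have cr' z : onsq a s z -> ccont r z.
  by move=> zon; apply: ccontM; [exact: ccont_cst|exact: cr].
have c1 u z : nm (u - a) < s / 2 -> onsq a s z -> ccont (fun z => g z * (z - u)^-1) z.
  by move=> ua zon; apply: ccontM; [exact: cg|exact: ck].
have c2 z : onsq a s z -> ccont (fun z => g z * ((z - w)^-1 * (z - w)^-1)) z.
  by move=> zon; apply: ccontM; [exact: cg|apply: ccontM; exact: ck].
have -> : cauchy g a s v - cauchy g a s w - D * (v - w) = sq_int r a s.
  suff -> : cauchy g a s v = cauchy g a s w + ((v - w) * D + sq_int r a s) by ring.
  rewrite /cauchy /D -sqZ// -sqD//; last first.
    by move=> z zon; apply: ccontM; [exact: ccont_cst|exact: c2].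
  rewrite -sqD//.
  - apply: eq_sq => // z zon.
    have zw := onsq_neq s0 (wa' _ wa) zon; have zv := onsq_neq s0 (wa' _ va) zon.
    rewrite /r; field; exact/andP.
  - by move=> z zon; exact: c1.
  - move=> z zon; apply: ccontD; last exact: cr'.
    by apply: ccontM; [exact: ccont_cst|exact: c2].
rewrite sqZ// nmM nmX.
apply: (@le_trans _ _ (nm (v - w) ^+ 2 * K)).
  apply: ler_wpM2l; first by rewrite exprn_ge0 ?nm_ge0.
  apply: sq_bound => // z zon.
  rewrite !nmM !nmV.
  have i2 u : nm (u - a) < s / 2 -> (nm (z - u))^-1 <= 2 / s.
    move=> ua; have H := onsq_far s0 ua zon.
    rewrite -[2 / s]invf_div lef_pV2 ?posrE ?divr_gt0//.
    by apply: lt_le_trans H; rewrite divr_gt0.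
  have n0 u : 0 <= (nm (z - u))^-1 by rewrite invr_ge0 nm_ge0.
  apply: ler_pM; rewrite ?nm_ge0 ?mulr_ge0//; first exact: gM.
  by rewrite exprSr expr2; do 2 (apply: ler_pM; rewrite ?mulr_ge0// ?i2//).
rewrite expr2 -mulrA mulrC; apply: ler_wpM2r; first exact: nm_ge0.
rewrite ltr_pdivlMr// mulrDr mulr1 in v2.
by have := nm_ge0 (v - w); lra.
Qed.

Lemma Im_inv z : Im (z^-1) = - Im z / nm z ^+ 2.
Proof.
by rewrite nm_sqr; case: z => x y /=; rewrite mulNr.
Qed.

Lemma Re_inv z : Re (z^-1) = Re z / nm z ^+ 2.
Proof. by rewrite nm_sqr; case: z. Qed.

(** On each of the four sides, of length [2 s], the imaginary part of
    [dz / (z - a)] is at least [1 / (2 s)] per unit of length: each side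
    contributes at least [1] to the imaginary part of the integral. *)
Lemma cauchy1_neq0 a s : 0 < s -> cauchy (fun=> 1) a s a != 0.
Proof.
move=> s0; suff : 0 < Im (cauchy (fun=> 1) a s a).
  by apply: contraTneq => ->; rewrite ltxx.
have aa : nm (a - a) < s by rewrite subrr nm0.
pose k z : C := 1 * (z - a)^-1.
have ck z : onsq a s z -> ccont k z.
  move=> zon; apply: hol_ccont; apply: holM; first exact: hol_cst.
  exact: hol_kernel zon.
have x01 := sq_le (Re a) s0; have y01 := sq_le (Im a) s0.
have [c1 c2 c3 c4] := rect_contOn x01 y01 ck.
have onE z : onsq a s z -> [/\ nm (z - a) ^+ 2 <= 2 * s ^+ 2 & 0 < nm (z - a) ^+ 2].
  move=> zon; split; last by rewrite exprn_gt0// (lt_le_trans s0)// (onsq_nm s0 zon).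
  rewrite nm_sqr ReD ImD ReN ImN.
  have := onsq_in zon => /andP[/andP[z1 z2] /andP[z3 z4]]; nra.
pose M := (2 * s)^-1.
have bnd (x y : R) : 0 < y -> y <= 2 * s ^+ 2 -> x = s -> M <= x / y.
  move=> y0 ys ->; rewrite /M ler_pdivlMr// mulrC ler_pdivrMr ?mulr_gt0//.
  lra.
rewrite /cauchy sqE rectE -/k.
have [e1 e2 e3 e4] := edgeP k x01 y01 (fun z (zon : onsq a s z) => onE z zon).
have cN (A B : R) phi : contOn A B phi -> - cint phi A B = cint (fun x => -1 * phi x) A B.
  by move=> h; rewrite cintZ// mulN1r.
have cI (A B : R) phi : contOn A B phi -> 'i * cint phi A B = cint (fun x => 'i * phi x) A B.
  by move=> h; rewrite cintZ.
have cNI (A B : R) phi : contOn A B phi ->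
    - ('i * cint phi A B) = cint (fun x => (- 'i) * phi x) A B.
  by move=> h; rewrite cintZ// mulNr.
have cc (k' : C) (A B : R) phi : contOn A B phi -> contOn A B (fun x => k' * phi x).
  move=> h x xx e e0.
  have [|d d0 H] := h x xx (e / (nm k' + 1)).
    by rewrite divr_gt0 // ltr_wpDl ?nm_ge0.
  exists d => // y /H; rewrite -mulrBr nmM ltr_pdivlMr ?ltr_wpDl ?nm_ge0// => H'.
  by apply: le_lt_trans H'; have := nm_ge0 (phi y - phi x); have := nm_ge0 k'; nra.
rewrite mulrBr cN// cNI// cI// !ImD.
have L : M * (Re a + s - (Re a - s)) = 1 by rewrite /M; field; exact: lt0r_neq0.
have L' : M * (Im a + s - (Im a - s)) = 1 by rewrite /M; field; exact: lt0r_neq0.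
have i1 : 1 <= Im (cint (fun x => k (x +i* (Im a - s))) (Re a - s) (Re a + s)).
  rewrite -L; apply: Im_cint_ge => // x xx.
  have [b1 b2] := e1 x xx; rewrite /k mul1r Im_inv; apply: bnd => //.
  rewrite ImD ImN /=; ring.
have i2 : 1 <= Im (cint (fun x => -1 * k (x +i* (Im a + s))) (Re a - s) (Re a + s)).
  rewrite -L; apply: Im_cint_ge => //; first exact: cc.
  move=> x xx; have [b1 b2] := e2 x xx; rewrite /k mul1r mulN1r ImN Im_inv -mulNr.
  by apply: bnd => //; rewrite ImD ImN /=; ring.
have i3 : 1 <= Im (cint (fun y => 'i * k ((Re a + s) +i* y)) (Im a - s) (Im a + s)).
  rewrite -L'; apply: Im_cint_ge => //; first exact: cc.
  move=> x xx; have [b1 b2] := e4 x xx; rewrite /k mul1r mulrC ImiRe Re_inv.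
  by apply: bnd => //; rewrite ReD ReN /=; ring.
have i4 : 1 <= Im (cint (fun y => - 'i * k ((Re a - s) +i* y)) (Im a - s) (Im a + s)).
  rewrite -L'; apply: Im_cint_ge => //; first exact: cc.
  move=> x xx; have [b1 b2] := e3 x xx.
  rewrite /k mul1r mulNr mulrC ImN ImiRe Re_inv -mulNr.
  by apply: bnd => //; rewrite ReD ReN /=; ring.
lra.
Qed.

Lemma near_holC f a : (\forall z \near (a : C^o), hol f z) ->
  exists2 s : R, 0 < s & forall z, insq a s z -> hol f z.
Proof.
move=> /nbhsC[e e0 H]; exists (e / 3); first by rewrite divr_gt0.
by move=> z /insq_nm za; apply: H; lra.
Qed.

Lemma near_disc a (r : R) : 0 < r -> \forall z \near (a : C^o), nm (z - a) < r.
Proof. by move=> r0; apply/nbhsC; exists r. Qed.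

Lemma near_neq0 f a : ccont f a -> f a != 0 -> \forall z \near (a : C^o), f z != 0.
Proof.
move=> cf fa0; have [|d d0 H] := cf (nm (f a)); first by rewrite nm_gt0.
apply/nbhsC; exists d => // z /H; apply: contraTneq => ->.
by rewrite sub0r nmN -leNgt.
Qed.

Lemma cauchy1_near_neq0 a s : 0 < s ->
  \forall w \near (a : C^o), cauchy (fun=> 1) a s w != 0.
Proof.
move=> s0; apply: near_neq0; last exact: cauchy1_neq0.
apply: hol_ccont; apply: cauchy_hol => //; last by move=> z _; exact: ccont_cst.
by rewrite subrr nm0 divr_gt0.
Qed.

(** The difference quotient of [f] at [a] is a quotient of two Cauchy integrals,
    that of the difference quotient itself and that of [1]; these are
    holomorphic at [a] as well. *)
Theorem hol_factor f a : (\forall z \near (a : C^o), hol f z) ->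
  exists q : C -> C, [/\ \forall z \near (a : C^o), hol q z,
    \forall z \near (a : C^o), f z = f a + (z - a) * q z &
    is_derive (a : C^o) 1 (f : C^o -> C^o) (q a)].
Proof.
move=> hf; have [s s0 hs] := near_holC hf.
pose g z := (f z - f a) * (z - a)^-1.
have aa : nm (a - a) < s by rewrite subrr nm0.
have s2 : 0 < s / 2 by rewrite divr_gt0.
have hfe z : onsq a s z -> hol f z by move=> /onsq_in/hs.
have cg z : onsq a s z -> ccont g z.
  move=> zon; apply: hol_ccont; apply: holM; last exact: hol_kernel zon.
  by apply: holB; [exact: hfe|exact: hol_cst].
have g0 : sq_int g a s = 0.
  have H : cauchy (fun z => f z - f a) a s a = 0.
    have hfa z : insq a s z -> hol (fun z => f z - f a) z.
      by move=> zin; apply: holB; [exact: hs|exact: hol_cst].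
    by rewrite (cauchy_formula s0 aa hfa) subrr mul0r.
  exact: H.
pose q w := cauchy g a s w * (cauchy (fun=> 1) a s w)^-1.
have hq : \forall z \near (a : C^o), hol q z.
  near=> z; apply: holM.
    by apply: cauchy_hol => //; near: z; exact: near_disc.
  apply: holV; first by near: z; exact: cauchy1_near_neq0.
  apply: cauchy_hol => //; last by move=> ? _; exact: ccont_cst.
  by near: z; exact: near_disc.
have fq : \forall z \near (a : C^o), f z = f a + (z - a) * q z.
  near=> w.
  have wa : nm (w - a) < s by near: w; exact: near_disc.
  have J0 : cauchy (fun=> 1) a s w != 0 by near: w; exact: cauchy1_near_neq0.
  have cw z : onsq a s z -> ccont (fun z => (z - w)^-1) z.
    by move=> zon; apply: hol_ccont; apply: hol_kernel zon.
  (* on the boundary, [(z - a) / (z - w) = 1 + (w - a) / (z - w)] *)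
  have key : (f w - f a) * cauchy (fun=> 1) a s w = (w - a) * cauchy g a s w.
    have cf := @cauchy_formula _ (fun z => f z - f a) a s w s0 wa.
    rewrite -cf => [|z zin]; last by apply: holB; [exact: hs|exact: hol_cst].
    have -> : cauchy (fun z => f z - f a) a s w = sq_int g a s + (w - a) * cauchy g a s w.
      rewrite /cauchy -sqZ//; last by move=> z zon; apply: ccontM; [exact: cg|exact: cw].
      rewrite -sqD//; last first.
        move=> z zon; apply: ccontM; first exact: ccont_cst.
        by apply: ccontM; [exact: cg|exact: cw].
      apply: eq_sq => // z zon; rewrite /g; field.
      by rewrite (onsq_neq s0 aa zon) (onsq_neq s0 wa zon).
    by rewrite g0 add0r.
  rewrite /q mulrA -key mulfK//; ring.
exists q; split => //.
have hqa : hol q a by exact: nbhs_singleton hq.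
apply/is_deriveCP => e e0.
have [d d0 H] := hol_ccont hqa e0.
move/nbhsC : fq => [d' d'0 H'].
exists (Num.min d d'); first by rewrite lt_min d0.
move=> z; rewrite lt_min => /andP[zd zd'].
rewrite (H' z zd').
have -> : f a + (z - a) * q z - f a - q a * (z - a) = (q z - q a) * (z - a) by ring.
by rewrite nmM ler_wpM2r ?nm_ge0// ltW// H.
Unshelve. all: by end_near.
Qed.

(** Maximum principle on a square: apply the Cauchy formula to all powers of
    [f], so that the constants in the estimate disappear in the limit. *)
Theorem max_square f a s (m : R) : 0 < s -> (forall z, insq a s z -> hol f z) ->
  (forall z, onsq a s z -> nm (f z) <= m) -> nm (f a) <= m.
Proof.
move=> s0 hf fm; rewrite leNgt; apply/negP => mf.
have aa : nm (a - a) < s by rewrite subrr nm0.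
set J := nm (cauchy (fun=> 1) a s a).
have J0 : 0 < J by rewrite nm_gt0 cauchy1_neq0.
have m0 : 0 <= m.
  have : onsq a s ((Re a + s) +i* Im a).
    split; last by apply: Or42.
    by rewrite /inrect /=; apply/andP; split; apply/andP; split; lra.
  by move=> /fm; apply: le_trans; exact: nm_ge0.
have f0 : 0 < nm (f a) by exact: le_lt_trans mf.
have key n : nm (f a) ^+ n * J <= 16 * m ^+ n.
  have hfn z : insq a s z -> hol (fun z => f z ^+ n) z by move=> /hf; exact: holX.
  have := cauchy_formula s0 aa hfn => /(congr1 (@nm R)).
  rewrite nmM nmX -/J => <-.
  have -> : 16 * m ^+ n = 16 * (m ^+ n / s) * s by rewrite mulrA mulfVK// gt_eqF.
  apply: sq_bound => // z zon.
    apply: hol_ccont; apply: holM; last exact: hol_kernel zon.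
    by apply: hfn; exact: onsq_in.
  rewrite nmM nmX nmV; apply: ler_pM; rewrite ?exprn_ge0 ?invr_ge0 ?nm_ge0//.
    by apply: lerXn2r; rewrite ?nnegrE ?nm_ge0//; exact: fm.
  have H := onsq_nm s0 zon.
  by rewrite lef_pV2 ?posrE// (lt_le_trans s0).
pose x := m / nm (f a).
have x1 : `|x| < 1.
  by rewrite ger0_norm ?divr_ge0 ?nm_ge0// ltr_pdivrMr// mul1r.
have /cvgrPdist_lt/(_ (J / 16)) := cvg_expr x1.
case; first by rewrite divr_gt0.
move=> N _ /(_ N); rewrite /= leqnn => /(_ isT).
rewrite sub0r normrN normrX ger0_norm ?divr_ge0 ?nm_ge0// ltNge => /negP; apply.
rewrite ler_pdivrMr// /x expr_div_n mulrAC ler_pdivlMr ?exprn_gt0//.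
by rewrite mulrC [_ * 16]mulrC key.
Qed.

(** Locally uniform limits of entire functions are entire, because the Cauchy
    formula passes to the limit. *)
Theorem hol_unif_limit (fn : nat -> C -> C) f :
  (forall n z, hol (fn n) z) ->
  (forall B e : R, 0 < e -> exists n, forall z, nm z <= B -> nm (fn n z - f z) <= e) ->
  forall a, hol f a.
Proof.
move=> hfn lim a.
have cf z : ccont f z.
  move=> e e0.
  have [|n H] := lim (nm z + 1) (e / 4); first by rewrite divr_gt0.
  have [|d d0 Hd] := hol_ccont (hfn n z) (e := e / 4); first by rewrite divr_gt0.
  exists (Num.min d 1); first by rewrite lt_min d0 ltr01.
  move=> w; rewrite lt_min => /andP[wd w1].
  have Hw : nm (fn n w - f w) <= e / 4.
    by apply: H; have := nmD (w - z) z; rewrite subrK; lra.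
  have Hz : nm (fn n z - f z) <= e / 4 by apply: H; rewrite lerDl.
  have := Hd w wd; have := nm_tri (f w) (f z) (fn n w).
  have := nm_tri (fn n w) (f z) (fn n z); rewrite (nmB (f w) (fn n w)); lra.
have s0 : 0 < (1 : R) by exact: ltr01.
have form : \forall w \near (a : C^o), f w = cauchy f a 1 w * (cauchy (fun=> 1) a 1 w)^-1.
  near=> w.
  have wa : nm (w - a) < 1 by near: w; exact: near_disc.
  have wa2 : nm (w - a) < 1 / 2 by near: w; apply: near_disc; rewrite divr_gt0.
  have J0 : cauchy (fun=> 1) a 1 w != 0 by near: w; exact: cauchy1_near_neq0.
  suff E : cauchy f a 1 w = f w * cauchy (fun=> 1) a 1 w by rewrite E mulfK.
  apply/eqP; rewrite -subr_eq0 -nm_eq0 eq_le nm_ge0 andbT.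
  apply/ler_addgt0Pr => e e0; rewrite add0r.
  pose J := nm (cauchy (fun=> 1) a 1 w).
  have Jp : 0 < 32 + J by rewrite ltr_wpDr ?nm_ge0.
  have [|n Hn] := lim (nm a + 2) (e / (32 + J)); first by rewrite divr_gt0.
  pose t := e / (32 + J).
  have ck z : onsq a 1 z -> ccont (fun z => (z - w)^-1) z.
    by move=> zon; apply: hol_ccont; apply: hol_kernel zon.
  have D : nm (cauchy f a 1 w - cauchy (fn n) a 1 w) <= 32 * t.
    have c1 g z : (forall z, ccont g z) -> onsq a 1 z -> ccont (fun z => g z * (z - w)^-1) z.
      by move=> cg zon; apply: ccontM => //; exact: ck.
    have cn z : ccont (fn n) z by exact: hol_ccont.
    rewrite -[X in nm (_ + X)]mulN1r /cauchy -sqZ//; last by move=> z; exact: c1.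
    rewrite -sqD//; first last.
    - by move=> z zon; apply: ccontM; [exact: ccont_cst|exact: c1].
    - by move=> z; exact: c1.
    have -> : 32 * t = 16 * (2 * t) * 1 by ring.
    apply: sq_bound => //.
      move=> z zon; apply: ccontD; first exact: c1.
      by apply: ccontM; [exact: ccont_cst|exact: c1].
    move=> z zon.
    have -> : f z * (z - w)^-1 + -1 * (fn n z * (z - w)^-1) = - (fn n z - f z) * (z - w)^-1.
      by ring.
    rewrite nmM nmN nmV mulrC; apply: ler_pM; rewrite ?invr_ge0 ?nm_ge0//.
      have H := onsq_far s0 wa2 zon.
      rewrite -[leRHS]invrK lef_pV2 ?posrE// ?invr_gt0//; first by rewrite -div1r.
      by apply: lt_le_trans H; rewrite divr_gt0.
    apply: Hn; have := insq_nm (onsq_in zon); have := nmD (z - a) a.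
    by rewrite subrK mulr1; lra.
  have -> : cauchy f a 1 w - f w * cauchy (fun=> 1) a 1 w =
      (cauchy f a 1 w - cauchy (fn n) a 1 w) +
      (fn n w - f w) * cauchy (fun=> 1) a 1 w.
    rewrite (@cauchy_formula _ (fn n) a 1 w)//; ring.
  apply: le_trans (nmD _ _) _; rewrite nmM -/J.
  have -> : e = 32 * t + t * J.
    by rewrite /t; field; exact: lt0r_neq0.
  apply: lerD => //; apply: ler_wpM2r; first exact: nm_ge0.
  by apply: Hn; have := nmD (w - a) a; rewrite subrK; lra.
apply: (@eq_hol _ (fun w => cauchy f a 1 w * (cauchy (fun=> 1) a 1 w)^-1)).
  by apply: filterS form => w ->.
have aa : nm (a - a) < 1 / 2 by rewrite subrr nm0 divr_gt0.
apply: holM; first by apply: cauchy_hol => // z _; exact: cf.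
apply: holV; first exact: cauchy1_neq0.
by apply: cauchy_hol => // z _; exact: ccont_cst.
Unshelve. all: by end_near.
Qed.

End CauchyConsequences.

(** * The complex exponential *)

Section Exponential.
Variable R : realType.
Local Notation C := (R[i]).
Implicit Types (z w : C).

Definition cexp z : C := (expR (Re z))%:C * (cos (Im z) +i* sin (Im z)).

Lemma cexpE z : cexp z = (expR (Re z) * cos (Im z)) +i* (expR (Re z) * sin (Im z)).
Proof. by rewrite /cexp; simpc. Qed.

Lemma cexpD z w : cexp (z + w) = cexp z * cexp w.
Proof.
rewrite !cexpE ReD ImD expRD sinD cosD; simpc; congr (_ +i* _); ring.
Qed.

Lemma cexp0 : cexp 0 = 1.
Proof. by rewrite cexpE expR0 cos0 sin0 mulr1 mulr0. Qed.

Lemma nm_cexp z : nm (cexp z) = expR (Re z).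
Proof.
rewrite nmM nm_real ger0_norm ?expR_ge0//.
have -> : nm (cos (Im z) +i* sin (Im z)) = 1.
  apply/eqP; rewrite -(@eqrXn2 _ 2) ?nm_ge0 ?ler01//.
  by rewrite nm_sqr /= cos2Dsin2 expr1n.
by rewrite mulr1.
Qed.

Lemma cexp_neq0 z : cexp z != 0.
Proof. by rewrite -nm_gt0 nm_cexp expR_gt0. Qed.

Lemma is_deriveRP (f : R -> R) (a d : R) : is_derive a 1 f d ->
  forall e : R, 0 < e -> exists2 r : R, 0 < r &
    forall x, `|x - a| < r -> `|f x - f a - d * (x - a)| <= e * `|x - a|.
Proof.
move=> [df fd] e e0; move: df => /cvg_ex[l] df.
have ld : l = d by rewrite -fd; apply/esym/cvg_lim.
move: df => /cvgrPdist_le/(_ e e0)/nbhs_ballP[r /= r0 H].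
exists r => // x xr; have [->|xa] := eqVneq x a.
  by rewrite !subrr mulr0 subr0 normr0 mulr0.
have := H (x - a); rewrite -ball_normE /= sub0r normrN => /(_ xr).
rewrite subr_eq0 => /(_ xa); rewrite ld -[_%:A]/(_ * 1) mulr1 subrK => {}H.
have xa0 : x - a != 0 by rewrite subr_eq0.
have -> : f x - f a - d * (x - a) = - ((d - (x - a)^-1 * (f x - f a)) * (x - a)).
  by field.
by rewrite normrN normrM ler_wpM2r.
Qed.

(** By the functional equation it is enough to estimate [cexp h - 1 - h] for
    small [h], which the derivatives of [expR], [cos] and [sin] at [0] do. *)
Lemma is_derive_cexp z : is_derive (z : C^o) 1 (cexp : C^o -> C^o) (cexp z).
Proof.
apply/is_deriveCP => e e0.
pose t := Num.min 1 (e / (6 * expR (Re z))).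
have ez0 := expR_gt0 (Re z).
have [t0 t1 t2] : [/\ 0 < t, t <= 1 & t <= e / (6 * expR (Re z))].
  by rewrite /t; split; rewrite ?lt_min ?ge_min ?lexx ?orbT ?ltr01 ?divr_gt0 ?mulr_gt0.
have t1' : 0 < t / 2 by rewrite divr_gt0.
have [r1 r10 H1] := is_deriveRP (is_derive_expR (0 : R)) t0.
have [r2 r20 H2] := is_deriveRP (is_derive_cos (0 : R)) t0.
have [r3 r30 H3] := is_deriveRP (is_derive_sin (0 : R)) t0.
exists (Num.min (Num.min r1 (t / 2)) (Num.min r2 r3)).
  by rewrite !lt_min r10 r20 r30 t1'.
move=> w; rewrite !lt_min => /andP[/andP[w1 wt] /andP[w2 w3]].
set h := w - z in w1 w2 w3 wt *.
have -> : cexp w - cexp z - cexp z * h = cexp z * (cexp h - 1 - h).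
  have -> : w = z + h by rewrite /h addrC subrK.
  by rewrite cexpD; ring.
rewrite nmM nm_cexp.
have nh := nm_ge0 h; have Rh := Re_le_nm h; have Ih := Im_le_nm h.
have {}H1 := H1 (Re h); have {}H2 := H2 (Im h); have {}H3 := H3 (Im h).
rewrite !subr0 in H1 H2 H3; rewrite expR0 mul1r in H1.
rewrite cos0 sin0 oppr0 mul0r subr0 in H2; rewrite sin0 cos0 subr0 mul1r in H3.
have {}H1 := H1 (le_lt_trans Rh w1); have {}H2 := H2 (le_lt_trans Ih w2).
have {}H3 := H3 (le_lt_trans Ih w3).
pose A := expR (Re h); pose x := Re h; pose y := Im h.
have A1 : `|A - 1| <= 2 * nm h.
  have -> : A - 1 = (A - 1 - x) + x by ring.
  by apply: le_trans (ler_normD _ _) _; have := normr_ge0 x; rewrite -/A -/x in H1 Rh; nra.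
have A2 : `|A| <= 2.
  have -> : A = (A - 1) + 1 by ring.
  by apply: le_trans (ler_normD _ _) _; rewrite normr1; lra.
have main : nm (cexp h - 1 - h) <= 6 * t * nm h.
  have -> : cexp h - 1 - h = A%:C * ((cos y - 1)%:C + 'i * (sin y - y)%:C) +
      (A - 1 - x)%:C + 'i * (y * (A - 1))%:C.
    rewrite cexpE [in X in _ - X](complexE h) -/A -/x -/y.
    by simpc; apply/eqP; rewrite eq_complex /=; apply/andP; split; apply/eqP; ring.
  apply: le_trans (nmD _ _) _.
  rewrite nmM nm_i mul1r nm_real normrM.
  pose N1 := nm ((cos y - 1)%:C + 'i * (sin y - y)%:C).
  have g1 := nmD (A%:C * ((cos y - 1)%:C + 'i * (sin y - y)%:C)) (A - 1 - x)%:C.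
  rewrite nmM !nm_real -/N1 in g1.
  have g2 : N1 <= `|cos y - 1| + `|sin y - y|.
    by apply: le_trans (nmD _ _) _; rewrite nmM nm_i mul1r !nm_real.
  have N10 : 0 <= N1 by exact: nm_ge0.
  rewrite -/A -/x -/y in H1 H2 H3 Rh Ih.
  have B0 : t * `|y| <= t * nm h by rewrite ler_pM2l.
  have B1 : N1 <= 2 * (t * nm h) by lra.
  have B2 : `|A| * N1 <= 2 * (2 * (t * nm h)) by apply: ler_pM.
  have B3 : `|A - 1 - x| <= t * nm h by apply: le_trans H1 _; rewrite ler_pM2l.
  have B4 : `|y| * `|A - 1| <= nm h * t by apply: ler_pM => //; lra.
  lra.
have E : expR (Re z) * (6 * t) <= e by rewrite mulrA mulrC [expR _ * _]mulrC -ler_pdivlMr ?mulr_gt0.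
apply: le_trans (_ : expR (Re z) * (6 * t * nm h) <= _); first by rewrite ler_pM2l.
by rewrite mulrA; apply: ler_wpM2r.
Qed.

Lemma hol_cexp z : hol cexp z. Proof. by case: (is_derive_cexp z). Qed.

(** After reduction to [0 <= x < 2 pi], [cos x = 1 - 2 sin (x / 2) ^+ 2] and the
    sine is positive on the open interval from [0] to [pi]. *)
Lemma cos_eq1 (x : R) : cos x = 1 -> exists m : int, x = m%:~R * (pi *+ 2).
Proof.
move=> cx; have p2 : 0 < pi *+ 2 :> R by rewrite pmulrn_lgt0 ?pi_gt0.
have cper (m : int) (y : R) : cos (y + m%:~R * (pi *+ 2)) = cos y.
  case: m => n.
    by rewrite mulr_natl (periodicn (@cosD2pi R)).
  rewrite NegzE mulrNz mulNr mulr_natl.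
  by rewrite -[in RHS](subrK ((pi *+ 2) *+ n.+1) y) (periodicn (@cosD2pi R)).
pose m := Num.floor (x / (pi *+ 2)); exists m.
pose y := x - m%:~R * (pi *+ 2).
have cy : cos y = 1.
  by rewrite -cx /y -[in RHS](subrK (m%:~R * (pi *+ 2)) x) cper.
have /andP[m1 m2] := floor_itv (x / (pi *+ 2)).
rewrite -/m ler_pdivlMr// in m1; rewrite -/m ltr_pdivrMr// intrD mulrDl mul1r in m2.
have y0 : 0 <= y by rewrite /y subr_ge0.
have y1 : y < pi *+ 2 by rewrite /y ltrBlDl.
have [y0'|y0'] := eqVneq y 0; first by apply/eqP; rewrite -subr_eq0 -/y y0'.
have yp : 0 < y by rewrite lt0r y0'.
have : 0 < sin (y / 2).
  by apply: sin_gt0_pi; rewrite divr_gt0//= ltr_pdivrMr// mulr_natr.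
have : cos ((y / 2) *+ 2) = 1 by rewrite -mulr_natr divfK.
rewrite cos_mulr2n cos2sin2 => H.
have : sin (y / 2) ^+ 2 = 0 by lra.
by move/eqP; rewrite sqrf_eq0 => /eqP ->; rewrite ltxx.
Qed.

Definition twopii : C := 'i * (pi *+ 2)%:C.

Lemma Re_twopii : Re twopii = 0.
Proof. by rewrite /twopii ReM /=; ring. Qed.

Lemma Im_twopii : Im twopii = pi *+ 2.
Proof. by rewrite /twopii ImM /=; ring. Qed.

Lemma twopii_neq0 : twopii != 0.
Proof.
rewrite mulf_neq0// -nm_eq0 ?nm_i ?oner_eq0// nm_real normr_eq0.
by rewrite mulrn_eq0 /= gt_eqF ?pi_gt0.
Qed.

(** The exponential of period [1]. *)
Definition ez z := cexp (twopii * z).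

Lemma ezD z w : ez (z + w) = ez z * ez w.
Proof. by rewrite /ez mulrDr cexpD. Qed.
Lemma ez0 : ez 0 = 1. Proof. by rewrite /ez mulr0 cexp0. Qed.
Lemma ez_neq0 z : ez z != 0. Proof. exact: cexp_neq0. Qed.
Lemma ezN z : ez (- z) = (ez z)^-1.
Proof.
by apply: (mulfI (ez_neq0 z)); rewrite -ezD subrr ez0 mulfV ?ez_neq0.
Qed.

Lemma nm_ez z : nm (ez z) = expR (- ((pi *+ 2) * Im z)).
Proof. by rewrite nm_cexp ReM Re_twopii Im_twopii mul0r sub0r. Qed.

Lemma ez1 : ez 1 = 1.
Proof.
rewrite /ez mulr1 cexpE Re_twopii Im_twopii expR0 cos2pi sin2pi.
by rewrite mulr1 mulr0.
Qed.

Lemma ez_eq1 z : ez z = 1 -> exists m : int, z = m%:~R.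
Proof.
move=> z1; have := nm_ez z; rewrite z1 nm1 -[X in X = _]expR0 => /expR_inj/esym/eqP.
rewrite oppr_eq0 mulf_eq0 mulrn_eq0 /= gt_eqF ?pi_gt0//= => /eqP iz.
move: z1; rewrite /ez cexpE (ReM twopii) (ImM twopii) Re_twopii Im_twopii iz.
rewrite !(mulr0, mul0r, subr0, add0r).
rewrite oppr0 expR0 !mul1r => -[cz _].
have [m mE] := cos_eq1 cz; exists m.
have p2 : (pi *+ 2 : R) != 0 by rewrite mulrn_eq0 /= gt_eqF ?pi_gt0.
have -> : z = (Re z)%:C by rewrite [LHS]complexE iz mulr0 addr0.
have -> : Re z = m%:~R by apply: (mulfI p2); rewrite mE mulrC.
by rewrite rmorph_int.
Qed.

Lemma hol_ez z : hol ez z.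
Proof.
apply: (@hol_comp _ cexp (fun w => twopii * w)); last exact: hol_cexp.
by apply: holM; [exact: hol_cst|exact: hol_id].
Qed.

Lemma is_derive_ez0 : is_derive (0 : C^o) 1 (ez : C^o -> C^o) twopii.
Proof.
apply/is_deriveCP => e e0.
have n0 : 0 < nm twopii by rewrite nm_gt0 twopii_neq0.
have [|r r0 H] := (is_deriveCP cexp 0 (cexp 0)).1 (is_derive_cexp 0) (e / nm twopii).
  by rewrite divr_gt0.
exists (r / nm twopii); first by rewrite divr_gt0.
move=> z; rewrite subr0 ltr_pdivlMr// mulrC -nmM => zr.
have := H (twopii * z); rewrite !subr0 cexp0 mul1r => /(_ zr).
by rewrite nmM /ez mulr0 cexp0 mulrA divfK// lt0r_neq0.
Qed.

End Exponential.

(** * The theta function of a lattice *)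

Section QProduct.
Variable R : realType.
Local Notation C := (R[i]).
Implicit Types (z w u : C).

(** Completeness of the complex plane, for sequences with geometric steps. *)
Lemma geometric_limit (a : nat -> C) (K rho : R) : 0 <= K -> 0 <= rho < 1 ->
  (forall n, nm (a n.+1 - a n) <= K * rho ^+ n) ->
  exists l : C, forall n, nm (a n - l) <= 4 * K / (1 - rho) * rho ^+ n.
Proof.
move=> K0 /andP[r0 r1] step; have d0 : 0 < 1 - rho by rewrite subr_gt0.
pose V n := K / (1 - rho) * rho ^+ n.
have V0 n : 0 <= V n by rewrite mulr_ge0 ?exprn_ge0 ?divr_ge0// ltW.
have VS n : V n - V n.+1 = K * rho ^+ n.
  by rewrite /V exprS; field; exact: lt0r_neq0.
have key (x : nat -> R) : (forall n, `|x n.+1 - x n| <= K * rho ^+ n) ->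
    exists l, forall n, `|x n - l| <= 2 * V n.
  move=> hx.
  have [||l hl] := @nested_intervals R (fun n => x n - V n) (fun n => 2 * V n).
  - by move=> n; rewrite mulr_ge0.
  - move=> n; have := hx n; rewrite ler_norml -VS => /andP[h1 h2]; split; lra.
  exists l => n; have /andP[h1 h2] := hl n.
  by rewrite ler_norml; apply/andP; split; lra.
have [|lr hlr] := key (fun n => Re (a n)).
  by move=> n; rewrite -ReN -ReD; apply: le_trans (Re_le_nm _) (step n).
have [|li hli] := key (fun n => Im (a n)).
  by move=> n; rewrite -ImN -ImD; apply: le_trans (Im_le_nm _) (step n).
exists (lr +i* li) => n; apply: le_trans (nm_le _) _.
rewrite ReD ReN ImD ImN /=; have := hlr n; have := hli n.
have -> : 4 * K / (1 - rho) * rho ^+ n = 4 * V n by rewrite /V; ring.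
lra.
Qed.

Variable q : C.
Hypothesis q1 : nm q < 1.
Let rho := nm q.
Let rho0 : 0 <= rho. Proof. exact: nm_ge0. Qed.
Let d0 : 0 < 1 - rho. Proof. by rewrite subr_gt0. Qed.

Let Tn n u : C := \prod_(k < n) (1 - q ^+ k * u).

Let TnS n u : Tn n.+1 u = Tn n u * (1 - q ^+ n * u).
Proof. by rewrite /Tn big_ord_recr. Qed.

Let TnSl n u : Tn n.+1 u = (1 - u) * Tn n (q * u).
Proof.
rewrite /Tn big_ord_recl /= expr0 mul1r; congr (_ * _).
by apply: eq_bigr => k _; rewrite /= exprSr mulrA.
Qed.

(** From [1 + x <= exp x] and the geometric series. *)
Let Tn_bound (U : R) n u : nm u <= U -> nm (Tn n u) <= expR (U / (1 - rho)).
Proof.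
move=> uU; have U0 : 0 <= U by apply: le_trans uU; exact: nm_ge0.
have H : nm (Tn n u) <= expR (U * ((1 - rho ^+ n) / (1 - rho))).
  elim: n => [|n IH].
    by rewrite /Tn big_ord0 nm1 expr0 subrr mul0r mulr0 expR0.
  rewrite TnS nmM.
  have -> : U * ((1 - rho ^+ n.+1) / (1 - rho)) =
      U * ((1 - rho ^+ n) / (1 - rho)) + U * rho ^+ n.
    by rewrite exprS; field; exact: lt0r_neq0.
  rewrite expRD; apply: ler_pM; rewrite ?nm_ge0//.
  apply: le_trans (expR_ge1Dx _); apply: le_trans (nmD _ _) _.
  rewrite nm1 nmN nmM nmX -/rho lerD2l mulrC; apply: ler_wpM2r => //.
  exact: exprn_ge0.
apply: le_trans H _; rewrite ler_expR ler_wpM2l// ler_pdivrMr// mulVf ?lt0r_neq0//.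
by rewrite gerBl exprn_ge0.
Qed.

Let Kb U : R := 4 * (U * expR (U / (1 - rho))) / (1 - rho).

Let T_exists u : exists l, forall n, nm (Tn n u - l) <= Kb (nm u) * rho ^+ n.
Proof.
apply: geometric_limit; rewrite ?rho0//.
  by rewrite mulr_ge0 ?nm_ge0 ?expR_ge0.
move=> n; rewrite TnS mulrBr mulr1 addrAC subrr add0r nmN !nmM nmX -/rho.
rewrite mulrCA mulrC; apply: ler_wpM2r; first exact: exprn_ge0.
by rewrite mulrC; apply: ler_wpM2l; [exact: nm_ge0|exact: Tn_bound].
Qed.

Let T u : C := projT1 (cid (T_exists u)).
Let TP u n : nm (Tn n u - T u) <= Kb (nm u) * rho ^+ n.
Proof. by rewrite /T; case: cid. Qed.

Let Kb_ge0 U : 0 <= U -> 0 <= Kb U.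
Proof. by move=> U0; rewrite divr_ge0 ?mulr_ge0 ?expR_ge0// ltW. Qed.

Let le_Kb U V : 0 <= U -> U <= V -> Kb U <= Kb V.
Proof.
move=> U0 UV; rewrite ler_wpM2r ?invr_ge0 ?(ltW d0)// ler_wpM2l//.
apply: ler_pM; rewrite ?expR_ge0// ler_expR ler_wpM2r// invr_ge0 ltW//.
Qed.

Let rho_small (K e : R) : 0 <= K -> 0 < e -> exists N, forall n, (N <= n)%N ->
  K * rho ^+ n <= e.
Proof.
move=> K0 e0; have x1 : `|rho| < 1 by rewrite ger0_norm.
have /cvgrPdist_lt/(_ (e / (K + 1))) := cvg_expr x1.
case; first by rewrite divr_gt0// ltr_wpDl.
move=> N _ H; exists N => n /H /=.
rewrite sub0r normrN normrX ger0_norm// ltr_pdivlMr ?ltr_wpDl// => H'.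
by have : 0 <= rho ^+ n by [exact: exprn_ge0]; lra.
Qed.

Let T_lim u e : 0 < e -> exists N, forall n, (N <= n)%N -> nm (Tn n u - T u) <= e.
Proof.
move=> e0; have [N HN] := rho_small (Kb_ge0 (nm_ge0 u)) e0.
by exists N => n /HN; apply: le_trans; exact: TP.
Qed.

Let T_hol u : hol T u.
Proof.
apply: (@hol_unif_limit R Tn).
  move=> n z; elim: n => [|n IH].
    have -> : Tn 0 = (fun=> 1) by apply/funext => w; rewrite /Tn big_ord0.
    exact: hol_cst.
  have -> : Tn n.+1 = (fun w => Tn n w * (1 - q ^+ n * w)) by apply/funext => w; rewrite TnS.
  apply: holM; first exact: IH.
  apply: holB; first exact: hol_cst.
  by apply: holM; [exact: hol_cst|exact: hol_id].
move=> B e e0.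
have [N HN] := rho_small (Kb_ge0 (normr_ge0 B)) e0.
exists N => z zB; apply: le_trans (HN N (leqnn N)); apply: le_trans (TP z N) _.
apply: ler_wpM2r; first exact: exprn_ge0.
by apply: le_Kb; [exact: nm_ge0|exact: le_trans (ler_norm B)].
Qed.

Let eqC z w : (forall e, 0 < e -> nm (z - w) <= e) -> z = w.
Proof.
move=> h; apply/eqP; rewrite -subr_eq0 -nm_eq0 eq_le nm_ge0 andbT.
by apply/ler_addgt0Pr => e e0; rewrite add0r h.
Qed.

Let TE u : T u = (1 - u) * T (q * u).
Proof.
apply: eqC => e e0; pose K := nm (1 - u) + 1.
have K0 : 0 < K by rewrite ltr_wpDl ?nm_ge0.
have [N HN] := T_lim u (divr_gt0 e0 (ltr0n R 2)).
have [M HM] := T_lim (q * u) (divr_gt0 e0 (mulr_gt0 (ltr0n R 2) K0)).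
pose n := maxn N M.
have := HN n.+1 (leqW (leq_maxl _ _)); have := HM n (leq_maxr _ _).
rewrite TnSl => h1 h2.
have -> : T u - (1 - u) * T (q * u) =
  - ((1 - u) * Tn n (q * u) - T u) + (1 - u) * (Tn n (q * u) - T (q * u)) by ring.
apply: le_trans (nmD _ _) _; rewrite nmN nmM.
have : nm (1 - u) * nm (Tn n (q * u) - T (q * u)) <= K * (e / (2 * K)).
  by apply: ler_pM; rewrite ?nm_ge0// /K lerDl.
have -> : K * (e / (2 * K)) = e / 2 by field; exact: lt0r_neq0.
lra.
Qed.

Let T0 : T 0 = 1.
Proof.
apply: eqC => e e0; have [N /(_ _ (leqnn N))] := T_lim 0 e0.
have -> : Tn N 0 = 1.
  by rewrite /Tn big1// => k _; rewrite mulr0 subr0.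
by rewrite nmB.
Qed.

Let T_Tn n u : T u = Tn n u * T (q ^+ n * u).
Proof.
elim: n => [|n IH]; first by rewrite /Tn big_ord0 expr0 !mul1r.
by rewrite {1}IH TE TnS exprS mulrA -!mulrA.
Qed.

(** [T] is not zero near [0], where it is close to [T 0 = 1]; iterating the
    functional equation brings [u] close to [0]. *)
Let T_zero u : T u = 0 -> exists k : nat, q ^+ k * u = 1.
Proof.
move=> Tu.
have [|d dd H] := hol_ccont (@T_hol 0) (e := 1); first exact: ltr01.
have [N /(_ _ (leqnn N)) HN] := rho_small (nm_ge0 u) (divr_gt0 dd (ltr0n R 2)).
have TN0 : T (q ^+ N * u) != 0.
  have := H (q ^+ N * u); rewrite subr0 nmM nmX -/rho T0.
  have L : rho ^+ N * nm u < d by rewrite mulrC; lra.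
  move=> /(_ L); apply: contraTneq => ->.
  by rewrite sub0r nmN nm1 ltxx.
move: (T_Tn N u); rewrite Tu => /esym/eqP; rewrite mulf_eq0 (negbTE TN0) orbF.
move=> /prodf_eq0[k _]; rewrite subr_eq0 eq_sym => /eqP kE.
by exists k.
Qed.

(** For [T u] the limit of the partial products of [1 - q ^ k * u]. Only these
    three properties are used to build the theta function. *)
Theorem qproduct : exists T : C -> C, [/\ forall u, hol T u,
  forall u, T u = (1 - u) * T (q * u) &
  forall u, T u = 0 -> exists k : nat, q ^+ k * u = 1].
Proof. by exists T. Qed.

End QProduct.

Section Theta.
Variable R : realType.
Local Notation C := (R[i]).
Implicit Types (z w u : C).

Section Construction.
Variable tau : C.
Hypothesis tau0 : 0 < Im tau.
Let q := ez tau.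
Variable T : C -> C.
Hypothesis T_hol : forall u, hol T u.
Hypothesis TE : forall u, T u = (1 - u) * T (q * u).
Hypothesis T_zero : forall u, T u = 0 -> exists k : nat, q ^+ k * u = 1.

(** The Jacobi triple product, without its constant factor. *)
Let theta z := T (ez z) * T (q * ez (- z)).

Let theta_hol z : hol theta z.
Proof.
have he (w : C) : hol (fun w : C => ez (- w)) w.
  apply: (@hol_comp _ (@ez R) (fun w => - w)); last exact: hol_ez.
  by apply: holN; exact: hol_id.
apply: holM.
  by apply: (@hol_comp _ T (@ez R)); [exact: hol_ez|exact: T_hol].
apply: (@hol_comp _ T (fun w => q * ez (- w))); last exact: T_hol.
by apply: holM; [exact: hol_cst|exact: he].
Qed.

Let theta1 z : theta (z + 1) = theta z.
Proof. by rewrite /theta opprD !ezD (ezN 1) ez1 invr1 !mulr1. Qed.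

(** Adding [tau] multiplies [ez z] by [q], which moves one factor from one of the
    two products to the other: [1 - u] is replaced by [1 - u^-1]. *)
Let theta_tau z : theta (z + tau) = - (ez z)^-1 * theta z.
Proof.
have q0 : q != 0 by exact: ez_neq0.
have qE : q * ez (- (z + tau)) = (ez z)^-1.
  by rewrite opprD ezD !ezN -/q mulrCA mulfV// mulr1.
have qE' : ez (z + tau) = q * ez z by rewrite ezD mulrC.
rewrite /theta qE qE' ezN [T (ez z)]TE [T (ez z)^-1]TE.
by field; exact: ez_neq0.
Qed.

Let ezM z n : ez (z *+ n) = ez z ^+ n.
Proof. by elim: n => [|n IH]; rewrite ?ez0// mulrS ezD IH exprS. Qed.

Let theta_zero z : theta z = 0 -> exists m n : int, z = m%:~R + n%:~R * tau.
Proof.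
move/eqP; rewrite mulf_eq0 => /orP[] /eqP/T_zero[k].
  rewrite -ezM -ezD => /ez_eq1[m mE]; exists m, (- k%:Z).
  by rewrite -mE mulrNz mulNr mulr_natl; ring.
rewrite mulrA -exprSr -ezM -ezD => /ez_eq1[m mE]; exists (- m), (k.+1%:Z).
by rewrite mulrNz -mE mulr_natl; ring.
Qed.

(** The zeros at the other lattice points are obtained from the one at the origin
    by this quasi-periodicity. *)
Let theta_period (m n : int) : exists2 c : C, c != 0 & exists k : int,
  forall z, theta (z + (m%:~R + n%:~R * tau)) = c * ez z ^ k * theta z.
Proof.
have per (j : int) z : theta (z + j%:~R) = theta z.
  have H (i : nat) y : theta (y + i%:R) = theta y.
    by elim: i => [|i IH]; rewrite ?addr0// -addn1 natrD addrA theta1.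
  case: j => i; first exact: H.
  by rewrite NegzE mulrNz -[in RHS](subrK i.+1%:R z) H.
have step z : theta (z - tau) = - ez (z - tau) * theta z.
  rewrite -[in theta z](subrK tau z) theta_tau mulrA mulNr mulrN opprK.
  by rewrite mulfV ?mul1r ?ez_neq0.
suff [c c0 [k H]] : exists2 c : C, c != 0 & exists k : int,
    forall z, theta (z + n%:~R * tau) = c * ez z ^ k * theta z.
  by exists c => //; exists k => z; rewrite [m%:~R + _]addrC addrA per H.
elim/int_rect: n => [|n [c c0 [k H]]|n [c c0 [k H]]].
- by exists 1; [exact: oner_neq0|exists 0 => z; rewrite mul0r addr0 expr0z !mul1r].
- exists (- (ez (n%:R * tau))^-1 * c).
    by rewrite mulf_neq0// oppr_eq0 invr_eq0 ez_neq0.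
  exists (k - 1) => z.
  have -> : z + n.+1%:~R * tau = (z + n%:R * tau) + tau.
    by rewrite -addn1 PoszD intrD mulrDl mul1r addrA.
  rewrite theta_tau H ezD expfzDr ?ez_neq0// exprN1; field.
  by rewrite !ez_neq0.
- exists (- ez (- (n.+1%:R * tau)) * c).
    by rewrite mulf_neq0// oppr_eq0 ez_neq0.
  exists (k + 1) => z.
  have -> : z + (- n.+1%:Z)%:~R * tau = (z + (- n%:Z)%:~R * tau) - tau.
    by rewrite -addn1 PoszD opprD intrD mulrDl mulrN1z mulNr mul1r addrA.
  rewrite step H.
  have -> : z + (- n%:Z)%:~R * tau - tau = z + - (n.+1%:R * tau).
    by rewrite mulrNz mulNr -addrA -opprD -natr1 mulrDl mul1r.
  rewrite ezD expfzDr ?ez_neq0// expr1z; ring.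
Qed.

(** The zero at the origin comes from the factor [1 - ez z] alone. *)
Let theta_origin : exists2 u : C -> C,
  (\forall z \near (0 : C^o), hol u z) /\ u 0 != 0 &
  \forall z \near (0 : C^o), theta z = z * u z.
Proof.
have [|e [he eE e0]] := @hol_factor R (@ez R) 0.
  by apply: filterE => z; exact: hol_ez.
pose G z := T (q * ez z) * T (q * ez (- z)).
have hG z : hol G z.
  apply: holM.
    apply: (@hol_comp _ T (fun w => q * ez w)); last exact: T_hol.
    by apply: holM; [exact: hol_cst|exact: hol_ez].
  apply: (@hol_comp _ T (fun w => q * ez (- w))); last exact: T_hol.
  apply: holM; first exact: hol_cst.
  apply: (@hol_comp _ (@ez R) (fun w => - w)); last exact: hol_ez.
  by apply: holN; exact: hol_id.
exists (fun z => - e z * G z).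
  split.
    apply: filterS he => z hz; apply: holM; last exact: hG.
    exact: holN.
  have -> : e 0 = twopii R.
    by case: e0 => _ <-; case: (is_derive_ez0 R) => _ ->.
  rewrite mulf_neq0 ?oppr_eq0 ?twopii_neq0// /G oppr0 ez0 mulr1.
  have q1 : nm q < 1.
    by rewrite nm_ez expR_lt1 oppr_lt0 mulr_gt0// pmulrn_lgt0 ?pi_gt0.
  have Tq : T q != 0.
    apply/eqP => /T_zero[k]; rewrite -exprSr => /(congr1 (@nm R)).
    rewrite nmX nm1 => E.
    by have := exprn_ilt1 k.+1 (nm_ge0 q) q1; rewrite E ltxx.
  by rewrite mulf_neq0.
apply: filterS eE => z zE.
by rewrite /theta (TE (ez z)) /G {1}zE ez0 subr0; ring.
Qed.

Theorem theta_construction : exists theta : C -> C,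
  [/\ forall z, hol theta z,
      forall z, theta (z + 1) = theta z,
      forall z, theta (z + tau) = - (ez z)^-1 * theta z,
      forall z, theta z = 0 -> exists m n : int, z = m%:~R + n%:~R * tau &
      forall m n : int, let o : C := m%:~R + n%:~R * tau in
        exists2 u : C -> C, (\forall z \near (o : C^o), hol u z) /\ u o != 0 &
          \forall z \near (o : C^o), theta z = (z - o) * u z].
Proof.
exists theta; split => // m n o.
have [c c0 [k H]] := theta_period m n; have [u [hu u0] uE] := theta_origin.
have shift (P : C -> Prop) : (\forall z \near (0 : C^o), P z) ->
    \forall z \near (o : C^o), P (z - o).
  move=> /nbhsC[e e0 eP]; apply/nbhsC; exists e => // z zo.
  by apply: eP; rewrite subr0.
have hs z : hol (fun z => z - o) z by apply: holB; [exact: hol_id|exact: hol_cst].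
exists (fun z => c * ez (z - o) ^ k * u (z - o)).
  split; last first.
    by rewrite subrr ez0 exp1rz mulr1 mulf_neq0.
  apply: filterS (shift _ hu) => z hz; apply: holM.
    apply: holM; first exact: hol_cst.
    apply: hol_exprz; first exact: ez_neq0.
    apply: (@hol_comp _ (@ez R) (fun w => w - o)); [exact: hs|exact: hol_ez].
  by apply: (@hol_comp _ u (fun w => w - o)); [exact: hs|exact: hz].
apply: filterS (shift _ uE) => z zE.
have := H (z - o); rewrite -/o subrK zE => ->; ring.
Qed.

End Construction.

Theorem theta_exists (tau : C) : 0 < Im tau -> exists theta : C -> C,
  [/\ forall z, hol theta z,
      forall z, theta (z + 1) = theta z,
      forall z, theta (z + tau) = - (ez z)^-1 * theta z,
      forall z, theta z = 0 -> exists m n : int, z = m%:~R + n%:~R * tau &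
      forall m n : int, let o : C := m%:~R + n%:~R * tau in
        exists2 u : C -> C, (\forall z \near (o : C^o), hol u z) /\ u o != 0 &
          \forall z \near (o : C^o), theta z = (z - o) * u z].
Proof.
move=> t0; have q1 : nm (ez tau) < 1.
  by rewrite nm_ez expR_lt1 oppr_lt0 mulr_gt0// pmulrn_lgt0 ?pi_gt0.
have [T [h1 h2 h3]] := qproduct q1.
apply: (@theta_construction tau t0 T); [exact: h1|exact: h2|exact: h3].
Qed.

End Theta.

(** * Orders of doubly periodic meromorphic functions *)

Section NearTools.
Variable R : realType.
Local Notation C := (R[i]).
Implicit Types (f g h : C -> C) (a z w : C).

Lemma near_dnbhs a (P : C -> Prop) :
  (\forall z \near (a : C^o), P z) -> \forall z \near (a : C^o)^', P z.
Proof. exact: cvg_within. Qed.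

Lemma dnbhs_ex a (P : C -> Prop) :
  (\forall z \near (a : C^o)^', P z) -> forall e : R, 0 < e ->
  exists z, [/\ P z, nm (z - a) < e & z != a].
Proof.
move=> /dnbhsC[d d0 H] e e0; pose t := Num.min d e / 2.
have t0 : 0 < t by rewrite divr_gt0// lt_min d0.
have tm : t < Num.min d e by rewrite /t ltr_pdivrMr// ltr_pMr ?ltr1n// lt_min d0.
rewrite lt_min in tm; case/andP: tm => td te.
have E : a + t%:C - a = t%:C by rewrite addrC addKr.
have nE : nm (a + t%:C - a) = t by rewrite E nm_real gtr0_norm.
have neq : a + t%:C != a by rewrite -subr_eq0 -nm_eq0 nE gt_eqF.
by exists (a + t%:C); split => //; [apply: H => //|]; rewrite nE.
Qed.

(** Orders are defined in terms of punctured neighbourhoods; continuity is what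
    allows to pass to the centre. *)
Lemma ccont_punctured_eq f g a : ccont f a -> ccont g a ->
  (\forall z \near (a : C^o)^', f z = g z) -> f a = g a.
Proof.
move=> cf cg fg; apply/eqP; rewrite -subr_eq0 -nm_eq0 eq_le nm_ge0 andbT.
apply/ler_addgt0Pr => e e0; rewrite add0r.
have e2 : 0 < e / 2 by rewrite divr_gt0.
have [d1 d10 H1] := cf _ e2; have [d2 d20 H2] := cg _ e2.
have dm : 0 < Num.min d1 d2 by rewrite lt_min d10.
have [z [zE]] := dnbhs_ex fg dm.
rewrite lt_min => /andP[/H1 h1 /H2 h2] _.
by have := nm_tri (f a) (g a) (f z); rewrite {2}zE (nmB (f a) (f z)); lra.
Qed.

Lemma punctured_near a (P : C -> Prop) : (\forall z \near (a : C^o)^', P z) ->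
  \forall z \near (a : C^o)^', \forall w \near (z : C^o), P w.
Proof.
move=> /dnbhsC[d d0 H]; apply/dnbhsC; exists d => // z zd za.
apply/nbhsC; exists (Num.min (d - nm (z - a)) (nm (z - a))).
  by rewrite lt_min subr_gt0 zd nm_gt0 subr_eq0.
move=> w; rewrite lt_min => /andP[w1 w2]; apply: H.
  by have := nm_tri w a z; lra.
by apply: contraTneq w2 => ->; rewrite -leNgt nmB.
Qed.

(** The entire function takes at [a] the value of the local extension at [a];
    near [a] it agrees with that extension, by continuity. *)
Lemma glue_entire f :
  (forall a, exists2 g : C -> C, \forall z \near (a : C^o), hol g z &
     \forall z \near (a : C^o)^', f z = g z) ->
  exists2 F : C -> C, forall z, hol F z &
    forall a, \forall z \near (a : C^o)^', F z = f z.
Proof.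
move=> loc.
pose G a := projT1 (cid2 (loc a)).
have GP a : (\forall z \near (a : C^o), hol (G a) z) /\
    (\forall z \near (a : C^o)^', f z = G a z).
  by rewrite /G; case: cid2.
pose F a := G a a.
have FG a : \forall z \near (a : C^o), F z = G a z.
  have [hG fG] := GP a.
  have : \forall z \near (a : C^o)^', F z = G a z.
    have hG' := near_dnbhs hG; have fG' := punctured_near fG.
    apply: filterS2 hG' fG' => z hz fz.
    apply: (@ccont_punctured_eq (G z) (G a) z).
    - exact: hol_ccont (nbhs_singleton (GP z).1).
    - exact: hol_ccont hz.
    - apply: filterS2 (GP z).2 (near_dnbhs fz) => w h1 h2.
      exact (etrans (esym h1) h2).
  move=> /dnbhsC[d d0 H]; apply/nbhsC; exists d; first exact: d0.
  move=> z zd; have [->|za] := eqVneq z a; first by [].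
  exact: (H z zd za).
exists F => a.
  apply: (@eq_hol _ (G a)); last exact: nbhs_singleton (GP a).1.
  by apply: filterS (FG a) => z ->.
apply: filterS2 (near_dnbhs (FG a)) (GP a).2 => z h1 h2.
exact (etrans h1 (esym h2)).
Qed.

Lemma nm_exprz z (n : int) : nm (z ^ n) = nm z ^ n.
Proof. by case: n => n; rewrite /exprz ?nmV nmX. Qed.

Lemma expR_exprz (y : R) (n : int) : expR y ^ n = expR (n%:~R * y).
Proof.
have H (m : nat) : expR y ^+ m = expR (m%:R * y) by rewrite expRM_natl.
case: n => n; first exact: H.
have -> : (Negz n)%:~R = - n.+1%:R :> R by rewrite NegzE mulrNz.
by rewrite mulNr expRN -H.
Qed.

End NearTools.

Section ThetaQuotient.
Variable R : realType.
Local Notation C := (R[i]).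
Variables (tau : C) (theta : C -> C).
Hypothesis tau0 : 0 < Im tau.
Hypothesis th_hol : forall z, hol theta z.
Hypothesis th_1 : forall z, theta (z + 1) = theta z.
Hypothesis th_tau : forall z, theta (z + tau) = - (ez z)^-1 * theta z.
Hypothesis th_zero :
  forall z, theta z = 0 -> exists m n : int, z = m%:~R + n%:~R * tau.
Hypothesis th_simple : forall m n : int, let o : C := m%:~R + n%:~R * tau in
  exists2 u : C -> C, (\forall z \near (o : C^o), hol u z) /\ u o != 0 &
    \forall z \near (o : C^o), theta z = (z - o) * u z.

(** All that matters of the elliptic curve here is its set of points [X], the
    projection [P] and a lift [a x] of each point; [o] is a divisor. *)
Variables (X : eqType) (P : C -> X) (a : X -> C) (o : X -> int).
Hypothesis Pa : forall x, P (a x) = x.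
Hypothesis PP : forall z w, P z = P w <->
  exists m n : int, z - w = m%:~R + n%:~R * tau.

Definition theta_prod (S : seq X) (z : C) : C :=
  \prod_(x <- S) theta (z - a x) ^ (- o x).

Lemma near_shift (b c : C) (Q : C -> Prop) : (\forall z \near ((b - c : C) : C^o), Q z) ->
  \forall z \near (b : C^o), Q (z - c).
Proof.
move=> /nbhsC[e e0 H]; apply/nbhsC; exists e => // z zb; apply: H.
by have -> : z - c - (b - c) = z - b by ring.
Qed.

Lemma hol_shift (c : C) z : hol (fun w : C => w - c) z.
Proof. by apply: holB; [exact: hol_id|exact: hol_cst]. Qed.

(** A translate of theta has at [z0] a simple zero or no zero, according to
    whether [z0] lies over [x]. *)
Lemma theta_factor_local x (n : int) z0 : exists V : C -> C,
  [/\ \forall z \near (z0 : C^o), hol V z, V z0 != 0 &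
    \forall z \near (z0 : C^o)^',
      theta (z - a x) ^ n = (z - z0) ^ (if P z0 == x then n else 0) * V z].
Proof.
have [zx|zx] := eqVneq (P z0) x.
  have [m [k E]] : exists m k : int, z0 - a x = m%:~R + k%:~R * tau.
    by apply/PP; rewrite Pa.
  have [u [hu u0] uE] := th_simple m k; rewrite -E in hu u0 uE.
  have cu : ccont u (z0 - a x) by apply: hol_ccont; exact: nbhs_singleton hu.
  have u0' := near_neq0 cu u0.
  exists (fun z => u (z - a x) ^ n); split.
  - apply: filterS2 (near_shift hu) (near_shift u0') => z hz z0'.
    apply: hol_exprz; first exact: z0'.
    by apply: (@hol_comp _ u (fun w => w - a x)); [exact: hol_shift|exact: hz].
  - by rewrite expfz_neq0.
  - apply: filterS (near_dnbhs (near_shift uE)) => z ->.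
    rewrite -expfzMl; congr (_ ^ n); congr (_ * _); ring.
have t0 : theta (z0 - a x) != 0.
  apply: contra_neq zx => /th_zero/PP ->; exact: Pa.
have ht z : hol (fun w => theta (w - a x)) z.
  by apply: (@hol_comp _ theta (fun w => w - a x)); [exact: hol_shift|exact: th_hol].
exists (fun z => theta (z - a x) ^ n); split.
- have H := near_neq0 (hol_ccont (ht z0)) t0.
  by apply: filterS H => z zn; apply: hol_exprz; [exact: zn|exact: ht].
- by rewrite expfz_neq0.
- by apply: filterE => z; rewrite expr0z mul1r.
Qed.

Lemma theta_prod_local (S : seq X) z0 : exists V : C -> C,
  [/\ \forall z \near (z0 : C^o), hol V z, V z0 != 0 &
    \forall z \near (z0 : C^o)^', theta_prod S z =
      (z - z0) ^ (- \sum_(x <- S | P z0 == x) o x) * V z].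
Proof.
elim: S => [|x S [V [hV V0 VE]]].
  exists (fun=> 1); split; [|exact: oner_neq0|].
    by apply: filterE => z; exact: hol_cst.
  by apply: filterE => z; rewrite /theta_prod !big_nil oppr0 expr0z mulr1.
have [W [hW W0 WE]] := theta_factor_local x (- o x) z0.
exists (fun z => W z * V z); split.
- by apply: filterS2 hW hV => z h1 h2; exact: holM h1 h2.
- by rewrite mulf_neq0.
- have ne : \forall z \near (z0 : C^o)^', z != z0.
    by apply/dnbhsC; exists 1.
  apply: filterS3 WE VE ne => z zW zV zz.
  rewrite /theta_prod !big_cons -/(theta_prod S z) zW zV.
  have d0 : z - z0 != 0 by rewrite subr_eq0.
  case: ifP => _; last by rewrite expr0z mul1r mulrCA.
  by rewrite opprD expfzDr//; ring.
Qed.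

Variable h : C -> C.
Hypothesis hP : forall z w, P z = P w -> h z = h w.
Hypothesis h_ord : forall z0, exists2 g : C -> C,
  \forall z \near (z0 : C^o), hol g z &
  \forall z \near (z0 : C^o)^', h z = (z - z0) ^ o (P z0) * g z.
Variable S : seq X.
Hypothesis uS : uniq S.
Hypothesis oS : forall x, o x != 0 -> x \in S.

(** The theta quotient has order [- o x] over [x] and [h] has order at least
    [o x], so that all the singularities of [F0] are removable. *)
Let F0 z := h z * theta_prod S z.

Let sum_at x : \sum_(y <- S | x == y) o y = o x.
Proof.
have [xS|xS] := boolP (x \in S).
  rewrite big_mkcond (bigD1_seq x)//= eqxx big1 ?addr0// => y yx.
  by rewrite eq_sym (negbTE yx).
rewrite big_seq_cond big1; last first.
  by move=> y /andP[yS /eqP xy]; rewrite xy yS in xS.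
by apply/esym/eqP; apply: contraNT xS => /oS.
Qed.

Let F0_local z0 : exists2 g : C -> C, \forall z \near (z0 : C^o), hol g z &
  \forall z \near (z0 : C^o)^', F0 z = g z.
Proof.
have [g hg gE] := h_ord z0; have [V [hV V0 VE]] := theta_prod_local S z0.
exists (fun z => g z * V z); first by apply: filterS2 hg hV => z h1 h2; exact: holM h1 h2.
have ne : \forall z \near (z0 : C^o)^', z != z0 by apply/dnbhsC; exists 1.
apply: filterS3 gE VE ne => z zg zV zz; rewrite /F0 zg zV sum_at.
have d0 : z - z0 != 0 by rewrite subr_eq0.
have : (z - z0) ^ o (P z0) * (z - z0) ^ (- o (P z0)) = 1.
  by rewrite -expfzDr// subrr expr0z.
move=> E; rewrite mulrACA E mul1r //.
Qed.

(** The factor of automorphy of the theta quotient. Its modulus is the exponential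
    of an affine function of [Im z], of slope [- 2 pi d]. *)
Let mult z : C := \prod_(x <- S) (- (ez (z - a x))^-1) ^ (- o x).

Let F0_1 z : F0 (z + 1) = F0 z.
Proof.
rewrite /F0 (@hP (z + 1) z); last first.
  by apply/PP; exists 1, 0; rewrite mul0r addr0 addrC addKr.
by congr (_ * _); apply: eq_bigr => x _; rewrite addrAC th_1.
Qed.

Let F0_tau z : F0 (z + tau) = F0 z * mult z.
Proof.
rewrite /F0 (@hP (z + tau) z); last first.
  by apply/PP; exists 0, 1; rewrite mul1r add0r addrC addKr.
rewrite -mulrA -big_split /=; congr (_ * _); apply: eq_bigr => x _.
by rewrite addrAC th_tau expfzMl mulrC.
Qed.

Let d : int := \sum_(x <- S) o x.
Let b : R := \sum_(x <- S) (o x)%:~R * Im (a x).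

Let nm_mult z : nm (mult z) = expR ((pi *+ 2) * (b - d%:~R * Im z)).
Proof.
rewrite /mult /b /d; elim: S => [|x s IH].
  by rewrite !big_nil nm1 mul0r subr0 mulr0 expR0.
rewrite !big_cons nmM IH nm_exprz nmN nmV nm_ez.
rewrite -expRN expR_exprz -expRD ImD ImN intrD mulrNz; congr expR; ring.
Qed.

Let hol_mult z : hol mult z.
Proof.
rewrite /mult; elim: S => [|x s IH].
  have -> : (fun z => \prod_(x <- [::]) (- (ez (z - a x))^-1) ^ (- o x)) = (fun=> 1).
    by apply/funext => w; rewrite big_nil.
  exact: hol_cst.
have -> : (fun z => \prod_(x <- x :: s) (- (ez (z - a x))^-1) ^ (- o x)) =
  (fun z => (- (ez (z - a x))^-1) ^ (- o x) *
    \prod_(x <- s) (- (ez (z - a x))^-1) ^ (- o x)).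
  by apply/funext => w; rewrite big_cons.
apply: holM; last exact: IH.
apply: hol_exprz; first by rewrite oppr_eq0 invr_eq0 ez_neq0.
apply: holN; apply: holV; first exact: ez_neq0.
by apply: (@hol_comp _ (@ez R) (fun w => w - a x)); [exact: hol_shift|exact: hol_ez].
Qed.

Let F_exists : exists2 F : C -> C, forall z, hol F z &
  [/\ forall z0, \forall z \near (z0 : C^o)^', F z = F0 z,
      forall z, F (z + 1) = F z &
      forall z, nm (F (z + tau)) =
        nm (F z) * expR ((pi *+ 2) * (b - d%:~R * Im z))].
Proof.
have [F hF FE] := glue_entire F0_local; exists F => //.
have hS c z : hol (fun w => F (w + c)) z.
  apply: (@hol_comp _ F (fun w => w + c)); last exact: hF.
  by apply: holD; [exact: hol_id|exact: hol_cst].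
have sh c z0 : \forall z \near (z0 : C^o)^', F (z + c) = F0 (z + c).
  have /dnbhsC[e e0 H] := FE (z0 + c); apply/dnbhsC; exists e => // z ze zz.
  apply: H; first by have -> : z + c - (z0 + c) = z - z0 by ring.
  by rewrite (inj_eq (addIr _)).
split=> // z.
  apply: (@ccont_punctured_eq R (fun w => F (w + 1)) F z).
  - exact: hol_ccont.
  - exact: hol_ccont.
  by apply: filterS2 (sh 1 z) (FE z) => w -> ->; rewrite F0_1.
rewrite -nm_mult -nmM; congr nm.
apply: (@ccont_punctured_eq R (fun w => F (w + tau)) (fun w => F w * mult w) z).
- exact: hol_ccont.
- by apply: hol_ccont; apply: holM.
by apply: filterS2 (sh tau z) (FE z) => w -> ->; rewrite F0_tau.
Qed.

(** With [Y = Im z] and [t = Im tau], the exponent [al Y^2 + be Y] grows by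
    [2 al t Y + al t^2 + be t] when [z] is translated by [tau]. The two
    coefficients are chosen so that this is the opposite of the exponent
    [2 pi (b - d Y)] of the factor of automorphy; then [al] has the sign of
    [d]. *)
Let metric_exists : 0 < d -> exists (F : C -> C) (al be : R),
  [/\ 0 < al, forall z, hol F z,
      forall z0, \forall z \near (z0 : C^o)^', F z = F0 z &
      forall z w, P z = P w ->
        nm (F z) * expR (al * Im z ^+ 2 + be * Im z) =
        nm (F w) * expR (al * Im w ^+ 2 + be * Im w)].
Proof.
move=> dpos; have [F hF [FF0 F1 Ftau]] := F_exists.
pose t := Im tau; have t_neq0 : t != 0 by rewrite gt_eqF.
pose al := pi * d%:~R / t; pose be := - (al * t ^+ 2 + (pi *+ 2) * b) / t.
exists F, al, be; split.
- by rewrite divr_gt0// mulr_gt0 ?pi_gt0// ltr0z.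
- exact: hF.
- exact: FF0.
pose u z := nm (F z) * expR (al * Im z ^+ 2 + be * Im z).
have u1 z : u (z + 1) = u z by rewrite /u F1 ImD /= addr0.
have ut z : u (z + tau) = u z.
  rewrite /u Ftau ImD -/t -mulrA -expRD; congr (_ * expR _).
  rewrite /be /al; field; exact: t_neq0.
have um (m : int) z : u (z + m%:~R) = u z.
  have H (i : nat) y : u (y + i%:R) = u y.
    by elim: i => [|i IH]; rewrite ?addr0// -addn1 natrD addrA u1.
  case: m => i; first exact: H.
  by rewrite NegzE mulrNz -[in RHS](subrK i.+1%:R z) H.
have un (m : int) z : u (z + m%:~R * tau) = u z.
  have H (i : nat) y : u (y + i%:R * tau) = u y.
    elim: i => [|i IH]; first by rewrite mul0r addr0.
    by rewrite -addn1 natrD mulrDl mul1r addrA ut.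
  case: m => i; first exact: H.
  by rewrite NegzE mulrNz mulNr -[in RHS](subrK (i.+1%:R * tau) z) H.
move=> z w /PP[m [n E]]; rewrite -/(u z) -/(u w).
have -> : z = w + m%:~R + n%:~R * tau by rewrite -addrA -E addrC subrK.
by rewrite un um.
Qed.

Lemma ccont_nm f z : ccont f z -> forall e : R, 0 < e -> exists2 r : R, 0 < r &
  forall w, nm (w - z) < r -> `|nm (f w) - nm (f z)| < e.
Proof.
move=> cf e /cf[r r0 H]; exists r => // w /H; apply: le_lt_trans.
have h1 := nm_tri (f z) 0 (f w); have h2 := nm_tri (f w) 0 (f z).
by move: h1 h2; rewrite !subr0 (nmB (f z)) ler_norml => *; lra.
Qed.

(** A doubly periodic function takes all its values on a compact parallelogram. *)
Let period_max (F : C -> C) (al be : R) : (forall z, hol F z) ->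
  (forall z w, P z = P w ->
    nm (F z) * expR (al * Im z ^+ 2 + be * Im z) =
    nm (F w) * expR (al * Im w ^+ 2 + be * Im w)) ->
  exists z0, forall z, nm (F z) * expR (al * Im z ^+ 2 + be * Im z) <=
    nm (F z0) * expR (al * Im z0 ^+ 2 + be * Im z0).
Proof.
move=> hF per; pose u z := nm (F z) * expR (al * Im z ^+ 2 + be * Im z).
pose pt (xy : R * R) : C := xy.1%:C + xy.2%:C * tau.
pose box : set (R * R) := `[0, 1]%classic `*` `[0, 1]%classic.
have ptIm xy : Im (pt xy) = xy.2 * Im tau.
  by rewrite /pt ImD ImM /= mul0r add0r addr0.
have cpt (xy : R * R) : (nm (F (pt xy'))) @[xy' --> xy] --> nm (F (pt xy)).
  apply: (@cvgrPdist_lt _ R^o _ (nbhs xy) _ _ _).2 => e e0.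
  have [r r0 H] := ccont_nm (hol_ccont (hF (pt xy))) e0.
  have K0 : 0 < 1 + nm tau by rewrite ltr_wpDr ?nm_ge0.
  apply/nbhs_ballP; exists (r / (1 + nm tau)); first by rewrite /= divr_gt0.
  move=> xy' [b1 b2]; rewrite distrC; apply: H.
  have -> : pt xy' - pt xy = (xy'.1 - xy.1)%:C + (xy'.2 - xy.2)%:C * tau.
    by rewrite /pt !rmorphB /=; ring.
  apply: le_lt_trans (nmD _ _) _; rewrite nmM !nm_real.
  move: b1 b2; rewrite -!ball_normE /= !(distrC xy.1) !(distrC xy.2) => b1 b2.
  have -> : r = r / (1 + nm tau) + r / (1 + nm tau) * nm tau.
    by field; exact: lt0r_neq0.
  by apply: ltr_leD => //; apply: ler_wpM2r; [exact: nm_ge0|exact: ltW].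
have cu : {within box, continuous (fun xy => u (pt xy))}.
  apply: continuous_subspaceT => xy.
  apply: (@cvgM _ _ (nbhs xy)); first exact: cpt.
  rewrite (_ : (fun x => _) = (fun xy : R * R => expR (al * (xy.2 * Im tau) ^+ 2 +
    be * (xy.2 * Im tau)))); last by apply/funext => xy'; rewrite ptIm.
  rewrite ptIm; apply: (@continuous_comp _ _ _ (fun xy : R * R => xy.2)
    (fun y : R => expR (al * (y * Im tau) ^+ 2 + be * (y * Im tau)))).
    exact: cvg_snd.
  apply: (@continuous_comp _ _ _ (fun y : R => al * (y * Im tau) ^+ 2 + be * (y * Im tau))
    expR); last exact: continuous_expR.
  have cm : {for xy.2, continuous (fun y : R => y * Im tau)}.
    by apply: cvgM; [exact: cvg_id|exact: cvg_cst].
  apply: cvgD; last by apply: cvgM; [exact: cvg_cst|exact: cm].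
  apply: cvgM; first exact: cvg_cst.
  by rewrite expr2; under eq_fun do rewrite expr2; apply: cvgM; exact: cm.
have box0 : box !=set0.
  by exists (0, 0); split; rewrite /= in_itv /= lexx ler01.
have cbox : compact box by apply: compact_setX; exact: segment_compact.
have [c _ H] := compact_EVT_max box0 cbox cu.
exists (pt c) => z; rewrite -/(u z) -/(u (pt c)).
pose y := Im z / Im tau; pose n := Num.floor y.
pose x := Re z - y * Re tau; pose m := Num.floor x.
have zE : z = x%:C + y%:C * tau.
  apply/eqP; rewrite eq_complex ReD ReM ImD ImM /= !mul0r subr0 addr0 add0r /x subrK.
  by rewrite /y divfK ?eqxx// gt_eqF.
have -> : u z = u (pt (x - m%:~R, y - n%:~R)).
  apply: per; apply/PP; exists m, n; rewrite /pt {1}zE /= !rmorphB /= !rmorph_int.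
  ring.
apply: H; rewrite inE; split; rewrite /= in_itv /=.
  have /andP[h1 h2] := floor_itv x; rewrite -/m in h1 h2.
  by rewrite intrD in h2; apply/andP; split; lra.
have /andP[h1 h2] := floor_itv y; rewrite -/n in h1 h2.
by rewrite intrD in h2; apply/andP; split; lra.
Qed.

(** The weight [al Y^2 + be Y] is the real part of [w], up to a constant, plus
    [al |z - z0|^2 / 2]: it is strictly subharmonic. So the maximality at [z0]
    gives [|F e^w| <= |F z0| exp (- al |z - z0|^2 / 2)] with equality at [z0],
    which contradicts the maximum principle unless [F z0 = 0]. *)
Let no_max (F : C -> C) (al be : R) z0 : 0 < al -> (forall z, hol F z) ->
  (forall z, nm (F z) * expR (al * Im z ^+ 2 + be * Im z) <=
    nm (F z0) * expR (al * Im z0 ^+ 2 + be * Im z0)) -> F z0 = 0.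
Proof.
move=> al0 hF mx; apply/eqP; apply: contraT; rewrite -nm_gt0 => F0p.
(* the slope of the weight at [z0] *)
pose c := 2 * al * Im z0 + be.
pose w z := (- (c%:C * 'i)) * (z - z0) - (al / 2)%:C * (z - z0) ^+ 2.
have Rew z : Re (w z) = c * (Im z - Im z0)
    - al / 2 * ((Re z - Re z0) ^+ 2 - (Im z - Im z0) ^+ 2).
  by rewrite /w !expr2 !(ReD, ReN, ReM, ImD, ImN, ImM) /=; field.
pose f z := F z * cexp (w z).
have hw z : hol w z.
  have hs : hol (fun w : C => w - z0) z by exact: hol_shift.
  apply: holB; first by apply: holM; [exact: hol_cst|exact: hs].
  by apply: holM; [exact: hol_cst|exact: holX].
have hf z : hol f z.
  apply: holM; first exact: hF.
  by apply: (@hol_comp _ (@cexp R) w); [exact: hw|exact: hol_cexp].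
have := @max_square R f z0 1 (nm (F z0) * expR (- (al / 2))) ltr01 (fun z _ => hf z).
have -> : nm (f z0) = nm (F z0).
  rewrite /f nmM nm_cexp Rew !subrr !mulr0 subrr expR0 mulr1.
  by [].
move=> H; have {}H : nm (F z0) <= nm (F z0) * expR (- (al / 2)).
  apply: H => z zon; rewrite /f nmM nm_cexp Rew.
  have z1 : 1 <= (Re z - Re z0) ^+ 2 + (Im z - Im z0) ^+ 2.
    have := onsq_nm ltr01 zon => z1.
    by rewrite -!ReN -!ImN -ReD -ImD -nm_sqr expr_ge1// nm_ge0.
  have := mx z; set A := al * Im z ^+ 2 + _; set A0 := al * Im z0 ^+ 2 + _ => key.
  set W := c * _ - _.
  have key' : nm (F z) <= nm (F z0) * expR (A0 - A).
    by rewrite expRD expRN mulrA ler_pdivlMr ?expR_gt0.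
  apply: le_trans (ler_wpM2r (expR_ge0 W) key') _.
  rewrite -mulrA -expRD ler_pM2l// ler_expR /A /A0 /W /c.
  set Y := Im z; set Y0 := Im z0 in z1 *; set D := (Re z - Re z0) ^+ 2 in z1 *.
  rewrite -subr_ge0.
  have -> : - (al / 2) - (al * Y0 ^+ 2 + be * Y0 - (al * Y ^+ 2 + be * Y) +
    ((2 * al * Y0 + be) * (Y - Y0) - al / 2 * (D - (Y - Y0) ^+ 2))) =
    al / 2 * (D + (Y - Y0) ^+ 2 - 1) by field.
  by rewrite mulr_ge0 ?subr_ge0// divr_ge0// ltW.
have e1 : expR (- (al / 2)) < 1 by rewrite expR_lt1 oppr_lt0 divr_gt0.
by move: H; rewrite leNgt gtr_pMr// e1.
Qed.

(** The vanishing of [F] at the maximum of its weighted modulus makes it vanish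
    everywhere. *)
Theorem order_sum_le0 : 0 < \sum_(x <- S) o x ->
  forall z0, \forall z \near (z0 : C^o)^', h z = 0.
Proof.
move=> dpos z0; have [F [al [be [al0 hF FF0 per]]]] := metric_exists dpos.
have [z1 mx] := period_max hF per; have F1 := no_max al0 hF mx.
have Fz z : F z = 0.
  have := mx z; rewrite F1 nm0 mul0r pmulr_lle0 ?expR_gt0// => H.
  by apply/eqP; rewrite -nm_eq0 eq_le H nm_ge0.
have [V [hV V0 VE]] := theta_prod_local S z0.
have Vn := near_dnbhs (near_neq0 (hol_ccont (nbhs_singleton hV)) V0).
have ne : \forall z \near (z0 : C^o)^', z != z0 by apply/dnbhsC; exists 1.
have VE' : \forall z \near (z0 : C^o)^', theta_prod S z != 0.
  apply: filterS3 VE Vn ne => z -> Vz zz.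
  by rewrite mulf_neq0// expfz_neq0// subr_eq0.
apply: filterS2 (FF0 z0) VE' => z zE Tz.
move: zE; rewrite Fz /F0 => /esym/eqP; rewrite mulf_eq0 (negbTE Tz) orbF.
by move/eqP.
Qed.

End ThetaQuotient.

(** * From the elliptic curve to the plane *)

Section Surface.
Variable R : realType.
Local Notation C := (R[i]).
Variable X : riemannSurface R.
Implicit Types (c : rs_chart X) (x : X) (h : X -> C).

Lemma chart_near c x (U : set X) : rs_dom c x -> open U -> U x ->
  \forall z \near (rs_coord c x : C^o),
    [/\ rs_dom c (rs_par c z), rs_coord c (rs_par c z) = z & U (rs_par c z)].
Proof.
move=> cx oU Ux.
have h1 : \forall z \near (rs_coord c x : C^o), (rs_coord c @` rs_dom c) z.
  by apply: open_nbhs_nbhs; split; [exact: rs_img_open|exists x].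
have h2 : \forall z \near (rs_coord c x : C^o), U (rs_par c z).
  have nU : nbhs (rs_par c (rs_coord c x)) U.
    by rewrite rs_coordK//; exact: open_nbhs_nbhs.
  exact: (rs_par_cont cx nU).
by apply: filterS2 h1 h2 => _ [y cy <-]; rewrite rs_coordK.
Qed.

Lemma holo_near c x (U : set X) f : rs_dom c x -> open U -> U x ->
  holo_on U f -> \forall z \near (rs_coord c x : C^o), hol (f \o rs_par c) z.
Proof.
move=> cx oU Ux hf; apply: filterS (chart_near cx oU Ux) => z [cz zE Uz].
by have := hf c _ cz Uz; rewrite zE.
Qed.

(** The order of [h] at [x] is at least [n], as seen in the chart [c]: unlike in
    an order that is exactly [n], the cofactor [g] may vanish at [x]. *)
Definition order_ge h c x (n : int) (g : C -> C) :=
  (\forall z \near (rs_coord c x : C^o), hol g z) /\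
  \forall z \near (rs_coord c x : C^o)^',
    h (rs_par c z) = (z - rs_coord c x) ^ n * g z.

Variables (tau : C) (P : C -> X).
Hypothesis tau0 : 0 < Im tau.
Hypothesis P_surj : forall x, exists z, P z = x.
Hypothesis PP : forall z w, P z = P w <->
  exists m n : int, z - w = m%:~R + n%:~R * tau.
Hypothesis P_cont : continuous (P : C^o -> X).
Hypothesis P_der : forall c z, rs_dom c (P z) ->
  derivable (rs_coord c \o P : C^o -> C^o) z 1 /\
  derive (rs_coord c \o P : C^o -> C^o) z 1 != 0.

(** The projection is a local biholomorphism, hence preserves orders. *)
Lemma order_lift h c z0 n g : rs_dom c (P z0) -> order_ge h c (P z0) n g ->
  exists G : C -> C, [/\ \forall z \near (z0 : C^o), hol G z,
    \forall z \near (z0 : C^o)^', h (P z) = (z - z0) ^ n * G z &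
    g (rs_coord c (P z0)) != 0 -> G z0 != 0].
Proof.
move=> cz [hg hE]; set b := rs_coord c (P z0) in hg hE *.
pose kap := rs_coord c \o P.
have dom_near : \forall z \near (z0 : C^o), rs_dom c (P z).
  have nU : nbhs (P z0) (rs_dom c).
    by apply: open_nbhs_nbhs; split; [exact: rs_dom_open|].
  exact: (P_cont nU).
have hk : \forall z \near (z0 : C^o), hol kap z.
  by apply: filterS dom_near => z /P_der[].
have [k [hhk kE kd]] := hol_factor hk.
have k0 : k z0 != 0 by have [_ E] := P_der cz; case: kd => _ <-.
have kn := near_neq0 (hol_ccont (nbhs_singleton hhk)) k0.
have kcont : ccont kap z0 := hol_ccont (nbhs_singleton hk).
have pull (Q : C -> Prop) : (\forall w \near (b : C^o), Q w) ->
    \forall z \near (z0 : C^o), Q (kap z).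
  by move=> bQ; move/ccontP : kcont => kcont; exact: (kcont _ bQ).
exists (fun z => k z ^ n * g (kap z)); split.
- apply: filterS3 hhk kn (filterI hk (pull _ hg)) => z h1 h2 [h3 h4]; apply: holM.
    exact: hol_exprz h2 h1.
  by apply: (@hol_comp _ g kap); [exact: h3|exact: h4].
- move/dnbhsC : hE => [e e0 hE].
  have e_near := pull _ (near_disc b e0).
  have ne : \forall z \near (z0 : C^o)^', z != z0 by apply/dnbhsC; exists 1.
  apply: filterS3 ne (near_dnbhs kn) (near_dnbhs (filterI kE (filterI dom_near e_near))).
  move=> z zz kz [kapE [dz bz]].
  have kb : kap z != b.
    by rewrite kapE -subr_eq0 addrC addKr mulf_neq0// subr_eq0.
  have := hE _ bz kb; rewrite /kap /= rs_coordK// => ->.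
  have -> : rs_coord c (P z) - b = (z - z0) * k z.
    by rewrite -[rs_coord c (P z)]/(kap z) kapE -[kap z0]/b addrC addKr.
  by rewrite expfzMl mulrA.
- by move=> gb; rewrite mulf_neq0// expfz_neq0.
Qed.

(** One point where the cofactor does not vanish is enough to exclude that [h] is
    identically zero. *)
Lemma elliptic_order_sum h (o : X -> int) (S : seq X) :
  uniq S -> (forall x, o x != 0 -> x \in S) ->
  (forall x, exists c g, rs_dom c x /\ order_ge h c x (o x) g) ->
  (exists c x g, [/\ rs_dom c x, order_ge h c x (o x) g & g (rs_coord c x) != 0]) ->
  \sum_(x <- S) o x <= 0.
Proof.
move=> uS oS hord [c [x [g [cx hx gx]]]]; rewrite leNgt; apply/negP => dpos.
have [theta [t1 t2 t3 t4 t5]] := theta_exists tau0.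
pose a x := projT1 (cid (P_surj x)).
have Pa y : P (a y) = y by rewrite /a; case: cid.
have hP z w : P z = P w -> h (P z) = h (P w) by move=> ->.
have hl z0 : exists2 g : C -> C, \forall z \near (z0 : C^o), hol g z &
    \forall z \near (z0 : C^o)^', h (P z) = (z - z0) ^ o (P z0) * g z.
  have [c' [g' [cz hz]]] := hord (P z0).
  by have [G [h1 h2 _]] := order_lift cz hz; exists G.
have H := order_sum_le0 tau0 t1 t2 t3 t4 t5 Pa PP hP hl uS oS dpos (a x).
rewrite -(Pa x) in cx hx gx.
have [G [h1 h2 h3]] := order_lift cx hx.
have Gn := near_dnbhs (near_neq0 (hol_ccont (nbhs_singleton h1)) (h3 gx)).
have ne : \forall z \near (a x : C^o)^', z != a x by apply/dnbhsC; exists 1.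
have F : \forall z \near (a x : C^o)^', False.
  apply: filterS3 ne Gn (filterI H h2) => z zz Gz [E1 E2].
  move: E2; rewrite E1 => /esym/eqP; rewrite mulf_eq0 (negbTE Gz) orbF.
  by apply/negP; rewrite expfz_neq0// subr_eq0.
by have [z []] := dnbhs_ex F ltr01.
Qed.

End Surface.

Section EllipticNormalForm.
Variable R : realType.
Local Notation C := (R[i]).

(** Rescaling the plane and changing the sign of a period, the lattice is
    generated by [1] and some [tau] in the upper half plane. *)
Lemma elliptic_normal_form (X : riemannSurface R) : elliptic_curve X ->
  exists (tau : C) (P : C -> X),
    [/\ 0 < Im tau, forall x, exists z, P z = x,
        forall z w, P z = P w <-> exists m n : int, z - w = m%:~R + n%:~R * tau,
        continuous (P : C^o -> X) &
        forall c z, rs_dom c (P z) ->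
          derivable (rs_coord c \o P : C^o -> C^o) z 1 /\
          derive (rs_coord c \o P : C^o -> C^o) z 1 != 0].
Proof.
move=> [w1 [w2 [proj [free surj per cont der]]]].
have w10 : w1 != 0.
  apply/eqP => w10; have [|/eqP] := free 1 0; last by rewrite oner_eq0.
  by rewrite w10 mulr0 mul0r addr0.
pose t := w2 / w1.
have w2E : w2 = t * w1 by rewrite /t divfK.
have It : Im t != 0.
  apply/eqP => It; have tE : t = (Re t)%:C by rewrite [LHS]complexE It mulr0 addr0.
  have [|_ /eqP] := free (- Re t) 1; last by rewrite oner_eq0.
  by rewrite w2E {2}tE rmorphN /=; ring.
pose P z := proj (w1 * z).
have mulw : forall z, hol (fun z : C => w1 * z) z.
  by move=> z; apply: holM; [exact: hol_cst|exact: hol_id].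
have core (tau : C) (e : int) : e * e = 1 -> tau = e%:~R * t -> 0 < Im tau ->
  [/\ 0 < Im tau, forall x, exists z, P z = x,
        forall z w, P z = P w <-> exists m n : int, z - w = m%:~R + n%:~R * tau,
        continuous (P : C^o -> X) &
        forall c z, rs_dom c (P z) ->
          derivable (rs_coord c \o P : C^o -> C^o) z 1 /\
          derive (rs_coord c \o P : C^o -> C^o) z 1 != 0].
  move=> ee tauE tau0; split => //.
  - by move=> x; have [z <-] := surj x; exists (z / w1); rewrite /P mulrC divfK.
  - have eeC : e%:~R * e%:~R = 1 :> C by rewrite -intrM ee.
    move=> z w; rewrite /P per -mulrBr; split=> -[m [n E]]; exists m, (n * e).
      apply: (mulfI w10); rewrite E w2E tauE intrM.
      have -> : n%:~R * e%:~R * (e%:~R * t) = n%:~R * (e%:~R * e%:~R) * t :> C by ring.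
      by rewrite eeC; ring.
    by rewrite E tauE w2E intrM; ring.
  - move=> z; apply: (@continuous_comp C^o C^o X (fun z : C => w1 * z) proj).
      by apply/ccontP; apply: hol_ccont; exact: mulw.
    exact: cont.
  - move=> c z cz; have [d1 d2] := der c (w1 * z) cz.
    have hd : hol (rs_coord c \o P) z.
      by apply: (@hol_comp _ (rs_coord c \o proj) (fun z => w1 * z)); [exact: mulw|exact: d1].
    split; first exact: hd.
    have {d1 d2}[d d0 Hd] : exists2 d : C, d != 0 &
        is_derive ((w1 * z : C) : C^o) 1 (rs_coord c \o proj : C^o -> C^o) d.
      exists (derive (rs_coord c \o proj : C^o -> C^o) (w1 * z) 1); first exact: d2.
      exact: derivableP d1.
    suff H : is_derive (z : C^o) 1 (rs_coord c \o P : C^o -> C^o) (d * w1).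
      by case: H => _ ->; rewrite mulf_neq0.
    apply/is_deriveCP => r r0.
    have n1 : 0 < nm w1 by rewrite nm_gt0.
    have [|s s0 Hs] := (is_deriveCP _ _ _).1 Hd (r / nm w1); first by rewrite divr_gt0.
    exists (s / nm w1); first by rewrite divr_gt0.
    move=> u; rewrite ltr_pdivlMr// mulrC -nmM mulrBr => us.
    have := Hs _ us; rewrite -mulrBr nmM mulrA divfK ?lt0r_neq0//.
    by rewrite -mulrA.
have [tp|tn] := ltrP 0 (Im t).
  by exists t, P; apply: (core t 1) => //; rewrite mul1r.
exists (- t), P; apply: (core (- t) (-1)) => //.
  by rewrite mulrN1z mulN1r.
by rewrite ImN oppr_gt0 lt_neqAle It.
Qed.

End EllipticNormalForm.

(** * Degrees of bundles on an elliptic curve *)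

Section Degree.
Variable R : realType.
Local Notation C := (R[i]).
Variable X : riemannSurface R.
Hypothesis hX : elliptic_curve X.

(** Sums over [X] of finite support become sums over one and the same sequence
    for all functions with support in that of [o]. *)
Lemma finite_support_seq (o : X -> int) : finite_set [set x | o x != 0] ->
  exists S : seq X, [/\ uniq S, forall x, o x != 0 -> x \in S &
    forall f : X -> int, (forall x, o x = 0 -> f x = 0) ->
      \sum_(x \in [set: X]) f x = \sum_(x <- S) f x].
Proof.
move=> /finite_seqP[s sE].
have oS x : o x != 0 -> x \in undup s.
  by move=> ox; rewrite mem_undup; have : [set x | o x != 0] x by []; rewrite sE.
exists (undup s); split; [exact: undup_uniq|exact: oS|].
move=> f f0; rewrite (@fsbigE _ _ _ X setT (undup s)) ?undup_uniq//.
  by under eq_bigl do rewrite in_setT.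
by move=> x _ xS; apply: f0; apply/eqP; apply: contraNT xS => /oS.
Qed.

Lemma elliptic_degree_le0 (h : X -> C) (o : X -> int) :
  finite_set [set x | o x != 0] ->
  (forall x, exists c g, rs_dom c x /\ order_ge h c x (o x) g) ->
  (exists c x g, [/\ rs_dom c x, order_ge h c x (o x) g & g (rs_coord c x) != 0]) ->
  \sum_(x \in [set: X]) o x <= 0.
Proof.
move=> fo h1 h2.
have [tau [P [t0 Ps PP Pc Pd]]] := elliptic_normal_form hX.
have [S [uS oS ->//]] := finite_support_seq fo.
have H := @elliptic_order_sum R X tau P t0 Ps PP Pc Pd h o S uS oS h1 h2.
exact: H.
Qed.

Lemma has_order_ge (h : X -> C) x n c : has_order h x n -> rs_dom c x ->
  exists2 g : C -> C, order_ge h c x n g & g (rs_coord c x) != 0.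
Proof. by move=> hh /hh[g [g1 g2 g3]]; exists g. Qed.

Lemma order_geV (h : X -> C) c x n g : order_ge h c x n g ->
  g (rs_coord c x) != 0 ->
  order_ge (fun y => (h y)^-1) c x (- n) (fun z => (g z)^-1).
Proof.
move=> [g1 g2] g0; have gn := near_neq0 (hol_ccont (nbhs_singleton g1)) g0.
split; first by apply: filterS2 g1 gn => z h1 h2; exact: holV h2 h1.
apply: filterS g2 => z ->.
by rewrite invfM invr_expz.
Qed.

(** Neither [h] nor its inverse has positive degree. *)
Lemma elliptic_degree0 (h : X -> C) (o : X -> int) :
  finite_set [set x | o x != 0] -> (forall x, has_order h x (o x)) ->
  \sum_(x \in [set: X]) o x = 0.
Proof.
move=> fo ho; have [x0 _] := rs_nonempty X; have [c0 cx0] := rs_cover x0.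
have [g0 h0 g0n] := has_order_ge (ho x0) cx0.
have le0 : \sum_(x \in [set: X]) o x <= 0.
  apply: (@elliptic_degree_le0 h) => //.
    move=> x; have [c cx] := rs_cover x; have [g hg _] := has_order_ge (ho x) cx.
    by exists c, g.
  by exists c0, x0, g0.
have ge0 : \sum_(x \in [set: X]) - o x <= 0.
  apply: (@elliptic_degree_le0 (fun x => (h x)^-1)).
  - by under eq_set do rewrite oppr_eq0.
  - move=> x; have [c cx] := rs_cover x; have [g hg gn] := has_order_ge (ho x) cx.
    exists c, (fun z => (g z)^-1); split; first exact: cx.
    exact: (order_geV hg gn).
  - exists c0, x0, (fun z => (g0 z)^-1); split; first exact: cx0.
      exact: (order_geV h0 g0n).
    by rewrite invr_eq0.
apply/eqP; rewrite eq_le le0 /=.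
have -> : \sum_(x \in [set: X]) o x = - \sum_(x \in [set: X]) - o x.
  have [S [_ _ SE]] := finite_support_seq fo.
  by rewrite !SE ?sumrN ?opprK// => x ->; rewrite oppr0.
by rewrite oppr_ge0.
Qed.

(** In a global frame, the wedge of meromorphic sections is a meromorphic
    function. *)
Lemma deg_trivial r (E : vbundle X r) (i : vb_idx E) :
  (forall x, vb_dom E i x) -> deg E = 0.
Proof.
move=> Ei; rewrite /deg; case: xgetP => // d _ [s [o [_ ho fo ->]]].
by apply: (@elliptic_degree0 (wedge s i)) => // x; exact: ho.
Qed.

(** The coordinates of a meromorphic section of [M] in the global frame of [E] are
    its local coordinate times the entries of the matrix of [iota], which are
    holomorphic and do not all vanish at any point. *)
Lemma line_subbundle_deg_le0 r (E : vbundle X r) (i : vb_idx E) (M : vbundle X 1)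
    (iota : fiber_map M E) :
  (forall x, vb_dom E i x) -> subbundle iota -> deg M <= 0.
Proof.
move=> Ei [bi ii]; rewrite /deg; case: xgetP => // d _ [s [o [_ ho fo ->]]].
pose h (k : 'I_r) y : C := vb_triv E i y (iota y (s 0 y)) k 0.
have loc x : exists c g (A : X -> 'M[C]_(r, 1)), [/\ rs_dom c x,
    (forall k, order_ge (h k) c x (o x) (fun z => A (rs_par c z) k 0 * g z)),
    g (rs_coord c x) != 0 & exists k, A x k 0 != 0].
  have [c cx] := rs_cover x; have [j jx] := vb_cover M x.
  have [g hg gn] := has_order_ge (ho j x jx) cx.
  have [A hA AE] := bi j i; exists c, g, A; split => //.
    move=> k; case: hg => g1 g2; split.
      have hAk : holo_on (vb_dom M j `&` vb_dom E i) (fun y => A y k 0) by exact: hA.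
      have oU : open (vb_dom M j `&` vb_dom E i) by apply: openI; exact: vb_dom_open.
      have := holo_near cx oU (conj jx (Ei x)) hAk.
      by move=> H; apply: filterS2 H g1 => z a1 a2; exact: holM a1 a2.
    have dn := near_dnbhs (chart_near cx (@vb_dom_open _ _ _ M j) jx).
    apply: filterS2 g2 dn => z zg [_ _ jz].
    rewrite /h AE; last by split.
    rewrite mxE big_ord1 mulrCA; congr (_ * _); rewrite -zg /wedge /=.
    by rewrite det_mx11 mxE.
  apply: contrapT => nA.
  have Ax : A x = 0.
    apply/matrixP => k l; rewrite ord1 mxE; apply/eqP; apply: contraT => kn.
    by exfalso; apply: nA; exists k.
  have [f fK Kf] := @vb_triv_bij _ _ _ M j x jx.
  have [f' f'K _] := @vb_triv_bij _ _ _ E i x (Ei x).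
  have : f (const_mx 1) = 0.
    apply: (ii x); rewrite linear0; apply: (can_inj f'K).
    by rewrite AE; [rewrite Ax mul0mx linear0|split].
  move=> /(congr1 (vb_triv M j x)); rewrite Kf linear0 => /matrixP/(_ 0 0).
  by rewrite !mxE => /eqP; rewrite oner_eq0.
have [x0 _] := rs_nonempty X; have [c0 [g0 [A0 [cx0 h0 gn0 [k A0k]]]]] := loc x0.
apply: (@elliptic_degree_le0 (h k)) => //.
  move=> x; have [c [g [A [cx hx _ _]]]] := loc x.
  by exists c, (fun z => A (rs_par c z) k 0 * g z).
exists c0, x0, (fun z => A0 (rs_par c0 z) k 0 * g0 z); split => //.
by rewrite rs_coordK// mulf_neq0.
Qed.

End Degree.

(** * The trivial plane bundle *)

Section TrivialPlane.
Variable R : realType.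
Local Notation C := (R[i]).
Variable X : riemannSurface R.
Hypothesis hX : elliptic_curve X.

Let E : vbundle X 2 := dsum_bundle (O_bundle X) (O_bundle X).
Let i0 : vb_idx E := (tt, tt).

Lemma OO_dom x : vb_dom E i0 x. Proof. by split. Qed.

Lemma OO_trivE x (v : vb_fiber E x) :
  vb_triv E i0 x v = col_mx (const_mx v.1 : 'M_(1, 1)) (const_mx v.2 : 'M_(1, 1)).
Proof. by rewrite lfunE /= /dsum_fun /= !scale_homE !mul1r. Qed.

Lemma O_trivE x (v : C^o) i : vb_triv (O_bundle X) i x v = const_mx v.
Proof. by rewrite /= scale_homE mul1r. Qed.

Definition incl_fun (e : C^o * C^o) (v : C^o) : C^o * C^o := (v * e.1, v * e.2).

Lemma incl_fun_linear e : linear (incl_fun e).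
Proof.
move=> k u v; apply: injective_projections => /=.
  by rewrite mulrDl -[k *: u]/(k * u) -[k *: _]/(k * _) mulrA.
by rewrite mulrDl -[k *: u]/(k * u) -[k *: _]/(k * _) mulrA.
Qed.

HB.instance Definition _ e := GRing.isLinear.Build C C^o (C^o * C^o)%type _
  (incl_fun e) (incl_fun_linear e).

Definition incl (e : C^o * C^o) : fiber_map (O_bundle X) E :=
  fun x => linfun (incl_fun e).

Lemma inclE e x (v : C^o) : incl e x v = (v * e.1, v * e.2).
Proof. by rewrite lfunE. Qed.

Lemma incl_subbundle e : e != 0 -> subbundle (incl e).
Proof.
move=> e0; split.
  move=> i [[] []]; exists (fun=> col_mx (const_mx e.1 : 'M[C]_1) (const_mx e.2 : 'M[C]_1)).
    exact: holo_mx_on_cst.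
  move=> x v _; rewrite -[(tt, tt)]/i0 OO_trivE O_trivE inclE /=.
  apply: etrans (esym (mul_col_mx (const_mx e.1 : 'M[C]_1) (const_mx e.2 : 'M[C]_1)
    (const_mx v : 'M[C]_1))).
  by congr col_mx; apply/matrixP => k l; rewrite !mxE big_ord1 !mxE mulrC.
move=> x u v; rewrite !inclE => -[h1 h2].
have [z1|n1] := eqVneq e.1 0; last exact: (mulIf n1 h1).
have n2 : e.2 != 0.
  by apply: contraNneq e0 => z2; apply/eqP; exact: injective_projections.
exact: (mulIf n2 h2).
Qed.

Lemma limg_incl e x : limg (incl e x) = <[(e : vb_fiber E x)]>%VS.
Proof.
apply/vspaceP => u; apply/memv_imgP/vlineP.
  move=> [v _ ->]; exists v; rewrite inclE.
  by apply: injective_projections.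
move=> [k ->]; exists (k : C^o); first exact: memvf.
by rewrite inclE; apply: injective_projections.
Qed.

Lemma deg_O : deg (O_bundle X) = 0.
Proof. exact: (@deg_trivial R X hX 1 (O_bundle X) tt (fun x => I)). Qed.

Lemma deg_OO : deg E = 0.
Proof. exact: (@deg_trivial R X hX 2 E i0 OO_dom). Qed.

Lemma O_max e : e != 0 -> max_line_subbundle (incl e).
Proof.
move=> e0; split; first exact: incl_subbundle.
move=> M iota hM; rewrite deg_O.
exact: (@line_subbundle_deg_le0 R X hX 2 E i0 M iota OO_dom hM).
Qed.

Lemma e1_neq0 : ((1, 0) : C^o * C^o) != 0.
Proof. by apply/eqP => -[/eqP]; rewrite oner_eq0. Qed.

Lemma OO_strictly_semistable : strictly_semistable E.
Proof.
split.
  move=> [//|[|//]] M iota _ hM; rewrite /slope deg_OO mul0r divr1 lerz0.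
  exact: (@line_subbundle_deg_le0 R X hX 2 E i0 M iota OO_dom hM).
move=> /(_ 1%N (O_bundle X) (incl (1, 0)) isT (incl_subbundle e1_neq0)).
by rewrite /slope deg_O deg_OO !mul0r ltxx.
Qed.

(** A line spanned by [e] is the fiber at [p] of the constant subbundle spanned by
    [e]. *)
Lemma OO_bad (p : X) (l : {vspace vb_fiber E p}) : \dim l = 1%N -> bad_line l.
Proof.
move=> dl; pose e := vpick l.
have e0 : e != 0 by rewrite vpick0 -dimv_eq0 dl.
exists (O_bundle X), (incl (e : C^o * C^o)); split; first exact: O_max.
rewrite limg_incl; apply/eqP; rewrite eqEdim dim_vline e0 dl leqnn andbT.
by rewrite -memvE memv_pick.
Qed.

Definition second_fun (v : C^o * C^o) : C^o := v.2.

Lemma second_fun_linear : linear second_fun. Proof. by []. Qed.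

HB.instance Definition _ := GRing.isLinear.Build C (C^o * C^o)%type C^o _
  second_fun second_fun_linear.

Definition second : fiber_map E (O_bundle X) := fun x => linfun second_fun.

Lemma secondE x (v : vb_fiber E x) : second x v = v.2.
Proof. by rewrite lfunE. Qed.

(** The quotient by the first factor is the second factor. *)
Lemma OO_instability : instability_degree E 0.
Proof.
exists (O_bundle X), (O_bundle X), (incl (1, 0)), second.
split; [exact: O_max e1_neq0| |by rewrite subrr].
split.
  move=> [[] []] i; exists (fun=> row_mx (0 : 'M[C]_1) (1%:M : 'M[C]_1)).
    exact: holo_mx_on_cst.
  move=> x v _; rewrite -[(tt, tt)]/i0 OO_trivE O_trivE secondE.
  apply: etrans (esym (mul_row_col (0 : 'M[C]_1) (1%:M : 'M[C]_1)
    (const_mx v.1 : 'M[C]_1) (const_mx v.2 : 'M[C]_1))).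
  by rewrite mul0mx add0r mul1mx.
move=> x; split.
  apply/eqP; rewrite eqEsubv subvf /=; apply/subvP => v _.
  apply/memv_imgP; exists ((0, v) : vb_fiber E x); first exact: memvf.
  by rewrite secondE.
rewrite limg_incl; apply/vspaceP => v; rewrite memv_ker secondE.
apply/eqP/vlineP => [v2|[k ->]]; last by rewrite /= -[k *: _]/(k * 0) mulr0.
exists v.1; apply: injective_projections => /=; first by rewrite -[_ *: _]/(v.1 * 1) mulr1.
by rewrite v2 -[_ *: _]/(v.1 * 0) mulr0.
Qed.

End TrivialPlane.

(** * Holomorphic matrices and bundle maps *)

Section Holo.
Variable R : realType.
Local Notation C := (R[i]).
Variable X : riemannSurface R.
Implicit Types (U V : set X) (f g : X -> C).

Lemma holo_onS U V f : V `<=` U -> holo_on U f -> holo_on V f.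
Proof. by move=> VU hf c x cx /VU; exact: hf. Qed.

Lemma holo_onD U f g : holo_on U f -> holo_on U g -> holo_on U (fun x => f x + g x).
Proof. by move=> hf hg c x cx Ux; exact: holD (hf c x cx Ux) (hg c x cx Ux). Qed.

Lemma holo_onM U f g : holo_on U f -> holo_on U g -> holo_on U (fun x => f x * g x).
Proof. by move=> hf hg c x cx Ux; exact: holM (hf c x cx Ux) (hg c x cx Ux). Qed.

Lemma holo_onV U f : (forall x, U x -> f x != 0) -> holo_on U f ->
  holo_on U (fun x => (f x)^-1).
Proof.
move=> f0 hf c x cx Ux; apply: holV; last exact: hf c x cx Ux.
by rewrite /= rs_coordK// f0.
Qed.

Lemma holo_on_sum (I : Type) (r : seq I) (Q : pred I) U (F : I -> X -> C) :
  (forall i, holo_on U (F i)) -> holo_on U (fun x => \sum_(i <- r | Q i) F i x).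
Proof.
move=> hF; elim: r => [|i r IH].
  have -> : (fun x => \sum_(i <- [::] | Q i) F i x) = (fun=> 0).
    by apply/funext => x; rewrite big_nil.
  exact: holo_on_cst.
have -> : (fun x => \sum_(i <- i :: r | Q i) F i x) =
    (fun x => (if Q i then F i x else 0) + \sum_(i <- r | Q i) F i x).
  by apply/funext => x; rewrite big_cons; case: (Q i); rewrite ?add0r.
by apply: holo_onD IH; case: (Q i); [exact: hF|exact: holo_on_cst].
Qed.

Lemma holo_on_prod (I : Type) (r : seq I) (Q : pred I) U (F : I -> X -> C) :
  (forall i, holo_on U (F i)) -> holo_on U (fun x => \prod_(i <- r | Q i) F i x).
Proof.
move=> hF; elim: r => [|i r IH].
  have -> : (fun x => \prod_(i <- [::] | Q i) F i x) = (fun=> 1).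
    by apply/funext => x; rewrite big_nil.
  exact: holo_on_cst.
have -> : (fun x => \prod_(i <- i :: r | Q i) F i x) =
    (fun x => (if Q i then F i x else 1) * \prod_(i <- r | Q i) F i x).
  by apply/funext => x; rewrite big_cons; case: (Q i); rewrite ?mul1r.
by apply: holo_onM IH; case: (Q i); [exact: hF|exact: holo_on_cst].
Qed.

Lemma holo_mx_onS m n U V (A : X -> 'M[C]_(m, n)) : V `<=` U ->
  holo_mx_on U A -> holo_mx_on V A.
Proof. by move=> VU hA k l; exact: holo_onS VU (hA k l). Qed.

Lemma holo_mx_onM m n q U (A : X -> 'M[C]_(m, n)) (B : X -> 'M[C]_(n, q)) :
  holo_mx_on U A -> holo_mx_on U B -> holo_mx_on U (fun x => A x *m B x).
Proof.
move=> hA hB k l.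
have -> : (fun x => (A x *m B x) k l) = (fun x => \sum_j A x k j * B x j l).
  by apply/funext => x; rewrite mxE.
by apply: holo_on_sum => j; exact: holo_onM (hA k j) (hB j l).
Qed.

Lemma holo_on_det n U (A : X -> 'M[C]_n) :
  holo_mx_on U A -> holo_on U (fun x => \det (A x)).
Proof.
move=> hA; apply: holo_on_sum => s; apply: holo_onM; first exact: holo_on_cst.
by apply: holo_on_prod => k; exact: hA.
Qed.

(** The inverse is written with the adjugate because [invmx A] is a case
    distinction on the invertibility of [A]. *)
Lemma holo_mx_on_inv n U (A : X -> 'M[C]_n) : (forall x, U x -> A x \in unitmx) ->
  holo_mx_on U A -> holo_mx_on U (fun x => (\det (A x))^-1 *: \adj (A x)).
Proof.
move=> Au hA k l.
have -> : (fun x => ((\det (A x))^-1 *: \adj (A x)) k l) =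
    (fun x => (\det (A x))^-1 * ((-1) ^+ (l + k) * \det (row' l (col' k (A x))))).
  by apply/funext => x; rewrite !mxE.
apply: holo_onM.
  apply: holo_onV; last exact: holo_on_det.
  by move=> x /Au; rewrite unitmxE unitfE.
apply: holo_onM; first exact: holo_on_cst.
apply: holo_on_det => k' l'.
have -> : (fun x => row' l (col' k (A x)) k' l') = (fun x => A x (lift l k') (lift k l')).
  by apply/funext => x; rewrite !mxE.
exact: hA.
Qed.

Lemma mulmx_bij n (A : 'M[C]_n) : A \in unitmx ->
  bijective (fun v : 'cV[C]_n => A *m v).
Proof. by move=> Au; exists (fun v => invmx A *m v) => v; rewrite ?mulKmx ?mulKVmx. Qed.

Lemma bij_unitmx n (A : 'M[C]_n) :
  injective (fun v : 'cV[C]_n => A *m v) -> A \in unitmx.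
Proof.
move=> Ai; rewrite -unitmx_tr -row_free_unit; apply: inj_row_free => v vA.
apply: trmx_inj; rewrite trmx0; apply: Ai.
by rewrite mulmx0 -[A]trmxK -trmx_mul vA trmx0.
Qed.

(** The matrix of a linear map in given bases is unique, so that matrices given
    locally agree on overlaps. *)
Lemma bundle_map_local r s (E : vbundle X r) (F : vbundle X s) (phi : fiber_map E F) :
  (forall i j x0, vb_dom E i x0 -> vb_dom F j x0 ->
     exists (V : set X) (A : X -> 'M[C]_(s, r)), [/\ open V, V x0, holo_mx_on V A &
       forall x v, V x -> vb_dom E i x -> vb_dom F j x ->
         vb_triv F j x (phi x v) = A x *m vb_triv E i x v]) ->
  bundle_map phi.
Proof.
move=> loc i j.
pose S x := [set B : 'M[C]_(s, r) | forall v,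
  vb_triv F j x (phi x v) = B *m vb_triv E i x v].
have uS x B B' : vb_dom E i x -> S x B -> S x B' -> B = B'.
  move=> ix hB hB'; have [f _ fK] := @vb_triv_bij _ _ _ E i x ix.
  have BB (w : 'cV[C]_r) : B *m w = B' *m w by rewrite -(fK w) -hB -hB'.
  apply/matrixP => k l; have /matrixP/(_ k 0) := BB (delta_mx l 0).
  by rewrite -!colE !mxE.
have SA x : vb_dom E i x -> vb_dom F j x -> S x (xget 0 (S x)).
  move=> ix jx; have [V [A [_ Vx _ AE]]] := loc i j x ix jx.
  by apply: (@xgetPex _ _ (S x)); exists (A x) => v; exact: AE.
exists (fun x => xget 0 (S x)); last by move=> x v [ix jx]; exact: SA.
move=> k l c x cx [ix jx]; have [V [A [oV Vx hA AE]]] := loc i j x ix jx.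
pose W := V `&` (vb_dom E i `&` vb_dom F j).
have oW : open W by apply: openI => //; apply: openI; exact: vb_dom_open.
apply: (@holo_on_eq _ X W (fun y => A y k l)) => //.
- move=> y [Vy [iy jy]]; congr (fun_of_matrix _ k l).
  by apply: (uS y) => //; [move=> v; exact: AE|exact: SA].
- by apply: holo_onS (hA k l) => y [].
Qed.

(** The inverse of a holomorphic matrix is holomorphic. *)
Lemma bundle_iso_of_bij r (E F : vbundle X r) (phi : fiber_map E F) :
  bundle_map phi -> (forall x, bijective (phi x)) -> bundle_iso E F.
Proof.
move=> hphi bphi; pose psi : fiber_map F E := fun x => (phi x)^-1%VF.
have psiK x : cancel (psi x) (phi x).
  move=> w; apply: limg_lfunVK; have [f _ fK] := bphi x.
  by rewrite -(fK w); apply: memv_img; exact: memvf.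
have phiK x : cancel (phi x) (psi x).
  by move=> v; apply: (bij_inj (bphi x)); rewrite psiK.
exists phi, psi; split => // j i.
have [A hA AE] := hphi i j.
pose U := vb_dom F j `&` vb_dom E i.
have UE : U `<=` vb_dom E i `&` vb_dom F j by move=> x [].
have Au x : U x -> A x \in unitmx.
  move=> [jx ix]; apply: bij_unitmx => u u' uu.
  have [f fK Kf] := @vb_triv_bij _ _ _ E i x ix.
  rewrite -(Kf u) -(Kf u'); congr (vb_triv E i x _).
  apply: (bij_inj (bphi x)); apply: (bij_inj (@vb_triv_bij _ _ _ F j x jx)).
  by rewrite !AE ?Kf//; split.
exists (fun x => (\det (A x))^-1 *: \adj (A x)).
  by apply: holo_mx_on_inv => //; exact: holo_mx_onS UE hA.
move=> x v Ux.
have -> : (\det (A x))^-1 *: \adj (A x) = invmx (A x) by rewrite /invmx Au.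
by rewrite -{2}(psiK x v) AE ?mulKmx ?Au//; exact: UE.
Qed.

(** The cofactor is given by [hol_factor] in the chart [c]; the point is that it is
    holomorphic in all charts, on an open set of the surface. *)
Lemma holo_factor (c : rs_chart X) (p : X) U f : rs_dom c p -> open U -> U p ->
  holo_on U f -> f p = 0 -> exists V g, [/\ open V, V p, V `<=` U `&` rs_dom c,
    holo_on V g & forall x, V x -> f x = (rs_coord c x - rs_coord c p) * g x].
Proof.
move=> cp oU Up hf fp; set b := rs_coord c p.
have [q [hq qE _]] := hol_factor (holo_near cp oU Up hf).
have : \forall z \near (b : C^o), hol q z /\ f (rs_par c z) = (z - b) * q z.
  apply: filterS2 hq qE => z h1 h2; split; first exact: h1.
  by move: h2; rewrite /= rs_coordK// fp add0r.
case/nbhsC=> e e0 He.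
pose V := [set x | [/\ U x, rs_dom c x & nm (rs_coord c x - b) < e]].
exists V, (fun x => q (rs_coord c x)); split.
- rewrite openE => x [Ux cx ex].
  have n1 : nbhs x U by exact: open_nbhs_nbhs.
  have n2 : nbhs x (rs_dom c).
    by apply: open_nbhs_nbhs; split => //; exact: rs_dom_open.
  have n3 : nbhs (rs_coord c x : C^o) [set z | nm (z - b) < e].
    apply/nbhsC; exists (e - nm (rs_coord c x - b)); first by rewrite subr_gt0.
    by move=> z; rewrite ltrBrDr; apply: le_lt_trans; exact: nm_tri.
  have n4 : nbhs x (rs_coord c @^-1` [set z | nm (z - b) < e]).
    exact: (rs_coord_cont cx n3).
  by apply: filterS3 n1 n2 n4 => y ? ? ?; split.
- by split => //; rewrite subrr nm0.
- by move=> x [].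
- move=> d x dx [Ux cx ex]; have [hqx _] := He _ ex.
  apply: (@hol_comp _ q (rs_coord c \o rs_par d)); first exact: rs_transition.
  by rewrite /= rs_coordK.
- by move=> x [Ux cx ex]; have [_] := He _ ex; rewrite rs_coordK.
Qed.

End Holo.

(** * Hecke modifications of the trivial plane bundle *)

Section CoordinateRatio.
Variable R : realType.
Local Notation C := (R[i]).
Variable X : riemannSurface R.

(** Two local coordinates centred at [p] differ by a nonvanishing factor, as
    each is divisible by the other. *)
Lemma coord_ratio (c d : rs_chart X) (p : X) : rs_dom c p -> rs_dom d p ->
  exists (V : set X) (m : X -> C), [/\ open V, V p,
    V `<=` rs_dom c `&` rs_dom d, holo_on V m /\ m p != 0 &
    forall x, V x -> rs_coord d x - rs_coord d p =
      (rs_coord c x - rs_coord c p) * m x].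
Proof.
move=> cp dp.
have hcoord (e : rs_chart X) : holo_on (rs_dom e) (fun x => rs_coord e x - rs_coord e p).
  move=> k x kx ex; apply: holB; last exact: hol_cst.
  exact: rs_transition.
have fac (k e : rs_chart X) : rs_dom k p -> rs_dom e p -> exists V g,
  [/\ open V, V p, V `<=` rs_dom e `&` rs_dom k, holo_on V g &
    forall x, V x -> rs_coord e x - rs_coord e p = (rs_coord k x - rs_coord k p) * g x].
  move=> kp ep; apply: (holo_factor kp (@rs_dom_open _ X e) ep (hcoord e)).
  by rewrite subrr.
have [V [m [oV Vp Vcd hm mE]]] := fac c d cp dp.
have [W [n [oW Wp Wcd hn nE]]] := fac d c dp cp.
exists V, m; split => //; first by move=> x /Vcd[].
split => //.
suff mn : m p * n p = 1.
  by apply/eqP => m0; move: mn; rewrite m0 mul0r => /esym/eqP; rewrite oner_eq0.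
have hmn : hol (fun z => m (rs_par c z) * n (rs_par c z)) (rs_coord c p).
  exact: holM (hm c p cp Vp) (hn c p cp Wp).
have oVW : open (V `&` W) by exact: openI.
have near1 := chart_near cp oVW (conj Vp Wp).
have := @ccont_punctured_eq R (fun z => m (rs_par c z) * n (rs_par c z)) (fun=> 1)
  (rs_coord c p) (hol_ccont hmn) (ccont_cst 1 (rs_coord c p)).
rewrite rs_coordK//; apply.
have ne : \forall z \near (rs_coord c p : C^o)^', z != rs_coord c p.
  by apply/dnbhsC; exists 1.
apply: filterS2 ne (near_dnbhs near1) => z zp [_ zE [Vz Wz]].
have E1 := mE _ Vz; have E2 := nE _ Wz; rewrite zE in E1 E2.
have z0 : z - rs_coord c p != 0 by rewrite subr_eq0.
apply: (mulfI z0).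
by rewrite mulr1 mulrA -E1 -E2.
Qed.

End CoordinateRatio.

Section Hecke.
Variable R : realType.
Local Notation C := (R[i]).
Variable X : riemannSurface R.
Variable p : X.
Let E : vbundle X 2 := dsum_bundle (O_bundle X) (O_bundle X).
Let i0 : vb_idx E := (tt, tt).
Let G : vbundle X 2 := dsum_bundle (O_bundle X) (Ominus_bundle p).
Variables (F : vbundle X 2) (alpha : fiber_map F E).
Variables (T0 : 'M[C]_2) (tauF : forall x, 'Hom(vb_fiber F x, 'cV[C]_2)).
Variables (m0 m1 : C).

(** Away from [p] the new isomorphism is [alpha] followed by the constant
    change of basis [T0]; at [p] its second component is the limit of that of
    [T0 \o alpha] divided by the coordinate, namely [m0 * t0 + m1 * t1]. *)
Definition hecke_fun x (v : vb_fiber F x) : C^o * C^o :=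
  let w := T0 *m vb_triv E i0 x (alpha x v) in
  (w 0 0, if x == p then m0 * tauF x v 0 0 + m1 * tauF x v 1 0 else w 1 0).

Lemma hecke_fun_linear x : linear (@hecke_fun x).
Proof.
move=> k u v; rewrite /hecke_fun !linearP /=.
apply: injective_projections => /=; first by rewrite !mxE.
by case: ifP => _; rewrite !mxE// -[k *: (_ + _)]/(k * (_ + _)); ring.
Qed.

HB.instance Definition _ x := GRing.isLinear.Build C (vb_fiber F x)
  (C^o * C^o)%type _ (@hecke_fun x) (@hecke_fun_linear x).

Definition hecke_map : fiber_map F G := fun x => linfun (@hecke_fun x).

Lemma hecke_mapE x v : hecke_map x v = hecke_fun v.
Proof. by rewrite lfunE. Qed.

Lemma OOm_trivE b x (v : vb_fiber G x) : vb_triv G (tt, b) x v =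
  col_mx (const_mx v.1 : 'M[C]_1) (const_mx (Om_coef p b x * v.2) : 'M[C]_1).
Proof. by rewrite lfunE /= /dsum_fun /= !scale_homE !mul1r. Qed.

Lemma cV2P (A B : 'cV[C]_2) : A 0 0 = B 0 0 -> A 1 0 = B 1 0 -> A = B.
Proof.
move=> h0 h1; apply/matrixP => k l; rewrite ord1.
by case: k => -[|[|//]] hk; [move: h0|move: h1]; congr (_ = _);
  congr (fun_of_matrix _ _ _); apply/val_inj.
Qed.

Lemma col2E (a b : C) : let A : 'cV[C]_2 := col_mx (const_mx a : 'M[C]_1) (const_mx b : 'M[C]_1) in
  A 0 0 = a /\ A 1 0 = b.
Proof.
move=> A; split.
  have := @col_mxEu C 1 1 1 (const_mx a) (const_mx b) 0 0; rewrite [X in _ = X]mxE => <-.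
  by congr (fun_of_matrix _ _ _); exact/val_inj.
have := @col_mxEd C 1 1 1 (const_mx a) (const_mx b) 0 0; rewrite [X in _ = X]mxE => <-.
by congr (fun_of_matrix _ _ _); exact/val_inj.
Qed.

Lemma mulmx2E (A : 'M[C]_2) (v : 'cV[C]_2) k :
  (A *m v) k 0 = A k 0 * v 0 0 + A k 1 * v 1 0.
Proof. by rewrite mxE big_ord_recl big_ord1; do !congr (_ + _); congr (_ * _);
  congr (fun_of_matrix _ _ _); apply/val_inj. Qed.

Definition entries (w : 'cV[C]_2) : C^o * C^o := (w 0 0, w 1 0).

Lemma entries_bij : bijective entries.
Proof.
exists (fun u : C^o * C^o =>
  col_mx (const_mx u.1 : 'M[C]_1) (const_mx u.2 : 'M[C]_1) : 'cV[C]_2).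
  by move=> w; have [h1 h2] := col2E (w 0 0) (w 1 0); exact: cV2P.
by move=> [a b]; have [h1 h2] := col2E a b; rewrite /entries h1 h2.
Qed.

End Hecke.

Section HeckeIso.
Variable R : realType.
Local Notation C := (R[i]).
Variable X : riemannSurface R.
Variable p : X.
Let E : vbundle X 2 := dsum_bundle (O_bundle X) (O_bundle X).
Let i0 : vb_idx E := (tt, tt).
Let G : vbundle X 2 := dsum_bundle (O_bundle X) (Ominus_bundle p).

(** Let [T] be the transition matrix from the constant frame to the frame [tauE]
    in which [alpha] is [diag (1, zc)], and [T0 = T p]. With [L = T0 T^-1],
    [alpha] is [L diag (1, zc)] in the constant frame [T0]. As [L p = 1], the
    entry [L 1 0] vanishes at [p], so that the coordinate at [p] divides the
    second row of this matrix; the quotient is the second row of [N], the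
    matrix of the isomorphism near [p]. Moreover [N p] is lower triangular, with
    diagonal entries [1] and [m1 p != 0]. *)
Theorem hecke_iso (F : vbundle X 2) (alpha : fiber_map F E) :
  hecke_modification p alpha -> bundle_iso F G.
Proof.
move=> [ba bija [c [U [tauE [tauF [oU Up Uc [[bE hE] [bF hF]] rel]]]]]].
have [T hT TE] := hE i0.
have UE x : U x -> (U `&` vb_dom E i0) x by move=> Ux; split => //; exact: OO_dom.
have hTU : holo_mx_on U T by apply: holo_mx_onS hT.
have bi0 x : bijective (vb_triv E i0 x) by apply: vb_triv_bij; exact: OO_dom.
have Tu x : U x -> T x \in unitmx.
  move=> Ux; apply: bij_unitmx => u u' uu; have [f fK Kf] := bi0 x.
  rewrite -(Kf u) -(Kf u'); congr (vb_triv E i0 x _).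
  by apply: (bij_inj (bE x Ux)); rewrite !TE ?Kf//; exact: UE.
pose T0 := T p; pose zc x := rs_coord c x - rs_coord c p.
pose L x := T0 *m ((\det (T x))^-1 *: \adj (T x)).
have LE x : U x -> L x = T0 *m invmx (T x).
  by move=> Ux; rewrite /L /invmx Tu.
have Lp : L p = 1%:M by rewrite LE// mulmxV// Tu.
have hL : holo_mx_on U L.
  by apply: holo_mx_onM; [exact: holo_mx_on_cst|exact: holo_mx_on_inv].
have key x v : U x -> T0 *m vb_triv E i0 x (alpha x v) =
    L x *m (diag_mx (\row_(k < 2) zc x ^+ k) *m tauF x v).
  move=> Ux; rewrite -rel// TE; last exact: UE.
  by rewrite LE// mulmxA mulmxKV// Tu.
have keyk x v (k : 'I_2) : U x -> (T0 *m vb_triv E i0 x (alpha x v)) k 0 =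
    L x k 0 * tauF x v 0 0 + L x k 1 * zc x * tauF x v 1 0.
  move=> Ux; rewrite key// mulmx2E !mul_diag_mx !mxE expr0 expr1 mul1r.
  by rewrite mulrA.
pose a := chart_at p; have ap : rs_dom a p := chart_atP p.
have [V1 [m0 [oV1 V1p V1U hm0 m0E]]] : exists V g, [/\ open V, V p,
    V `<=` U `&` rs_dom a, holo_on V g &
    forall x, V x -> L x 1 0 = (rs_coord a x - rs_coord a p) * g x].
  by apply: (holo_factor ap oU Up (hL 1 0)); rewrite Lp mxE.
have [V2 [m1 [oV2 V2p V2c [hm1 m1p] m1E]]] := coord_ratio ap (Uc p Up).
pose V0 := V1 `&` V2; have oV0 : open V0 by exact: openI.
have V0p : V0 p by [].
have V0U x : V0 x -> U x by move=> [/V1U[]].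
have V0a x : V0 x -> rs_dom a x by move=> [/V1U[]].
pose N x : 'M[C]_2 := \matrix_(k, l)
  if k == 0 then (if l == 0 then L x 0 0 else L x 0 1 * zc x)
  else (if l == 0 then m0 x else L x 1 1 * m1 x).
have hzc : holo_on V0 zc.
  move=> k x kx Vx; apply: holB; last exact: hol_cst.
  by apply: rs_transition => //; exact/Uc/V0U.
have hN : holo_mx_on V0 N.
  have hL0 k l : holo_on V0 (fun x => L x k l) by apply: holo_onS (hL k l).
  have hM0 : holo_on V0 m0 by apply: holo_onS hm0 => x [].
  have hM1 : holo_on V0 m1 by apply: holo_onS hm1 => x [].
  move=> k l; have -> : (fun x => N x k l) = (fun x =>
    if k == 0 then (if l == 0 then L x 0 0 else L x 0 1 * zc x)
    else (if l == 0 then m0 x else L x 1 1 * m1 x)).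
    by apply/funext => x; rewrite mxE.
  case: (k == 0); case: (l == 0).
  - exact: hL0.
  - exact: holo_onM (hL0 0 1) hzc.
  - exact: hM0.
  - exact: holo_onM (hL0 1 1) hM1.
pose phi := hecke_map p alpha T0 tauF (m0 p) (m1 p).
have N0 x v : (N x *m tauF x v) 0 0 = L x 0 0 * tauF x v 0 0 + L x 0 1 * zc x * tauF x v 1 0.
  by rewrite mulmx2E !mxE.
have N1 x v : (N x *m tauF x v) 1 0 = m0 x * tauF x v 0 0 + L x 1 1 * m1 x * tauF x v 1 0.
  by rewrite mulmx2E !mxE.
have phi1 x v : U x -> (phi x v).1 = (N x *m tauF x v) 0 0.
  by move=> Ux; rewrite hecke_mapE /= keyk// N0.
have phi2 x v : V0 x -> Om_coef p true x * (phi x v).2 = (N x *m tauF x v) 1 0.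
  move=> Vx; rewrite hecke_mapE /= /Om_coef /=; have [xp|xp] := eqVneq x p.
    by subst x; rewrite N1 mul1r Lp !mxE mul1r.
  rewrite keyk; last exact: V0U.
  rewrite N1; have [V1x V2x] := Vx.
  have k0 : coord_at p x != 0 by apply: coord_at_neq0 => //; exact: V0a.
  have E1 : L x 1 0 = coord_at p x * m0 x := m0E x V1x.
  have E2 : zc x = coord_at p x * m1 x := m1E x V2x.
  by rewrite E1 E2 /=; field; exact: k0.
apply: (@bundle_iso_of_bij _ X 2 F G phi); last first.
  move=> x; have [xp|xp] := eqVneq x p.
    subst x; have n00 : N p 0 0 = 1 by rewrite mxE /= Lp mxE.
    have n01 : N p 0 1 = 0 by rewrite mxE /= /zc subrr mulr0.
    have n10 : N p 1 0 = m0 p by rewrite mxE.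
    have n11 : N p 1 1 = m1 p by rewrite mxE /= Lp mxE mul1r.
    have Nu : N p \in unitmx.
      apply: bij_unitmx => u u' uu.
      have e0 : u 0 0 = u' 0 0.
        have := congr1 (fun w : 'cV[C]_2 => w 0 0) uu.
        by rewrite !mulmx2E n00 n01 !mul0r !addr0 !mul1r.
      apply: cV2P => //; have := congr1 (fun w : 'cV[C]_2 => w 1 0) uu.
      by rewrite !mulmx2E n10 n11 e0 => /addrI/(mulfI m1p).
    apply: (@eq_bij _ _ (@entries R \o (fun w => N p *m w) \o tauF p)).
      by apply: bij_comp; [apply: bij_comp; [exact: entries_bij|exact: mulmx_bij]|exact: bF].
    move=> v; apply: injective_projections; first by rewrite phi1.
    by rewrite -[LHS]/((N p *m tauF p v) 1 0) -phi2// /Om_coef eqxx andbF mul1r.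
  have T0u : T0 \in unitmx by exact: Tu.
  apply: (@eq_bij _ _ (@entries R \o (fun w => T0 *m w) \o vb_triv E i0 x \o alpha x)).
    apply: bij_comp; last by apply: bija; exact/eqP.
    apply: bij_comp; last exact: bi0.
    by apply: bij_comp; [exact: entries_bij|exact: mulmx_bij].
  by move=> v; rewrite hecke_mapE /hecke_fun (negbTE xp).
apply: bundle_map_local => i [[] b] x0 ix0 [_ bx0].
have [x0p|x0p] := eqVneq x0 p.
  subst x0; case: b bx0 => bx0; last by case: bx0.
  have [H hH HE] := hF i.
  exists (V0 `&` vb_dom F i), (fun x => N x *m H x); split.
  - by apply: openI => //; exact: vb_dom_open.
  - by [].
  - apply: holo_mx_onM; first by apply: holo_mx_onS hN => x [].
    by apply: holo_mx_onS hH => x [/V0U Ux ix].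
  - move=> x v [Vx _] ix [_ bx]; rewrite OOm_trivE -mulmxA -HE; last first.
      by split => //; exact: V0U.
    have [h1 h2] := col2E (phi x v).1 (Om_coef p true x * (phi x v).2).
    by apply: cV2P; rewrite ?h1 ?h2; [apply: phi1; exact: V0U|exact: phi2].
have [A hA AE] := ba i i0.
pose W := Om_dom p false `&` Om_dom p b `&` vb_dom F i.
have hoc : holo_on W (Om_coef p b).
  have := @Om_trans R X p false b; rewrite /Om_coef /=.
  under eq_fun do rewrite divr1.
  by move=> H; apply: holo_onS H => x [].
pose B x : 'M[C]_2 := \matrix_(k, l)
  ((if k == 0 then 1 else Om_coef p b x) * (T0 *m A x) k l).
exists W, B; split.
- by do !apply: openI; [exact: Om_dom_open|exact: Om_dom_open|exact: vb_dom_open].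
- by split; [split => //; exact/eqP|].
- have hTA : holo_mx_on W (fun x => T0 *m A x).
    apply: holo_mx_onM; first exact: holo_mx_on_cst.
    by apply: holo_mx_onS hA => x [_ ix]; split => //; exact: OO_dom.
  move=> k l; have -> : (fun x => B x k l) =
      (fun x => (if k == 0 then 1 else Om_coef p b x) * (T0 *m A x) k l).
    by apply/funext => x; rewrite mxE.
  apply: holo_onM (hTA k l).
  by case: (k == 0); [exact: holo_on_cst|exact: hoc].
- move=> x v [[xp _] _] ix [_ bx].
  have xp' : (x == p) = false by apply/eqP.
  have AEx := AE x v (conj ix (OO_dom x)).
  rewrite OOm_trivE hecke_mapE /hecke_fun xp' AEx mulmxA /=.
  have [h1 h2] := col2E ((T0 *m A x *m vb_triv F i x v) 0 0)
    (Om_coef p b x * (T0 *m A x *m vb_triv F i x v) 1 0).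
  have BE k l : B x k l = (if k == 0 then 1 else Om_coef p b x) * (T0 *m A x) k l.
    by rewrite mxE.
  by apply: cV2P; rewrite ?h1 ?h2 !mulmx2E !BE /=; ring.
Qed.

End HeckeIso.

Theorem theorem5p20 (R : realType) (X : riemannSurface R)
    (hX : elliptic_curve X) (p : X) :
  let E : vbundle X 2 := dsum_bundle (O_bundle X) (O_bundle X) in
  [/\ strictly_semistable E,
      instability_degree E 0,
      forall l : {vspace vb_fiber E p}, \dim l = 1%N -> bad_line l &
      forall (F : vbundle X 2) (alpha : fiber_map F E),
        hecke_modification p alpha ->
        bundle_iso F (dsum_bundle (O_bundle X) (Ominus_bundle p))].
Proof.
split.
- exact: OO_strictly_semistable.
- exact: OO_instability.
- by move=> l; exact: OO_bad.
- by move=> F alpha; exact: hecke_iso.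
Qed.
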